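(* Let $\rho : G \to O(V)$ be an orthogonal representation of a finite group $G$ on a real finite-dimensional Euclidean vector space $V$, and let $\sigma_1,\ldots,\sigma_n$ be a minimal system of homogeneous generators of positive degree of $\mathbb{R}[V]^G$, with orbit map $\sigma=(\sigma_1,\ldots,\sigma_n): V \to \mathbb{R}^n$. Write $V = V_1 \oplus \cdots \oplus V_l$ as an orthogonal direct sum of irreducible $G$-invariant subspaces $V_i$. For each $i$ choose $v_i \in V_i \setminus \{0\}$ such that the cardinality of the isotropy group $G_{v_i}$ is maximal (among isotropy groups of vectors in $V_i\setminus\{0\}$), and put $k = \max\{d(\rho),\ |G|/|G_{v_i}| : 1 \le i \le l\}$. Then any curve $c = (c_1,\ldots,c_n) : \mathbb{R} \to V/G = \sigma(V) \subseteq \mathbb{R}^n$ of class $C^{k}$ admits a global differentiable lift $\bar{c} : \mathbb{R} \to V$ with locally bounded derivative.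
   Context: $\mathbb{R}[V]^G$ is the (finitely generated) algebra of $G$-invariant real polynomials on $V$. The orbit map $\sigma$ induces a homeomorphism of $V/G$ onto $\sigma(V)\subseteq\mathbb{R}^n$, and these are identified; a curve in $V/G$ is of class $C^k$ if it is $C^k$ as a curve in $\mathbb{R}^n$. A lift of $c$ is a curve $\bar c$ in $V$ with $\sigma\circ\bar c = c$. The derivative is locally bounded if $\|\bar c'\|$ is bounded on every compact subset of the domain. $G_v=\{g\in G: g.v=v\}$ is the isotropy group. $d(\rho)$ denotes the maximum of the degrees of the elements of a minimal system of homogeneous generators of positive degree of $\mathbb{R}[V]^G$ (this is independent of the choice of the minimal system). *)

(* Defs.v *)
From HB Require Import structures.
From mathcomp Require Import all_boot all_order all_algebra all_fingroup.
From mathcomp Require Import mxrepresentation.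
From mathcomp Require mpoly.

Set Implicit Arguments.
Unset Strict Implicit.
Unset Printing Implicit Defensive.

Import Order.TTheory GRing.Theory Num.Theory.

Local Open Scope ring_scope.

(* The Euclidean space V is R^m, as row vectors with the standard inner
   product u *m v^T.  As usual for mx_representation, g acts on the right by
   v |-> v *m rG g; this is the left action v |-> rho(g^-1) v, so orbits,
   isotropy groups, invariants and invariant subspaces are unaffected. *)

(* Importing mpoly only inside this module avoids clashes between its
   notations and those of MathComp-Analysis. *)
Module Invariants.
Import mpoly.

Section Invariants.
Variables (R : realFieldType) (gT : finGroupType) (G : {group gT}) (m : nat).
Variable rG : mx_representation R G m.

Definition orthogonal_repr : Prop :=
  forall g, g \in G -> rG g *m (rG g)^T = 1%:M.

Definition poly_fun (p : {mpoly R[m]}) (v : 'rV[R]_m) : R :=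
  p.@[fun j => v 0 j].

Definition invariant (p : {mpoly R[m]}) : Prop :=
  forall g, g \in G -> forall v, poly_fun p (v *m rG g) = poly_fun p v.

Definition generates_invariants (s : seq {mpoly R[m]}) : Prop :=
  (forall p, p \in s -> invariant p) /\
  (forall p, invariant p ->
     exists q : {mpoly R[size s]}, p = q \mPo in_tuple s).

(* No proper subsystem of s generates.  The constant 0 is d.-homog for all d,
   but it is ruled out by minimality. *)
Definition minimal_homog_generators (s : seq {mpoly R[m]}) : Prop :=
  [/\ forall p, p \in s -> exists2 d : nat, (0 < d)%N & p \is d.-homog,
      generates_invariants s &
      forall s', subseq s' s -> generates_invariants s' -> s' = s].

(* d(rho), computed from a minimal system of homogeneous generators s;
   msize is the degree plus one. *)
Definition max_degree (s : seq {mpoly R[m]}) : nat :=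
  (\max_(p <- s) (msize p).-1)%N.

Definition orbit_map n (sigma : n.-tuple {mpoly R[m]}) (v : 'rV[R]_m) :
  'rV[R]_n := \row_i poly_fun (tnth sigma i) v.

(* The direct summands are the row spaces of the matrices U i. *)
Definition orthogonal_irreducible_decomposition l (U : 'I_l -> 'M[R]_m) :
  Prop :=
  [/\ forall i, mxsimple rG (U i),
      (\sum_i U i :=: 1%:M)%MS,
      mxdirect (\sum_i U i) &
      forall i j, i != j -> U i *m (U j)^T = 0].

Definition maximal_isotropy (W : 'M[R]_m) (v : 'rV[R]_m) : Prop :=
  [/\ (v <= W)%MS, v != 0 &
      forall w : 'rV[R]_m, (w <= W)%MS -> w != 0 ->
        (#|rstab rG w| <= #|rstab rG v|)%N].

End Invariants.
End Invariants.
Export Invariants.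

From mathcomp Require Import boolp classical_sets reals topology normedtype.
From mathcomp Require Import derive.
Import numFieldNormedType.Exports.

Local Open Scope classical_set_scope.

Definition class_C (R : realType) (V : normedModType R) (k : nat)
    (f : R -> V) : Prop :=
  (forall j, (j < k)%N -> forall t, derivable (f^`(j)) t 1) /\
  continuous (f^`(k)).

(* The library norm on 'rV_m is the sup norm. *)
Definition euclidean_norm (R : realType) m (v : 'rV[R]_m) : R :=
  Num.sqrt ((v *m v^T) 0 0).

Definition locally_bounded (R : realType) m (f : R -> 'rV[R]_m) : Prop :=
  forall K : set R, compact K ->
    exists M : R, forall t, K t -> euclidean_norm (f t) <= M.

(* Main.v *)
Require Import Defs.
From mathcomp Require Import all_boot all_order all_algebra all_fingroup.
From mathcomp Require Import mxrepresentation.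
From mathcomp Require mpoly.
From mathcomp Require Import boolp classical_sets reals topology normedtype.
From mathcomp Require Import derive.
From mathcomp Require Import realfun.
From mathcomp Require Import ring lra.

Set Implicit Arguments.
Unset Strict Implicit.
Unset Printing Implicit Defensive.

Import Order.TTheory GRing.Theory Num.Theory.
Import numFieldNormedType.Exports.
Import (canonicals, coercions) mpoly.

Local Open Scope ring_scope.
Local Open Scope classical_set_scope.

(** The curve [c] is lifted pointwise by choice to an arbitrary curve [x] in the
    representation space; every invariant polynomial is then a function of class
    C^k along [x] (predicate [orbit_UC]), because it is a polynomial in the
    components of [c]. Everything is proved for curves of orbits under a
    subgroup [H] of [G], by induction on the order of [H], and rests on two ways
    of making the group smaller or the curve simpler.

    Slices. Near a time where [x] takes the value [v], representatives of the
    orbits can be chosen so that [dot ^~ v] is larger on them than on the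
    translates by elements outside the isotropy group of [v]. Its value is then
    a simple root of a polynomial with [H]-invariant coefficients, hence of class
    C^k, and by Lagrange interpolation so are all invariants of the isotropy
    group ([orbit_UC_stab]). The property that invariants of degree at most [k]
    generate also passes to isotropy groups: near [v] an invariant of the latter
    agrees to any order with an invariant of [H] ([generated_stab]). After
    subtracting the average over [H], which has invariant components, the isotropy
    groups of nonzero vectors are proper subgroups.

    Zooming. At a zero, or in general with the distance to the origin as unit of
    length and time, a homogeneous invariant of degree [e <= k] is divided by the
    [e]-th power of the unit. Its derivatives of order at least [e] do not grow,
    and those of lower order are controlled by interpolation between the
    function and its [e]-th derivative ([orbit_UC_zoom]). This is where [k] must
    bound the degrees of generators.

    Velocity bound ([deriv_boundedP], after Bronshtein). The square length of a
    curve is a nonnegative function of class C^2; this bounds the velocity at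
    zeros, and after zooming puts the remaining curves on the unit sphere, which
    is compact and where the induction hypothesis applies through a slice.
    Stating the bound for families of curves ([UC], [deriv_bounded]) makes all
    constants uniform, and translates of one curve form such a family, so the
    bound is locally uniform in time.

    Existence ([lift_exists]). Where the curve does not vanish a slice and the
    induction hypothesis give a local differentiable lift. At a zero the zoomed
    curves converge to an orbit ([blowup_converges]): if this is the origin, any
    lift is stationary there; if not, the zero is isolated, and by finiteness of
    the orbit the lifts on either side can be moved by group elements so as to
    have the same derivative ([local_lift_at_zero]). Lifts on overlapping
    intervals are glued in the same way: two differentiable lifts agree to first
    order at a given time up to one group element, since some element carries one
    to the other along a sequence of times ([lifts_match]). *)

(** * Differentiable functions of one variable *)

Section ScalarCalculus.
Context {R : realType}.
Implicit Types (f g : R -> R) (a b s t l : R).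

Lemma near_oo a b t : a < t < b -> \forall s \near t, a < s < b.
Proof.
move=> tab; have : t \in `]a, b[%R by rewrite in_itv.
move/near_in_itvoo; apply: filterS => z; by rewrite in_itv.
Qed.

Lemma is_derive_ext_oo f g a b t l : a < t < b ->
  (forall s, a < s < b -> f s = g s) -> is_derive t 1 f l -> is_derive t 1 g l.
Proof.
move=> tab fg; apply: near_eq_is_derive.
by apply: filterS (near_oo tab) => s; exact: fg.
Qed.

Lemma is_derive_continuous f t l : is_derive t 1 f l -> {for t, continuous f}.
Proof.
by move=> [df _]; apply: differentiable_continuous; apply/derivable1_diffP.
Qed.

Lemma mvt (f df : R -> R) a b s t :
  (forall x, a < x < b -> is_derive x 1 f (df x)) -> a < s < b -> a < t < b ->
  exists x : R, [/\ a < x < b, `|x - s| <= `|t - s|, `|x - t| <= `|t - s| &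
                `|f t - f s| = `|df x| * `|t - s|].
Proof.
move=> fdf.
wlog st : s t / s <= t.
  move=> H sab tab; case: (leP s t) => [st|/ltW ts]; first exact: H.
  have [x [xab x1 x2 fx]] := H _ _ ts tab sab.
  by rewrite (distrC t s) (distrC (f t)); exists x.
move=> /andP[as_ sb] /andP[at_ tb].
have [||c] := @MVT_segment _ f df s t st.
- move=> x; rewrite in_itv /= => /andP[sx xt]; apply: fdf.
  by rewrite (lt_trans as_ sx) (lt_trans xt tb).
- apply: derivable_within_continuous => x; rewrite in_itv /= => /andP[sx xt].
  apply: (@ex_derive _ _ _ _ _ _ (df x)); apply: fdf.
  by rewrite (lt_le_trans as_ sx) (le_lt_trans xt tb).
rewrite in_itv /= => /andP[sc ct] ->; exists c.
split; last by rewrite normrM.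
- by rewrite (lt_le_trans as_ sc) (le_lt_trans ct tb).
- by rewrite !ger0_norm ?subr_ge0 // lerB.
- by rewrite distrC !ger0_norm ?subr_ge0 // lerB.
Qed.

(** Differentiability in the form needed for comparing, gluing and rescaling
   curves, where no algebra of derivatives is involved. *)
Definition dlin f t l :=
  forall e, 0 < e -> exists2 d : R, 0 < d &
    forall s, `|s - t| < d -> `|f s - f t - l * (s - t)| <= e * `|s - t|.

Lemma dlinP f t l : dlin f t l <-> is_derive t 1 f l.
Proof.
split=> [H|[df <-] e e0].
  suff H1 : h^-1 *: (f (h *: 1 + t) - f t) @[h --> 0^'] --> l.
    by apply: DeriveDef; [apply/cvg_ex; exists l | apply: cvg_lim].
  apply/cvgrPdist_le => e e0; have [d d0 Hd] := H _ e0.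
  near=> h.
  have h0 : h != 0 by near: h; exact: nbhs_dnbhs_neq.
  have hd : `|h| < d by near: h; exact: dnbhs0_lt.
  have := Hd (h + t); rewrite addrK => /(_ hd).
  rewrite /= (_ : h *: (1 : R) = h); last by rewrite /GRing.scale /= mulr1.
  rewrite -ler_pdivrMr ?normr_gt0 //; apply: le_trans.
  rewrite -normf_div distrC mulrBl mulfK // le_eqVlt; apply/orP; left.
  by rewrite /GRing.scale /= [h^-1 * _]mulrC.
have /cvg_ex[/= l0 Hl] := df.
have -> : 'D_1 f t = l0 by exact: cvg_lim Hl.
move/cvgrPdist_le : Hl => /(_ _ e0)[/= d d0 Hd].
exists d => // s std.
have [->|snt] := eqVneq s t; first by rewrite !subrr mulr0 subrr normr0 mulr0.
have := Hd (s - t); rewrite /ball_ /= sub0r normrN => /(_ std).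
rewrite subr_eq0 => /(_ snt).
rewrite (_ : (s - t) *: (1 : R) = s - t); last by rewrite /GRing.scale /= mulr1.
rewrite subrK -ler_pdivrMr ?normr_gt0 ?subr_eq0 // -normf_div mulrBl.
rewrite mulfK ?subr_eq0 // distrC /GRing.scale /= [_^-1 * _]mulrC.
by apply: le_trans.
Unshelve. all: by end_near. Qed.

Lemma is_derive_aff f c s t l :
  is_derive (s + c * t) 1 f l ->
  is_derive t 1 (fun x => f (s + c * x)) (c * l).
Proof.
move=> H; rewrite mulrC; apply: (@is_derive1_comp _ f (fun x => s + c * x)) => //.
apply/dlinP => e e0; exists 1 => // x _.
rewrite [X in `|X|](_ : _ = 0) ?normr0 ?mulr_ge0 ?(ltW e0) //; ring.
Qed.

Lemma is_derive_mul f g t l l' : is_derive t 1 f l -> is_derive t 1 g l' ->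
  is_derive t 1 (fun x => f x * g x) (f t * l' + g t * l).
Proof. by move=> ? ?; exact: (@is_deriveM _ _ f g). Qed.

Lemma is_derive_add f g t l l' : is_derive t 1 f l -> is_derive t 1 g l' ->
  is_derive t 1 (fun x => f x + g x) (l + l').
Proof. by move=> ? ?; exact: (@is_deriveD _ _ _ f g). Qed.

Lemma is_derive_inv f t l : f t != 0 -> is_derive t 1 f l ->
  is_derive t 1 (fun x => (f x)^-1) (- (l * ((f t)^-1 * (f t)^-1))).
Proof.
move=> f0 [df <-]; apply: DeriveDef; first exact: derivableV.
by rewrite deriveV // /GRing.scale /= expr2 invfM mulNr mulrC.
Qed.

End ScalarCalculus.

(** * Families with uniformly bounded derivatives *)

(** The family stands for a quantifier over curves placed inside the regularity
   class: one constant bounds all its members, so uniform estimates are obtained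
   without computing the constants. *)
Fixpoint UC {R : realType} (I : Type) (k : nat) (a b : R) (f : I -> R -> R) :
    Prop :=
  (exists M : R, forall i t, a < t < b -> `|f i t| <= M) /\
  match k with
  | 0%N => True
  | k'.+1 => exists2 df : I -> R -> R,
      forall i t, a < t < b -> is_derive t 1 (f i) (df i t) & UC k' a b df
  end.

Section UniformClass.
Context {R : realType}.
Implicit Types (I J : Type) (k : nat) (a b s t l : R).

Lemma UC_bounded I k a b (f : I -> R -> R) : UC k a b f ->
  exists2 M : R, 0 < M & forall i t, a < t < b -> `|f i t| <= M.
Proof.
have H : (exists M, forall i t, a < t < b -> `|f i t| <= M) ->
    exists2 M : R, 0 < M & forall i t, a < t < b -> `|f i t| <= M.
  move=> [M HM]; exists (1 + `|M|); first by rewrite ltr_pwDl.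
  move=> i t tab; apply: le_trans (HM i t tab) _.
  by apply: le_trans (ler_norm _) _; rewrite lerDr.
by case: k => [|k] [/H].
Qed.

Lemma UC_ext I k a b (f g : I -> R -> R) :
  (forall i t, a < t < b -> f i t = g i t) -> UC k a b f -> UC k a b g.
Proof.
move=> fg; case: k => [|k] [[M HM] H]; split=> //.
- by exists M => i t tab; rewrite -fg //; exact: HM.
- by exists M => i t tab; rewrite -fg //; exact: HM.
case: H => df Hd Hdf; exists df => // i t tab.
by apply: is_derive_ext_oo tab _ (Hd i t tab) => s; exact: fg.
Qed.

Lemma UCS I k a b (f : I -> R -> R) : UC k.+1 a b f -> UC k a b f.
Proof.
elim: k f => [|k IH] f [HM [df Hd Hdf]]; split=> //; exists df => //.
exact: IH.
Qed.

Lemma UC_le I k k' a b (f : I -> R -> R) : (k' <= k)%N ->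
  UC k a b f -> UC k' a b f.
Proof.
move=> /subnK <-; elim: (k - k')%N => [//|n IH]; rewrite addSn => /UCS.
exact: IH.
Qed.

Lemma UC_sub I k a b a' b' (f : I -> R -> R) : a <= a' -> b' <= b ->
  UC k a b f -> UC k a' b' f.
Proof.
move=> aa bb; have S t : a' < t < b' -> a < t < b.
  by move=> /andP[h1 h2]; rewrite (le_lt_trans aa h1) (lt_le_trans h2 bb).
elim: k f => [|k IH] f [[M HM] H]; split=> //.
- by exists M => i t /S; exact: HM.
- by exists M => i t /S; exact: HM.
case: H => df Hd Hdf; exists df; last exact: IH.
by move=> i t /S; exact: Hd.
Qed.

Lemma UC_continuous I k a b (f : I -> R -> R) i t : (0 < k)%N ->
  UC k a b f -> a < t < b -> {for t, continuous (f i)}.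
Proof.
case: k => // k _ [_ [df Hd _]] tab; exact: is_derive_continuous (Hd i t tab).
Qed.

Lemma UC_const I k a b (c : I -> R) M : (forall i, `|c i| <= M) ->
  UC k a b (fun i _ => c i).
Proof.
elim: k c M => [|k IH] c M cM; split=> //; do ?[by exists M => i t _].
exists (fun _ _ => 0); first by move=> i t _; exact: is_derive_cst.
by apply: (IH _ 0) => _; rewrite normr0.
Qed.

Lemma UC_cst I k a b (c : R) : UC k a b (fun (_ : I) _ => c).
Proof. exact: UC_const. Qed.

Lemma UC_add I k a b (f g : I -> R -> R) : UC k a b f -> UC k a b g ->
  UC k a b (fun i t => f i t + g i t).
Proof.
elim: k f g => [|k IH] f g [[M HM] H] [[N HN] H']; (split; first
  by exists (M + N) => i t tab; apply: le_trans (ler_normD _ _) _;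
     apply: lerD; [exact: HM | exact: HN]) => //.
case: H H' => df Hd Hdf [dg Hd' Hdg].
exists (fun i t => df i t + dg i t); last exact: IH.
by move=> i t tab; apply: is_derive_add; [exact: Hd | exact: Hd'].
Qed.

Lemma UC_mul I k a b (f g : I -> R -> R) : UC k a b f -> UC k a b g ->
  UC k a b (fun i t => f i t * g i t).
Proof.
elim: k f g => [|k IH] f g Hf Hg.
  case: Hf Hg => [[M HM] _] [[N HN] _]; split=> //; exists (M * N) => i t tab.
  by rewrite normrM; apply: ler_pM => //; [exact: HM | exact: HN].
have := UCS Hf; have := UCS Hg; case: Hf Hg.
move=> [M HM] [df Hd Hdf] [[N HN] [dg Hd' Hdg]] Hg Hf; split.
  exists (M * N) => i t tab.
  by rewrite normrM; apply: ler_pM => //; [exact: HM | exact: HN].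
exists (fun i t => f i t * dg i t + g i t * df i t).
  by move=> i t tab; apply: is_derive_mul; [exact: Hd | exact: Hd'].
by apply: UC_add; apply: IH.
Qed.

Lemma UC_opp I k a b (f : I -> R -> R) : UC k a b f ->
  UC k a b (fun i t => - f i t).
Proof.
move=> H; apply: UC_ext (UC_mul (UC_cst I k a b (- 1)) H) => i t _.
by rewrite mulN1r.
Qed.

Lemma UC_sum I T (r : seq T) (P : pred T) k a b (f : T -> I -> R -> R) :
  (forall x, P x -> UC k a b (f x)) ->
  UC k a b (fun i t => \sum_(x <- r | P x) f x i t).
Proof.
move=> H; elim: r => [|x r IH].
  by apply: UC_ext (UC_cst I k a b 0) => i t _; rewrite big_nil.
case: (boolP (P x)) => Px.
  apply: UC_ext (UC_add (H x Px) IH) => i t _; by rewrite big_cons Px.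
by apply: UC_ext IH => i t _; rewrite big_cons (negPf Px).
Qed.

Lemma UC_prod I T (r : seq T) (P : pred T) k a b (f : T -> I -> R -> R) :
  (forall x, P x -> UC k a b (f x)) ->
  UC k a b (fun i t => \prod_(x <- r | P x) f x i t).
Proof.
move=> H; elim: r => [|x r IH].
  by apply: UC_ext (UC_cst I k a b 1) => i t _; rewrite big_nil.
case: (boolP (P x)) => Px.
  apply: UC_ext (UC_mul (H x Px) IH) => i t _; by rewrite big_cons Px.
by apply: UC_ext IH => i t _; rewrite big_cons (negPf Px).
Qed.

Lemma UC_exp I k a b (f : I -> R -> R) n : UC k a b f ->
  UC k a b (fun i t => f i t ^+ n).
Proof.
move=> H; elim: n => [|n IH]; first exact: UC_cst.
by apply: UC_ext (UC_mul H IH) => i t _; rewrite exprS.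
Qed.

Lemma UC_inv I k a b (f : I -> R -> R) e : 0 < e ->
  (forall i t, a < t < b -> e <= `|f i t|) -> UC k a b f ->
  UC k a b (fun i t => (f i t)^-1).
Proof.
move=> e0 He; elim: k => [|k IH] Hf.
  split=> //; exists e^-1 => i t tab; rewrite normfV lef_pV2 ?posrE //.
    exact: He.
  exact: lt_le_trans (He _ _ tab).
have Hk := IH (UCS Hf); have [M _ HM] := UC_bounded Hk.
split; first by exists M.
case: Hf => _ [df Hd Hdf].
exists (fun i t => - (df i t * ((f i t)^-1 * (f i t)^-1))); last first.
  by apply: UC_opp; do 2?apply: UC_mul.
move=> i t tab; apply: is_derive_inv; last exact: Hd.
by rewrite -normr_gt0 (lt_le_trans e0) // He.
Qed.

Lemma UC_affine I J k a b a' b' (f : I -> R -> R) (h : J -> I) (s c : J -> R)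
  C : (forall j, `|c j| <= C) ->
  (forall j t, a' < t < b' -> a < s j + c j * t < b) ->
  UC k a b f -> UC k a' b' (fun j t => f (h j) (s j + c j * t)).
Proof.
move=> cC Hab; elim: k f => [|k IH] f [[M HM] H].
  by split=> //; exists M => j t tab; apply: HM; exact: Hab.
split; first by exists M => j t tab; apply: HM; exact: Hab.
case: H => df Hd Hdf.
exists (fun j t => c j * df (h j) (s j + c j * t)).
  by move=> j t /Hab tab; apply: is_derive_aff; exact: Hd.
by apply: UC_mul; [exact: (@UC_const _ _ _ _ _ C) | exact: IH].
Qed.

Lemma UC_reindex I J k a b (f : I -> R -> R) (h : J -> I) :
  UC k a b f -> UC k a b (fun j => f (h j)).
Proof.
elim: k f => [|k IH] f [[M HM] H].
  by split=> //; exists M => j t; exact: HM.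
split; first by exists M => j t; exact: HM.
by case: H => df Hd Hdf; exists (fun j => df (h j)); [move=> j; exact: Hd | exact: IH].
Qed.

End UniformClass.

(** * Second-order estimates *)

Section SecondOrder.
Context {R : realType}.
Implicit Types (I : Type) (k : nat) (a b s t : R).

Lemma UC_lipschitz I k a b (f : I -> R -> R) : (0 < k)%N -> UC k a b f ->
  exists2 M : R, 0 < M & forall i s t, a < s < b -> a < t < b ->
    `|f i t - f i s| <= M * `|t - s|.
Proof.
case: k => // k _ [_ [df Hd /UC_bounded[M M0 HM]]]; exists M => // i s t sab tab.
have [x [xab _ _ ->]] := mvt (Hd i) sab tab.
by rewrite ler_wpM2r // HM.
Qed.

Lemma UC_taylor2 I k a b (f : I -> R -> R) : (1 < k)%N -> UC k a b f ->
  exists2 M : R, 0 < M & exists2 df : I -> R -> R,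
    forall i s, a < s < b -> is_derive s 1 (f i) (df i s) &
    forall i s t, a < s < b -> a < t < b ->
      `|f i t - f i s - df i s * (t - s)| <= M * (t - s) ^+ 2.
Proof.
case: k => [//|[//|k]] _ [_ [df Hd Hdf]].
have [M M0 HM] := UC_lipschitz (ltn0Sn k) Hdf.
exists M => //; exists df => // i s t sab tab.
pose g x := f i x + (- df i s) * x.
have Hg x : a < x < b -> is_derive x 1 g (df i x - df i s).
  move=> xab; rewrite /g; apply: is_derive_add; first exact: Hd.
  have := @is_derive_aff _ (fun x => x) (- df i s) 0 x 1.
  rewrite mulr1 => /(_ (is_derive_id _ _)).
  by apply: is_derive_ext_oo xab _ => y _; rewrite add0r.
have [x [xab x1 _]] := mvt Hg sab tab.
rewrite /g (_ : _ - _ = f i t - f i s - df i s * (t - s)); last by ring.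
move=> ->; rewrite -real_normK ?num_real // expr2 mulrA ler_wpM2r //.
by apply: le_trans (HM i s x sab xab) _; rewrite ler_wpM2l // ltW.
Qed.

(** At distance [h] on the descending side a nonnegative function is still
   nonnegative; this bounds its slope by its value. *)
Lemma slope_bound (f0 d M r h : R) : 0 < h -> h < r ->
  (forall t, `|t| < r -> 0 <= f0 + d * t + M * t ^+ 2) ->
  `|d| * h <= f0 + M * h ^+ 2.
Proof.
move=> h0 hr H; case: (leP 0 d) => d0.
  have := H (- h); rewrite normrN gtr0_norm // => /(_ hr).
  by rewrite sqrrN mulrN addrAC subr_ge0 (ger0_norm d0).
have := H h; rewrite gtr0_norm // => /(_ hr).
by move=> H1; rewrite (ltr0_norm d0) mulNr -subr_ge0 opprK addrAC.
Qed.

(** At a zero of a nonnegative function the slope vanishes, so only the second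
   order term of the expansion remains. *)
Lemma UC_zero_quadratic I k a b t0 (f : I -> R -> R) : (1 < k)%N ->
  UC k a b f -> (forall i t, a < t < b -> 0 <= f i t) -> a < t0 < b ->
  exists2 M : R, 0 < M & forall i t, f i t0 = 0 -> a < t < b ->
    f i t <= M * (t - t0) ^+ 2.
Proof.
move=> k1 Hf f0 t0ab; have [M M0 [df Hd HM]] := UC_taylor2 k1 Hf.
exists M => // i t fit0 tab.
have df0 : df i t0 = 0.
  case/andP: t0ab => at0 t0b.
  pose r : R := Num.min (t0 - a) (b - t0).
  have r0 : 0 < r by rewrite /r lt_min !subr_gt0 at0.
  have Hs h : 0 < h -> h < r -> `|df i t0| * h <= 0 + M * h ^+ 2.
    move=> h0 hr; apply: slope_bound h0 hr _ => s.
    rewrite /r lt_min !ltr_norml => /andP[/andP[s1 _] /andP[_ s2]].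
    have sab : a < t0 + s < b by apply/andP; split; lra.
    have := HM i t0 (t0 + s); rewrite at0 t0b => /(_ isT sab).
    have := f0 i _ sab; rewrite fit0 (_ : t0 + s - t0 = s); last by ring.
    by move=> f1; rewrite ler_norml => /andP[_]; lra.
  apply: contrapT => /eqP dn0; have d0 : 0 < `|df i t0| by rewrite normr_gt0.
  (* For this [h] the slope is at least [2 * M * h], contradicting [Hs]. *)
  pose h := Num.min (r / 2) (`|df i t0| / (2 * M)).
  have h0 : 0 < h by rewrite lt_min !divr_gt0 // mulr_gt0.
  have hr : h < r by rewrite gt_min; apply/orP; left; lra.
  have := Hs h h0 hr; rewrite add0r expr2 mulrA ler_pM2r // => H1.
  have H2 : h <= `|df i t0| / (2 * M) by rewrite ge_min lexx orbT.
  have : M * h <= M * (`|df i t0| / (2 * M)) by rewrite ler_pM2l.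
  rewrite (_ : M * (_ / _) = `|df i t0| / 2); first by move=> H3; lra.
  by field; rewrite gt_eqF.
have := HM i t0 t t0ab tab; rewrite fit0 df0 subr0 mul0r subr0.
by apply: le_trans; exact: ler_norm.
Qed.

End SecondOrder.

(** * Peano expansion and interpolation of derivatives *)

Section Chains.
Context {R : realType}.
Implicit Types (I : Type) (k n : nat) (a b s t e M C : R).

Fixpoint nth_deriv I n a b (f g : I -> R -> R) : Prop :=
  match n with
  | 0%N => forall i t, a < t < b -> f i t = g i t
  | n'.+1 => exists2 df : I -> R -> R,
      forall i t, a < t < b -> is_derive t 1 (f i) (df i t) &
      nth_deriv n' a b df g
  end.

Lemma UC_nth_deriv I n k a b (f : I -> R -> R) : UC (n + k) a b f ->
  exists2 g, nth_deriv n a b f g & UC k a b g.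
Proof.
elim: n f => [|n IH] f; first by move=> H; exists f.
by rewrite addSn => -[_ [df Hd /IH[g Hg Hk]]]; exists g => //; exists df.
Qed.

Lemma nth_derivSr I n a b (f g : I -> R -> R) : nth_deriv n.+1 a b f g ->
  exists2 h : I -> R -> R, nth_deriv n a b f h &
    forall i t, a < t < b -> is_derive t 1 (h i) (g i t).
Proof.
elim: n f => [|n IH] f.
  move=> [df Hd /= H]; exists f => // i t tab.
  by rewrite -H //; exact: Hd.
move=> [df Hd /IH[h H1 H2]]; exists h => //; by exists df.
Qed.

Lemma nth_deriv_affine I n a b a' b' (A s c : I -> R) (f g : I -> R -> R) :
  (forall i t, a' < t < b' -> a < s i + c i * t < b) ->
  nth_deriv n a b f g ->
  nth_deriv n a' b' (fun i t => A i * f i (s i + c i * t))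
                    (fun i t => A i * c i ^+ n * g i (s i + c i * t)).
Proof.
move=> Hab; elim: n A f => [|n IH] A f.
  by move=> /= H i t tab; rewrite expr0 mulr1 H // Hab.
move=> [df Hd H]; exists (fun i t => (A i * c i) * df i (s i + c i * t)).
  move=> i t tab; have := is_derive_aff (Hd i _ (Hab i t tab)).
  move/(is_derive_mul (is_derive_cst (A i) _ _)).
  by move=> H1; apply: is_derive_eq H1 _; rewrite mulr0 addr0 mulrA.
have := IH (fun i => A i * c i) df H.
set F := (X in nth_deriv n a' b' _ X -> _); rewrite (_ : F = fun i t =>
  A i * c i ^+ n.+1 * g i (s i + c i * t)) //.
by apply/funext => i; apply/funext => t; rewrite /F exprS !mulrA.
Qed.

Lemma nth_derivB I n a b (f g f' g' : I -> R -> R) :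
  nth_deriv n a b f g -> nth_deriv n a b f' g' ->
  nth_deriv n a b (fun i t => f i t - f' i t) (fun i t => g i t - g' i t).
Proof.
elim: n f f' => [|n IH] f f'; first by move=> /= H H' i t tab; rewrite H ?H'.
move=> [df Hd H] [df' Hd' H']; exists (fun i t => df i t - df' i t).
  by move=> i t tab; exact: is_deriveB (Hd i t tab) (Hd' i t tab).
exact: IH.
Qed.

Lemma nth_deriv_sub I n a b a' b' (f g : I -> R -> R) : a <= a' -> b' <= b ->
  nth_deriv n a b f g -> nth_deriv n a' b' f g.
Proof.
move=> aa bb; have S t : a' < t < b' -> a < t < b.
  by move=> /andP[h1 h2]; rewrite (le_lt_trans aa h1) (lt_le_trans h2 bb).
elim: n f => [|n IH] f /=; first by move=> H i t /S; exact: H.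
by move=> [df Hd /IH H]; exists df => // i t /S; exact: Hd.
Qed.

(** The difference of step half the length of the interval of a bounded function
   is bounded and, by the mean value theorem, is the step times a value of the
   derivative; iterating reaches the [n]-th derivative. *)
Lemma nth_deriv_somewhere_bounded I n a b (f g : I -> R -> R) (M : R) : a < b ->
  nth_deriv n a b f g -> (forall i t, a < t < b -> `|f i t| <= M) ->
  exists C : R, forall i, exists2 x : R, a < x < b & `|g i x| <= C.
Proof.
elim: n a b f g M => [|n IH] a b f g M ab.
  move=> /= H HM; exists M => i; have mab : a < (a + b) / 2 < b.
    by apply/andP; split; lra.
  by exists ((a + b) / 2) => //; rewrite -H // HM.
move=> /nth_derivSr[h Hh Hg] HM; pose d := (b - a) / 2.
have d0 : 0 < d by rewrite divr_gt0 // subr_gt0.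
have ab' : a < b - d by rewrite /d; lra.
have S t : a < t < b - d -> a < t < b.
  by move=> /andP[h1 h2]; rewrite h1 /=; lra.
have S' t : a < t < b - d -> a < d + 1 * t < b.
  by move=> /andP[h1 h2]; apply/andP; split; lra.
have H1 := nth_deriv_affine (fun=> 1) (c := fun=> 1) (s := fun=> d)
  (fun i t => S' t) Hh.
have H2 : nth_deriv n a (b - d) f h.
  by apply: nth_deriv_sub Hh => //; lra.
have [|C HC] := IH _ _ _ _ (M + M) ab' (nth_derivB H1 H2).
  move=> i t tab; apply: le_trans (ler_normB _ _) _; rewrite mul1r.
  by apply: lerD; apply: HM; [exact: S' | exact: S].
exists (C / d) => i; have [x xab] := HC i.
rewrite expr1n !mul1r => Hx.
have := S' x xab; rewrite mul1r => x'ab.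
have [y [yab _ _ Hy]] := mvt (Hg i) (S x xab) x'ab.
exists y => //; move: Hx; rewrite Hy addrK (gtr0_norm d0).
by rewrite ler_pdivlMr.
Qed.

(** The derivative of order one less than the top is bounded at one point, by
   [nth_deriv_somewhere_bounded], and then everywhere because the top one is
   bounded; going down, all intermediate derivatives are bounded. *)
Lemma UC_interpolation I n k a b (f g : I -> R -> R) (M : R) : a < b ->
  nth_deriv n a b f g -> (forall i t, a < t < b -> `|f i t| <= M) ->
  UC k a b g -> UC (n + k) a b f.
Proof.
move=> ab + HM; elim: n k g => [|n IH] k g.
  by move=> H; apply: UC_ext => i t tab; rewrite -H.
move=> /nth_derivSr[h Hh Hg] Hk; rewrite addSnnS; apply: (IH k.+1 h) => //.
split; last by exists g.
have [C HC] := nth_deriv_somewhere_bounded ab Hh HM.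
have [N N0 HN] := UC_bounded Hk.
exists (C + N * (b - a)) => i t tab; have [x xab Hx] := HC i.
have [y [yab _ _ Hy]] := mvt (Hg i) xab tab.
rewrite -(subrK (h i x) (h i t)) addrC; apply: le_trans (ler_normD _ _) _.
apply: lerD => //; rewrite Hy; apply: ler_pM => //; first exact: HN.
case/andP: xab => x1 x2; case/andP: tab => t1 t2.
by rewrite ler_norml; apply/andP; split; lra.
Qed.

(** The expansion of the derivative is integrated: the mean value theorem raises
   the order of the remainder by one. *)
Lemma UC_peano I n a b t0 (f : I -> R -> R) i : a < t0 < b ->
  UC n.+1 a b f ->
  exists2 T : {poly R}, (size T <= n.+2)%N &
    forall e, 0 < e -> exists2 d : R, 0 < d & forall s, `|s - t0| < d ->
      `|f i s - T.[s - t0]| <= e * `|s - t0| ^+ n.+1.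
Proof.
move=> t0ab; elim: n f => [|n IH] f [_ [df Hd Hdf]].
  exists ((df i t0) *: 'X + (f i t0)%:P).
    rewrite (leq_trans (size_polyD _ _)) // geq_max.
    rewrite (leq_trans (size_scale_leq _ _)) ?size_polyX //.
    by rewrite (leq_trans (size_polyC_leq1 _)).
  have /dlinP H := Hd i t0 t0ab.
  move=> e /H [d d0 Hd']; exists d => // s /Hd'; rewrite !hornerE expr1.
  by rewrite opprD addrCA addrA [_ - _ - _]addrAC [- _ + _]addrC -addrA addrC.
have [T1 sT1 HT1] := IH _ Hdf.
pose T : {poly R} := \poly_(j < n.+3)
  (if j is j'.+1 then T1`_j' / j'.+1%:R else f i t0).
have dT : deriv T = T1.
  apply/polyP => j; rewrite coef_deriv coef_poly ltnS.
  case: ltnP => [|jn]; last by rewrite mul0rn nth_default // (leq_trans sT1).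
  by move=> _; rewrite -[LHS]mulr_natr divfK // pnatr_eq0.
have T0 : T.[0] = f i t0 by rewrite horner_coef0 coef_poly.
exists T; first exact: size_poly.
pose g s := f i s - T.[s - t0].
have Hg s : a < s < b -> is_derive s 1 g (df i s - T1.[s - t0]).
  move=> sab; apply: is_deriveB; first exact: Hd.
  have := @is_derive_aff _ (horner T) 1 (- t0) s (T1.[s - t0]).
  rewrite !mul1r addrC -dT => /(_ (is_derive_poly _ _)).
  by apply: is_derive_ext_oo sab _ => y _; rewrite mul1r addrC.
move=> e e0; have [d d0 Hd'] := HT1 _ e0.
have /andP[at0 t0b] := t0ab.
pose d' := Num.min d (Num.min (t0 - a) (b - t0)).
exists d'; first by rewrite !lt_min d0 !subr_gt0 at0.
move=> s; rewrite !lt_min !ltr_norml => /and3P[sd /andP[s1 _] /andP[_ s2]].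
have sab : a < s < b by apply/andP; split; lra.
have [x [xab x1 _]] := mvt Hg t0ab sab.
rewrite {2}/g subrr T0 subrr subr0 => ->; rewrite [_ ^+ n.+2]exprSr mulrA.
rewrite ler_wpM2r //; apply: le_trans (Hd' x _) _.
  by apply: le_lt_trans x1 _; rewrite ltr_norml.
by rewrite ler_wpM2l ?(ltW e0) // lerXn2r ?nnegrE.
Qed.

(** Letting [s] tend to [0] shows that [0] is a root, which can be divided out. *)
Lemma poly_eq_monomial n (T : {poly R}) (C d : R) : 0 < d -> (size T <= n.+1)%N ->
  (forall s, 0 < `|s| < d -> `|T.[s]| <= C * `|s| ^+ n) ->
  exists c : R, forall s, T.[s] = c * s ^+ n.
Proof.
move=> d0; elim: n T => [|n IH] T sT H.
  by exists T`_0 => s; rewrite (size1_polyC sT) hornerC coefC mulr1.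
have T0 : root T 0.
  rewrite /root; apply: contrapT => /negP T0.
  have c0 : {for 0, continuous (horner T)} by exact: continuous_horner.
  have /cvgrPdist_lt /(_ (`|T.[0]| / 2)) := c0.
  rewrite divr_gt0 ?normr_gt0 // => /(_ isT) /nbhs_ballP[r /= r0 Hr].
  have C0 : 0 < 1 + `|C| by rewrite ltr_pwDl.
  have E0 : 0 < `|T.[0]| by rewrite normr_gt0.
  pose s := Num.min (Num.min (d / 2) (r / 2))
                    (Num.min 1 (`|T.[0]| / 2 / (1 + `|C|))).
  have s0 : 0 < s by rewrite !lt_min !divr_gt0 // ltr01.
  have sd : s < d by rewrite !gt_min; apply/orP; left; apply/orP; left; lra.
  have sr : s < r.
    by rewrite !gt_min; apply/orP; left; apply/orP; right; lra.
  have s1 : s <= 1 by rewrite !ge_min lexx !orbT.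
  have sE : s <= `|T.[0]| / 2 / (1 + `|C|) by rewrite !ge_min lexx !orbT.
  have := Hr s; rewrite /ball /= sub0r normrN gtr0_norm // => /(_ sr) H1.
  have := H s; rewrite gtr0_norm // s0 sd => /(_ isT) H2.
  have H3 : C * s ^+ n.+1 <= `|T.[0]| / 2.
    apply: (@le_trans _ _ ((1 + `|C|) * s)).
      apply: le_trans (ler_wpM2r _ (_ : C <= 1 + `|C|)) _.
      - by rewrite exprn_ge0 // ltW.
      - by apply: le_trans (ler_norm C) _; rewrite lerDr.
      rewrite ler_wpM2l ?(ltW C0) // exprS -[leRHS]mulr1.
      by rewrite ler_wpM2l ?(ltW s0) // exprn_ile1 // ltW.
    by rewrite mulrC -ler_pdivlMr.
  have : `|T.[0]| <= `|T.[0] - T.[s]| + `|T.[s]|.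
    by rewrite -{1}(subrK T.[s] T.[0]) ler_normD.
  lra.
have /factor_theorem[T1 ET] := T0.
have ET' s : T.[s] = T1.[s] * s by rewrite ET hornerM hornerXsubC subr0.
have [||c Hc] := IH T1; last first.
- by exists c => s; rewrite ET' Hc exprSr mulrA.
- move=> s /andP[s0 sd]; have := H s; rewrite s0 sd => /(_ isT).
  by rewrite ET' normrM exprSr mulrA ler_pM2r.
have [->|T1n] := eqVneq T1 0; first by rewrite size_poly0.
by move: sT; rewrite ET size_Mmonic ?monicXsubC // size_XsubC addn2.
Qed.

(** The Taylor polynomial of order [n] of a function that is [O(|s - t0| ^+ n)]
   is of that size too, hence a monomial. *)
Lemma UC_leading_term I n a b t0 (f : I -> R -> R) i C d : a < t0 < b ->
  (0 < n)%N -> UC n a b f -> 0 < d ->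
  (forall s, `|s - t0| < d -> `|f i s| <= C * `|s - t0| ^+ n) ->
  exists c : R, forall e, 0 < e -> exists2 d : R, 0 < d &
    forall s, `|s - t0| < d ->
      `|f i s - c * (s - t0) ^+ n| <= e * `|s - t0| ^+ n.
Proof.
case: n => // n t0ab _ Hf d0 HC.
have [T sT HT] := UC_peano i t0ab Hf.
have [d1 d10 H1] := HT 1 ltr01.
have d20 : 0 < Num.min d d1 by rewrite lt_min d0.
have [|c Hc] := poly_eq_monomial (C := C + 1) d20 sT; last first.
  by exists c => e /HT[d2 d2_0 H2]; exists d2 => // s /H2; rewrite Hc.
move=> s /andP[s0]; rewrite lt_min => /andP[sd sd1].
have Es : t0 + s - t0 = s by rewrite addrC addKr.
have := H1 (t0 + s); rewrite Es mul1r => /(_ sd1) h1.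
have := HC (t0 + s); rewrite Es => /(_ sd) h2.
rewrite mulrDl mul1r -(subrK (f i (t0 + s)) T.[s]) addrC.
by apply: le_trans (ler_normD _ _) _; rewrite lerD // distrC.
Qed.

End Chains.

(** * Simple roots of polynomials with differentiable coefficients *)

Section SimpleRoots.
Context {R : realType}.
Implicit Types (I : Type) (k n : nat) (a b s t e : R).

(** The increment of the second factor is multiplied by the value of the first,
   which is zero. *)
Lemma is_derive_mul_continuous (f g : R -> R) t l : f t = 0 ->
  is_derive t 1 f l -> {for t, continuous g} ->
  is_derive t 1 (fun x => f x * g x) (l * g t).
Proof.
move=> ft0 [df <-] gc; have /cvg_ex[/= l0 Hl] := df.
have -> : 'D_1 f t = l0 by exact: cvg_lim Hl.
suff H1 : h^-1 *: (f (h *: 1 + t) * g (h *: 1 + t) - f t * g t) @[h --> 0^']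
    --> l0 * g t.
  by apply: DeriveDef; [apply/cvg_ex; exists (l0 * g t) | apply: cvg_lim].
have gc' : g (h *: (1 : R) + t) @[h --> 0^'] --> g t.
  have H0 : h *: (1 : R) + t @[h --> (0 : R)^'] --> t.
    apply/cvgrPdist_lt => e e0; near=> h.
    rewrite opprD addrCA subrr addr0 normrN /GRing.scale /= mulr1.
    by near: h; exact: dnbhs0_lt.
  by apply: cvg_comp H0 gc.
apply: cvg_trans (cvgM Hl gc'); apply: near_eq_cvg; near=> h.
by rewrite /= ft0 mul0r !subr0 /GRing.scale /= mulrA.
Unshelve. all: by end_near. Qed.

Lemma horner_sub_divided (p : {poly R}) n (x y : R) : (size p <= n)%N ->
  p.[x] - p.[y] =
  (x - y) * \sum_(j < n) p`_j * \sum_(i < j) x ^+ (j.-1 - i) * y ^+ i.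
Proof.
move=> sp; rewrite !(horner_coef_wide _ sp) -sumrB mulr_sumr.
by apply: eq_bigr => j _; rewrite -mulrBr subrXX mulrCA.
Qed.

Lemma horner_deriv_wide (p : {poly R}) n (x : R) : (size p <= n)%N ->
  p^`().[x] = \sum_(j < n) p`_j * (x ^+ j.-1 *+ j).
Proof.
move=> sp; have {1}-> : p = \sum_(j < n) p`_j *: 'X^j.
  rewrite -poly_def; apply/polyP => j; rewrite coef_poly; case: ltnP => // nj.
  by rewrite nth_default // (leq_trans sp).
rewrite raddf_sum horner_sum; apply: eq_bigr => j _.
by rewrite /= derivZ derivXn hornerZ hornerMn hornerXn.
Qed.

Lemma continuous_sum_at (T : Type) (r : seq T) (f : T -> R -> R) t :
  (forall x, {for t, continuous (f x)}) ->
  {for t, continuous (fun s => \sum_(x <- r) f x s)}.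
Proof.
move=> H; elim: r => [|x r IH].
  have -> : (fun s => \sum_(x <- [::]) f x s) = fun=> 0.
    by apply/funext => s; rewrite big_nil.
  exact: cvg_cst.
have -> : (fun s => \sum_(y <- x :: r) f y s) =
    fun s => f x s + \sum_(y <- r) f y s.
  by apply/funext => s; rewrite big_cons.
by apply: cvgD; [exact: H | exact: IH].
Qed.

Lemma is_derive_sum_seq (T : Type) (r : seq T) (f : T -> R -> R) (df : T -> R)
  t : (forall x, is_derive t 1 (f x) (df x)) ->
  is_derive t 1 (fun s => \sum_(x <- r) f x s) (\sum_(x <- r) df x).
Proof.
move=> H; elim: r => [|x r IH].
  have -> : (fun s => \sum_(x <- [::]) f x s) = fun=> 0.
    by apply/funext => s; rewrite big_nil.
  by rewrite big_nil; exact: is_derive_cst.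
have -> : (fun s => \sum_(y <- x :: r) f y s) =
    fun s => f x s + \sum_(y <- r) f y s.
  by apply/funext => s; rewrite big_cons.
by rewrite big_cons; apply: is_derive_add.
Qed.

(** Implicit differentiation at a simple root: dividing the equation
   [p t (l t) - p t (l t0) = - p t (l t0)] by the divided difference, which is
   continuous and tends to the derivative of [p t0]. *)
Lemma is_derive_simple_root a b n (p : R -> {poly R}) (dp : 'I_n -> R)
    (l : R -> R) t0 : a < t0 < b -> (forall t, (size (p t) <= n)%N) ->
  (forall j : 'I_n, is_derive t0 1 (fun t => (p t)`_j) (dp j)) ->
  {for t0, continuous l} -> (forall t, a < t < b -> root (p t) (l t)) ->
  (p t0)^`().[l t0] != 0 ->
  is_derive t0 1 l
    (- ((\sum_(j < n) dp j * l t0 ^+ j) / (p t0)^`().[l t0])).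
Proof.
move=> t0ab sp Hdp lc Hr Hd.
pose K t := \sum_(j < n) (p t)`_j * \sum_(i < j) l t ^+ (j.-1 - i) * l t0 ^+ i.
have K0 : K t0 = (p t0)^`().[l t0].
  rewrite (horner_deriv_wide _ (sp t0)); apply: eq_bigr => j _; congr (_ * _).
  rewrite (eq_bigr (fun=> l t0 ^+ j.-1)) ?sumr_const ?card_ord // => i _.
  by rewrite -exprD subnK // -ltnS prednK // (leq_ltn_trans _ (ltn_ord i)).
have Kc : {for t0, continuous K}.
  apply: continuous_sum_at => j; apply: cvgM.
    exact: is_derive_continuous (Hdp j).
  apply: continuous_sum_at => i; apply: cvgM; last exact: cvg_cst.
  exact: continuous_comp lc (@exprn_continuous _ _ _).
pose f t := (p t).[l t0].
have df : is_derive t0 1 f (\sum_(j < n) dp j * l t0 ^+ j).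
  have -> : f = fun t => \sum_(j < n) (p t)`_j * l t0 ^+ j.
    by apply/funext => t; rewrite /f (horner_coef_wide _ (sp t)).
  apply: is_derive_sum_seq => j.
  have := is_derive_mul (Hdp j) (is_derive_cst (l t0 ^+ j) t0 1).
  by rewrite mulr0 add0r mulrC.
have f0 : f t0 = 0 by apply/rootP; exact: Hr.
have Kn : K t0 != 0 by rewrite K0.
have Kic : {for t0, continuous (fun t => (K t)^-1)} by exact: cvgV.
have := is_derive_mul_continuous f0 df Kic.
move/(is_derive_mul (is_derive_cst (- 1 : R) t0 1)).
rewrite mulr0 addr0 => /(is_derive_add (is_derive_cst (l t0) t0 1)).
rewrite add0r mulN1r K0; apply: near_eq_is_derive.
have Knz : \forall t \near t0, K t != 0.
  move/cvgrPdist_lt : Kc => /(_ `|K t0|); rewrite normr_gt0 => /(_ Kn).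
  apply: filterS => t; apply: contraTneq => ->.
  by rewrite subr0 ltxx.
apply: filterS2 Knz (near_oo t0ab) => t Kt tab /=.
have := horner_sub_divided (l t) (l t0) (sp t).
rewrite (rootP (Hr t tab)) sub0r -/(K t) => E.
by rewrite /functions.cst /= mulN1r -mulNr E mulfK // addrC subrK.
Qed.

(** The formula for the derivative of the root expresses it through the root
   itself, which bootstraps its regularity up to that of the coefficients. *)
Lemma UC_simple_root I k n a b (p : I -> R -> {poly R}) (l : I -> R -> R) e :
  0 < e -> (forall i t, (size (p i t) <= n)%N) ->
  (forall j, UC k a b (fun i t => (p i t)`_j)) ->
  (forall i t, a < t < b -> {for t, continuous (l i)}) ->
  UC 0 a b l -> (forall i t, a < t < b -> root (p i t) (l i t)) ->
  (forall i t, a < t < b -> e <= `|(p i t)^`().[l i t]|) -> UC k a b l.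
Proof.
case: k => [//|k] e0 sp Hp lc lb lr He.
have /choice[dp Hdp] : forall j, exists dpj : I -> R -> R,
    (forall i t, a < t < b -> is_derive t 1 (fun t => (p i t)`_j) (dpj i t)) /\
    UC k a b dpj.
  by move=> j; have [_ [df H1 H2]] := Hp j; exists df.
suff H m : (m <= k.+1)%N -> UC m a b l by exact: H.
elim: m => [//|m IH] mk; have lm := IH (ltnW mk).
split; first by case: lb.
exists (fun i t => - ((\sum_(j < n) dp j i t * l i t ^+ j) /
                      (p i t)^`().[l i t])).
  move=> i t tab; apply: (is_derive_simple_root (a := a) (b := b)) => //.
  - by move=> j; have [H _] := Hdp j; exact: H.
  - exact: lc.
  - exact: lr.
  by rewrite -normr_gt0 (lt_le_trans e0) // He.
apply: UC_opp; apply: UC_mul.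
  apply: UC_sum => j _; apply: UC_mul; last exact: UC_exp.
  by apply: (UC_le (k := k)) => //; have [] := Hdp j.
apply: UC_inv e0 He _.
apply: (@UC_ext _ _ _ _ _ (fun i t => \sum_(j < n) (p i t)`_j *
    (l i t ^+ j.-1 * j%:R))).
  move=> i t _; rewrite (horner_deriv_wide _ (sp i t)).
  by apply: eq_bigr => j _; rewrite mulr_natr.
apply: UC_sum => j _; apply: UC_mul; first exact: UC_le (ltnW mk) (Hp j).
by apply: UC_mul; [exact: UC_exp | exact: UC_cst].
Qed.

End SimpleRoots.

(** * Polynomial functions *)

Section PolynomialFunctions.
Context {R : realType} {m : nat}.
Notation V := 'rV[R]_m.
Implicit Types (f g : V -> R) (v w y : V) (s t : R).

(** The zero function is homogeneous of every degree; for [m = 0] this does not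
   follow from the other rules. *)
Inductive hompol : nat -> (V -> R) -> Prop :=
| hompol0 d : hompol d (fun=> 0)
| hompol_const c : hompol 0 (fun=> c)
| hompol_coord j : hompol 1 (fun y => y 0 j)
| hompolD d f g : hompol d f -> hompol d g -> hompol d (fun y => f y + g y)
| hompolM d e f g : hompol d f -> hompol e g ->
    hompol (d + e) (fun y => f y * g y).

Inductive polfun : (V -> R) -> Prop :=
| polfun_const c : polfun (fun=> c)
| polfun_coord j : polfun (fun y => y 0 j)
| polfunD f g : polfun f -> polfun g -> polfun (fun y => f y + g y)
| polfunM f g : polfun f -> polfun g -> polfun (fun y => f y * g y).

Lemma hompol_ext d f g : f =1 g -> hompol d f -> hompol d g.
Proof. by move=> /funext ->. Qed.

Lemma polfun_ext f g : f =1 g -> polfun f -> polfun g.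
Proof. by move=> /funext ->. Qed.

Lemma hompol_polfun d f : hompol d f -> polfun f.
Proof.
elim=> [d'|c|j|d' f' g' _ H _ H'|d' e' f' g' _ H _ H'].
- exact: polfun_const.
- exact: polfun_const.
- exact: polfun_coord.
- exact: polfunD.
- exact: polfunM.
Qed.

Lemma hompol_sum (T : Type) (r : seq T) (P : pred T) d (f : T -> V -> R) :
  (forall x, P x -> hompol d (f x)) ->
  hompol d (fun y => \sum_(x <- r | P x) f x y).
Proof.
move=> H; elim: r => [|x r IH].
  by apply: hompol_ext (hompol0 d) => y; rewrite big_nil.
case: (boolP (P x)) => Px.
  by apply: hompol_ext (hompolD (H x Px) IH) => y; rewrite big_cons Px.
by apply: hompol_ext IH => y; rewrite big_cons (negPf Px).
Qed.

Lemma polfun_sum (T : Type) (r : seq T) (P : pred T) (f : T -> V -> R) :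
  (forall x, P x -> polfun (f x)) ->
  polfun (fun y => \sum_(x <- r | P x) f x y).
Proof.
move=> H; elim: r => [|x r IH].
  by apply: polfun_ext (polfun_const 0) => y; rewrite big_nil.
case: (boolP (P x)) => Px.
  by apply: polfun_ext (polfunD (H x Px) IH) => y; rewrite big_cons Px.
by apply: polfun_ext IH => y; rewrite big_cons (negPf Px).
Qed.

Lemma polfun_prod (T : Type) (r : seq T) (P : pred T) (f : T -> V -> R) :
  (forall x, P x -> polfun (f x)) ->
  polfun (fun y => \prod_(x <- r | P x) f x y).
Proof.
move=> H; elim: r => [|x r IH].
  by apply: polfun_ext (polfun_const 1) => y; rewrite big_nil.
case: (boolP (P x)) => Px.
  by apply: polfun_ext (polfunM (H x Px) IH) => y; rewrite big_cons Px.
by apply: polfun_ext IH => y; rewrite big_cons (negPf Px).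
Qed.

Lemma polfun_exp f n : polfun f -> polfun (fun y => f y ^+ n).
Proof.
move=> H; elim: n => [|n IH]; first exact: polfun_const.
by apply: polfun_ext (polfunM H IH) => y; rewrite exprS.
Qed.

Lemma polfunB f g : polfun f -> polfun g -> polfun (fun y => f y - g y).
Proof.
move=> Hf Hg; apply: polfun_ext (polfunD Hf (polfunM (polfun_const (-1)) Hg)).
by move=> y; rewrite mulN1r.
Qed.

Lemma polfun_affine f (A : 'M[R]_m) v : polfun f ->
  polfun (fun y => f (y *m A + v)).
Proof.
elim=> [c|j|f' g' _ H _ H'|f' g' _ H _ H'].
- exact: polfun_const.
- apply: (@polfun_ext (fun y => \sum_i y 0 i * A i j + v 0 j)).
    by move=> y; rewrite !mxE.
  apply: polfunD; last exact: polfun_const.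
  by apply: polfun_sum => i _; apply: polfunM; [exact: polfun_coord | exact: polfun_const].
- exact: polfunD.
- exact: polfunM.
Qed.

Lemma polfun_mul f (A : 'M[R]_m) : polfun f -> polfun (fun y => f (y *m A)).
Proof.
by move=> /(polfun_affine A 0); apply: polfun_ext => y; rewrite addr0.
Qed.

Lemma hompol_scale d f s y : hompol d f -> f (s *: y) = s ^+ d * f y.
Proof.
elim=> [d'|c|j|d' f' g' _ H _ H'|d' e' f' g' _ H _ H'].
- by rewrite mulr0.
- by rewrite mul1r.
- by rewrite mxE expr1.
- by rewrite H H' mulrDr.
- by rewrite H H' exprD mulrACA.
Qed.

Lemma hompol_bound d f : hompol d f ->
  exists2 C : R, 0 <= C & forall y (r : R), 0 <= r -> (forall j, `|y 0 j| <= r) ->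
    `|f y| <= C * r ^+ d.
Proof.
elim=> [d'|c|j|d' f' g' _ [C C0 H] _ [C' C0' H']|d' e' f' g' _ [C C0 H] _ [C' C0' H']].
- by exists 0 => // y r _ _; rewrite normr0 mul0r.
- by exists `|c| => // y r _ _; rewrite mulr1.
- by exists 1 => // y r _ /(_ j); rewrite expr1 mul1r.
- exists (C + C') => [|y r r0 yr]; first exact: addr_ge0.
  by rewrite mulrDl; apply: le_trans (ler_normD _ _) _; rewrite lerD ?H ?H'.
- exists (C * C') => [|y r r0 yr]; first exact: mulr_ge0.
  by rewrite exprD mulrACA normrM ler_pM ?H ?H'.
Qed.

Lemma polfun_continuous f : polfun f -> continuous f.
Proof.
elim=> [c|j|f' g' _ H _ H'|f' g' _ H _ H'] y.
- exact: cst_continuous.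
- exact: coord_continuous.
- exact: (@continuousD _ _ _ f' g' y (H y) (H' y)).
- exact: (@continuousM _ _ f' g' y (H y) (H' y)).
Qed.

(** The polynomial [F y] is in the parameter of the line through [v] with
   direction [y]; its coefficients are the homogeneous parts of [f] translated
   by [v]. *)
Definition taylor_expansion v n f (F : V -> {poly R}) :=
  [/\ forall y s, f (v + s *: y) = (F y).[s],
      forall j, hompol j (fun y => (F y)`_j) & forall y, (size (F y) <= n.+1)%N].

Lemma taylor_expansion_const v n (c : R) :
  taylor_expansion v n (fun=> c) (fun=> c%:P).
Proof.
split=> [y s|[|j]|y]; rewrite ?hornerC //.
- by apply: hompol_ext (hompol_const c) => y; rewrite coefC.
- by apply: hompol_ext (hompol0 _) => y; rewrite coefC.
- by rewrite (leq_trans (size_polyC_leq1 _)).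
Qed.

Lemma taylor_expansion_coord v j : taylor_expansion v 1 (fun y => y 0 j)
  (fun y => (v 0 j)%:P + (y 0 j) *: 'X).
Proof.
have E i y : ((v 0 j)%:P + (y 0 j) *: 'X)`_i =
    (if i == 0%N then v 0 j else 0) + y 0 j * (i == 1%N)%:R.
  by rewrite coefD coefC coefZ coefX.
split=> [y s|i|y].
- by rewrite !hornerE !mxE mulrC.
- case: i => [|[|i]].
  + by apply: hompol_ext (hompol_const (v 0 j)) => y; rewrite E mulr0 addr0.
  + by apply: hompol_ext (hompol_coord j) => y; rewrite E mulr1 add0r.
  + by apply: hompol_ext (hompol0 _) => y; rewrite E mulr0 addr0.
- rewrite (leq_trans (size_polyD _ _)) // geq_max.
  rewrite (leq_trans (size_polyC_leq1 _)) //.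
  by rewrite (leq_trans (size_scale_leq _ _)) ?size_polyX.
Qed.

Lemma taylor_expansionD v n n' f f' F F' : taylor_expansion v n f F ->
  taylor_expansion v n' f' F' ->
  taylor_expansion v (maxn n n') (fun y => f y + f' y) (fun y => F y + F' y).
Proof.
move=> [H1 H2 H3] [H1' H2' H3']; split=> [y s|j|y].
- by rewrite hornerD H1 H1'.
- by apply: hompol_ext (hompolD (H2 j) (H2' j)) => y; rewrite coefD.
- rewrite (leq_trans (size_polyD _ _)) // geq_max.
  rewrite (leq_trans (H3 y)) ?ltnS ?leq_maxl //.
  by rewrite (leq_trans (H3' y)) ?ltnS ?leq_maxr.
Qed.

Lemma taylor_expansionM v n n' f f' F F' : taylor_expansion v n f F ->
  taylor_expansion v n' f' F' ->
  taylor_expansion v (n + n') (fun y => f y * f' y) (fun y => F y * F' y).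
Proof.
move=> [H1 H2 H3] [H1' H2' H3']; split=> [y s|j|y].
- by rewrite hornerM H1 H1'.
- apply: (@hompol_ext _ (fun y => \sum_(i < j.+1) (F y)`_i * (F' y)`_(j - i))).
    by move=> y; rewrite coefM.
  apply: hompol_sum => i _.
  by have := hompolM (H2 i) (H2' (j - i)%N); rewrite subnKC // -ltnS.
- rewrite (leq_trans (size_polyMleq _ _)) // -subn1 leq_subLR addnC.
  by rewrite addnC (leq_trans (leq_add (H3 y) (H3' y))) // addSn addnS add1n.
Qed.

Lemma polfun_taylor f v : polfun f -> exists n F, taylor_expansion v n f F.
Proof.
elim=> [c|j|f1 f2 _ [n [F H]] _ [n' [F' H']]|f1 f2 _ [n [F H]] _ [n' [F' H']]].
- by exists 0%N; eexists; exact: taylor_expansion_const.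
- by exists 1%N; eexists; exact: taylor_expansion_coord.
- by eexists; eexists; exact: taylor_expansionD H H'.
- by eexists; eexists; exact: taylor_expansionM H H'.
Qed.

Lemma hompol_taylor d f v : hompol d f -> exists F, taylor_expansion v d f F.
Proof.
elim=> [d'|c|j|d' f1 f2 _ [F H] _ [F' H']|d1 d2 f1 f2 _ [F H] _ [F' H']].
- by eexists; exact: taylor_expansion_const.
- by eexists; exact: taylor_expansion_const.
- by eexists; exact: taylor_expansion_coord.
- by have := taylor_expansionD H H'; rewrite maxnn => HF; eexists; exact: HF.
- by eexists; exact: taylor_expansionM H H'.
Qed.

Lemma polfun_mpoly f : polfun f ->
  exists p : mpoly.mpoly m R, forall y, f y = poly_fun p y.
Proof.
elim=> [c|j|f' g' _ [p H] _ [p' H']|f' g' _ [p H] _ [p' H']].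
- by exists (mpoly.mpolyC m c) => y; rewrite /poly_fun mpoly.mevalC.
- by exists (mpoly.mpolyX R (mpoly.mnm1 j)) => y; rewrite /poly_fun mpoly.mevalXU.
- by exists (p + p') => y; rewrite /poly_fun mpoly.mevalD H H'.
- by exists (p * p') => y; rewrite /poly_fun mpoly.mevalM H H'.
Qed.

Lemma hompol_monomial (e : 'I_m -> nat) (r : seq 'I_m) :
  hompol (\sum_(i <- r) e i)%N (fun y => \prod_(i <- r) y 0 i ^+ e i).
Proof.
elim: r => [|j r IH].
  by rewrite big_nil; apply: hompol_ext (hompol_const 1) => y; rewrite big_nil.
have Hj n : hompol n (fun y => y 0 j ^+ n).
  elim: n => [|n IHn]; first exact: hompol_const.
  apply: (@hompol_ext _ (fun y => y 0 j * y 0 j ^+ n)).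
    by move=> y; rewrite exprS.
  by rewrite -add1n; apply: hompolM => //; exact: hompol_coord.
rewrite big_cons; apply: hompol_ext (hompolM (Hj (e j)) IH) => y.
by rewrite big_cons.
Qed.

Lemma mpoly_hompol d (p : mpoly.mpoly m R) :
  p \is mpoly.ishomog1 d mpoly.mdeg -> hompol d (poly_fun p).
Proof.
rewrite mpoly.dhomogE => /allP Hp.
apply: (@hompol_ext _ (fun y => \sum_(x <- mpoly.msupp p | x \in mpoly.msupp p)
    mpoly.mcoeff x p * \prod_i y 0 i ^+ x i)).
  by move=> y; rewrite /poly_fun mpoly.mevalE [RHS]big_seq_cond;
     apply: eq_bigl => x; rewrite andbT.
apply: hompol_sum => x /Hp /eqP /= <-; rewrite mpoly.mdegE -[X in hompol X _]add0n.
apply: hompolM; first exact: hompol_const.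
exact: hompol_monomial.
Qed.

Lemma poly_eq_of_horner (p q : {poly R}) : (forall s, p.[s] = q.[s]) -> p = q.
Proof.
move=> H; apply/eqP; rewrite -subr_eq0; apply: contraT => pq0.
pose rs := [seq (i%:R : R) | i <- iota 0 (size (p - q))].
have : (size rs < size (p - q)%R)%N.
  apply: max_poly_roots => //.
    by apply/allP => s _; rewrite /root hornerD hornerN H subrr.
  rewrite map_inj_uniq ?iota_uniq // => i j /eqP.
  by rewrite eqr_nat => /eqP.
by rewrite size_map size_iota ltnn.
Qed.

End PolynomialFunctions.

(** * Inner product *)

Section InnerProduct.
Context {R : realType} {m : nat}.
Notation V := 'rV[R]_m.
Implicit Types (v w y z : V) (s : R).

Definition dot y w : R := (y *m w^T) 0 0.

Lemma dotE y w : dot y w = \sum_j y 0 j * w 0 j.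
Proof. by rewrite /dot mxE; apply: eq_bigr => j _; rewrite mxE. Qed.

Lemma dotC y w : dot y w = dot w y.
Proof. by rewrite !dotE; apply: eq_bigr => j _; rewrite mulrC. Qed.

Lemma dotDl y z w : dot (y + z) w = dot y w + dot z w.
Proof. by rewrite /dot mulmxDl mxE. Qed.

Lemma dotZl s y w : dot (s *: y) w = s * dot y w.
Proof. by rewrite /dot -scalemxAl mxE. Qed.

Lemma dotBl y z w : dot (y - z) w = dot y w - dot z w.
Proof. by rewrite dotDl -scaleN1r dotZl mulN1r. Qed.

Lemma dotDr y z w : dot w (y + z) = dot w y + dot w z.
Proof. by rewrite dotC dotDl !(dotC w). Qed.

Lemma dotBr y z w : dot w (y - z) = dot w y - dot w z.
Proof. by rewrite dotC dotBl !(dotC w). Qed.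

Lemma dotZr s y w : dot w (s *: y) = s * dot w y.
Proof. by rewrite dotC dotZl dotC. Qed.

Lemma dot0l w : dot 0 w = 0.
Proof. by rewrite /dot mul0mx mxE. Qed.

Lemma dot_ge0 y : 0 <= dot y y.
Proof. by rewrite dotE sumr_ge0 // => j _; rewrite -expr2 sqr_ge0. Qed.

Lemma coord_sqr_le y j : (y 0 j) ^+ 2 <= dot y y.
Proof.
rewrite dotE (bigD1 j) //= -expr2 lerDl sumr_ge0 // => i _.
by rewrite -expr2 sqr_ge0.
Qed.

Lemma dot_eq0 y : dot y y = 0 -> y = 0.
Proof.
move=> y0; apply/rowP => j; rewrite mxE; apply/eqP.
by rewrite -sqrf_eq0 eq_le sqr_ge0 andbT -y0 coord_sqr_le.
Qed.

Lemma dot_gt0 y : y != 0 -> 0 < dot y y.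
Proof.
by move=> y0; rewrite lt_def dot_ge0 andbT; apply: contra_neq y0 => /dot_eq0.
Qed.

Lemma coord_le y j r : 0 <= r -> dot y y <= r ^+ 2 -> `|y 0 j| <= r.
Proof.
move=> r0 H; rewrite -(ler_pXn2r (ltn0Sn 1)) ?nnegrE //.
by rewrite real_normK ?num_real // (le_trans (coord_sqr_le y j)).
Qed.

Lemma cauchy_schwarz y w : dot y w ^+ 2 <= dot y y * dot w w.
Proof.
have [->|w0] := eqVneq w 0; first by rewrite dotC !dot0l mulr0 expr0n.
have ww := dot_gt0 w0; pose s := dot y w / dot w w.
have E : s * dot w w = dot y w by rewrite /s mulfVK ?gt_eqF.
have := dot_ge0 (y - s *: w).
rewrite dotBl !dotBr !dotZl !dotZr (dotC w y) -!E => H.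
have {}H : 0 <= (dot y y - s * (s * dot w w)) * dot w w.
  by rewrite mulr_ge0 ?(ltW ww) // -[X in 0 <= X]addr0 -(subrr (s * (s * dot w w))); lra.
rewrite -subr_ge0 (_ : _ - _ = (dot y y - s * (s * dot w w)) * dot w w) //.
by ring.
Qed.

(** The equality case of the Cauchy-Schwarz inequality; it separates a vector
   from the rest of its orbit by a linear form. *)
Lemma dot_lt v w : dot v v = dot w w -> v != w -> dot v w < dot v v.
Proof.
move=> E; rewrite -subr_eq0 => /dot_gt0; rewrite dotBl !dotBr (dotC w v) -E.
by move=> H; lra.
Qed.

Lemma polfun_dot w : polfun (dot^~ w).
Proof.
apply: (@polfun_ext _ _ (fun y => \sum_j y 0 j * w 0 j)).
  by move=> y; rewrite dotE.
by apply: polfun_sum => j _; apply: polfunM; [exact: polfun_coord | exact: polfun_const].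
Qed.

Lemma polfun_sq : polfun (fun y => dot y y).
Proof.
apply: (@polfun_ext _ _ (fun y => \sum_j y 0 j * y 0 j)).
  by move=> y; rewrite dotE.
by apply: polfun_sum => j _; apply: polfunM; exact: polfun_coord.
Qed.

End InnerProduct.

(** * Invariants of the subgroups *)

Section Invariants.
Context {R : realType} {gT : finGroupType} {G : {group gT}} {m : nat}.
Variable rG : mx_representation R G m.
Hypothesis rG_orth : orthogonal_repr rG.
Notation V := 'rV[R]_m.
Implicit Types (H : {group gT}) (f : V -> R) (v w y : V) (s t : R).

Lemma act1 y : y *m rG 1%g = y.
Proof. by rewrite repr_mx1 mulmx1. Qed.

Lemma actM y g h : g \in G -> h \in G ->
  y *m rG (g * h)%g = y *m rG g *m rG h.
Proof. by move=> gG hG; rewrite repr_mxM // mulmxA. Qed.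

Lemma actKV y h : h \in G -> y *m rG h^-1%g *m rG h = y.
Proof. by move=> hG; rewrite repr_mxKV. Qed.

Lemma actK y h : h \in G -> y *m rG h *m rG h^-1%g = y.
Proof. by move=> hG; rewrite repr_mxK. Qed.

Lemma dot_act y w h : h \in G -> dot (y *m rG h) (w *m rG h) = dot y w.
Proof.
by move=> hG; rewrite /dot trmx_mul mulmxA -(mulmxA y) rG_orth // mulmx1.
Qed.

Lemma dot_actl y w h : h \in G -> dot (y *m rG h) w = dot y (w *m rG h^-1%g).
Proof. by move=> hG; rewrite -{1}(actKV w hG) dot_act. Qed.

Definition invfun H f := forall h, h \in H -> forall y, f (y *m rG h) = f y.

Definition stab H v : {group gT} := (H :&: rstab rG v)%G.

Lemma stabP H v h : H \subset G ->
  reflect (h \in H /\ v *m rG h = v) (h \in stab H v).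
Proof.
move=> HG; rewrite /= !inE; apply: (iffP idP).
  by case/andP => -> /andP[_ /eqP].
by move=> [hH ->]; rewrite hH (fintype.subsetP HG) // eqxx.
Qed.

Lemma stab_sub H v : stab H v \subset H.
Proof. exact: subsetIl. Qed.

Lemma invfun_average H (F : V -> R) : H \subset G ->
  invfun H (fun y => \sum_(h in H) F (y *m rG h)).
Proof.
move=> HG g gH y; rewrite [RHS](reindex_inj (mulgI g)) /=.
apply: eq_big => [h|h hH]; first by rewrite groupMl.
by rewrite actM // (fintype.subsetP HG).
Qed.

Lemma card_group_neq0 H : (#|H|%:R : R) != 0.
Proof. by rewrite pnatr_eq0 -lt0n cardG_gt0. Qed.

(** The subalgebra generated by the invariants of degree at most [k], as an
   inductive predicate, so that properties of the generators extend to it by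
   induction. *)
Inductive inv_alg (k : nat) (H : {group gT}) : (V -> R) -> Prop :=
| inv_alg_const c : inv_alg k H (fun=> c)
| inv_alg_gen e f : (0 < e <= k)%N -> hompol e f -> invfun H f ->
    inv_alg k H f
| inv_algD f g : inv_alg k H f -> inv_alg k H g ->
    inv_alg k H (fun y => f y + g y)
| inv_algM f g : inv_alg k H f -> inv_alg k H g ->
    inv_alg k H (fun y => f y * g y).

Definition generated k H := forall f, polfun f -> invfun H f -> inv_alg k H f.

Lemma inv_alg_ext k H (f g : V -> R) : f =1 g -> inv_alg k H f -> inv_alg k H g.
Proof. by move=> /funext ->. Qed.

Lemma inv_alg_sum (T : Type) (r : seq T) (P : pred T) k H (f : T -> V -> R) :
  (forall x, P x -> inv_alg k H (f x)) ->
  inv_alg k H (fun y => \sum_(x <- r | P x) f x y).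
Proof.
move=> Hf; elim: r => [|x r IH].
  by apply: inv_alg_ext (inv_alg_const k H 0) => y; rewrite big_nil.
case: (boolP (P x)) => Px.
  by apply: inv_alg_ext (inv_algD (Hf x Px) IH) => y; rewrite big_cons Px.
by apply: inv_alg_ext IH => y; rewrite big_cons (negPf Px).
Qed.

Lemma inv_alg_prod (T : Type) (r : seq T) (P : pred T) k H (f : T -> V -> R) :
  (forall x, P x -> inv_alg k H (f x)) ->
  inv_alg k H (fun y => \prod_(x <- r | P x) f x y).
Proof.
move=> Hf; elim: r => [|x r IH].
  by apply: inv_alg_ext (inv_alg_const k H 1) => y; rewrite big_nil.
case: (boolP (P x)) => Px.
  by apply: inv_alg_ext (inv_algM (Hf x Px) IH) => y; rewrite big_cons Px.
by apply: inv_alg_ext IH => y; rewrite big_cons (negPf Px).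
Qed.

Lemma inv_alg_exp k H f n : inv_alg k H f -> inv_alg k H (fun y => f y ^+ n).
Proof.
move=> Hf; elim: n => [|n IH]; first exact: inv_alg_const.
by apply: inv_alg_ext (inv_algM Hf IH) => y; rewrite exprS.
Qed.

Lemma invfun_generators n (sigma : n.-tuple (mpoly.mpoly m R)) f :
  generates_invariants rG sigma -> polfun f -> invfun G f ->
  exists q : mpoly.mpoly (size sigma) R, forall y,
    f y = \sum_(e <- mpoly.msupp q) mpoly.mcoeff e q *
            \prod_i poly_fun (tnth (in_tuple sigma) i) y ^+ e i.
Proof.
move=> [_ Hgen] /polfun_mpoly[p Hp] fG.
have [|q Hq] := Hgen p; first by move=> g gG y; rewrite -!Hp fG.
exists q => y; rewrite -mpoly.mevalE Hp Hq /poly_fun.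
by rewrite mpoly.comp_mpoly_meval.
Qed.

Lemma generated_top n (sigma : n.-tuple (mpoly.mpoly m R)) k :
  minimal_homog_generators rG sigma -> (max_degree sigma <= k)%N ->
  generated k G.
Proof.
move=> [Hhom Hgen _] dk f pf fG; have [Hinv _] := Hgen.
have [q Hq] := invfun_generators Hgen pf fG.
apply: inv_alg_ext (fsym Hq) _.
apply: inv_alg_sum => x _; apply: inv_algM; first exact: inv_alg_const.
apply: inv_alg_prod => i _; apply: inv_alg_exp.
set P := tnth _ i; have Ps : P \in tval sigma by exact: mem_tnth.
have [d d0 /[dup] HP /mpoly_hompol HP'] := Hhom P Ps.
have [P0|P0] := eqVneq P 0.
  rewrite P0; apply: inv_alg_ext (inv_alg_const k G 0) => y.
  by rewrite /poly_fun mpoly.meval0.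
apply: (@inv_alg_gen k G d); rewrite ?d0 //=.
  apply: leq_trans dk; rewrite /max_degree.
  have := mpoly.dhomog_uniq P0 HP (mpoly.dhomog_msize HP).
  by move=> ->; exact: (leq_bigmax_seq P Ps isT).
by move=> g gG y; exact: Hinv.
Qed.

Definition avg H : 'M[R]_m := (#|H|%:R)^-1 *: \sum_(h in H) rG h.

Lemma avg_actl H h : H \subset G -> h \in H -> rG h *m avg H = avg H.
Proof.
move=> HG hH; rewrite /avg -scalemxAr; congr (_ *: _).
rewrite mulmx_sumr [RHS](reindex_inj (mulgI h)) /=.
apply: eq_big => [g|g gH]; first by rewrite groupMl.
by rewrite repr_mxM // (fintype.subsetP HG).
Qed.

Lemma avg_actr H h : H \subset G -> h \in H -> avg H *m rG h = avg H.
Proof.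
move=> HG hH; rewrite /avg -scalemxAl; congr (_ *: _).
rewrite mulmx_suml [RHS](reindex_inj (mulIg h)) /=.
apply: eq_big => [g|g gH]; first by rewrite groupMr.
by rewrite repr_mxM // (fintype.subsetP HG).
Qed.

Lemma avg_fixed H y : (forall h, h \in H -> y *m rG h = y) -> y *m avg H = y.
Proof.
move=> yH; rewrite /avg -scalemxAr mulmx_sumr (eq_bigr (fun=> y)) //.
by rewrite sumr_const -[y *+ _]scaler_nat scalerA mulVf ?scale1r // card_group_neq0.
Qed.

Lemma avg_idem H : H \subset G -> avg H *m avg H = avg H.
Proof.
move=> HG; rewrite {1}/avg -scalemxAl mulmx_suml (eq_bigr (fun=> avg H)).
  by rewrite sumr_const -[avg H *+ _]scaler_nat scalerA mulVf ?scale1r // card_group_neq0.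
by move=> h hH; exact: avg_actl.
Qed.

Lemma avg_compl H y : H \subset G -> (y - y *m avg H) *m avg H = 0.
Proof. by move=> HG; rewrite mulmxBl -mulmxA avg_idem // subrr. Qed.

Lemma invfun_compl H f : H \subset G -> invfun H f ->
  invfun H (fun y => f (y - y *m avg H)).
Proof.
move=> HG fH h hH y; rewrite -[in RHS](fH h hH) mulmxBl -!mulmxA.
by rewrite avg_actl // avg_actr.
Qed.

Lemma polfun_compl H f : polfun f -> polfun (fun y => f (y - y *m avg H)).
Proof.
move=> /(polfun_mul (1%:M - avg H)); apply: polfun_ext => y.
by rewrite mulmxBr mulmx1.
Qed.

Lemma hompol_low_degree d f : hompol d f ->
  match d with
  | 0%N => forall y, f y = f 0
  | 1%N => forall y z, f (y + z) = f y + f z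
  | _ => True
  end.
Proof.
elim=> [[|[]]|c|j|[|[]] f1 f2 _ H1 _ H2|[|[]] [|[]] f1 f2 _ H1 _ H2] //=.
- by move=> y z; rewrite addr0.
- by move=> y z; rewrite mxE.
- by move=> y; rewrite H1 H2.
- by move=> y z; rewrite H1 H2 addrACA.
- by move=> y; rewrite H1 H2.
- by move=> y z; rewrite (H1 (y + z)) (H1 y) (H1 z) H2 mulrDr.
- by move=> y z; rewrite (H2 (y + z)) (H2 y) (H2 z) H1 mulrDl.
Qed.

(** Invariants of degree at most one cannot see the part of a vector that
   averages to zero, so they do not generate unless the action is trivial. *)
Lemma generated_degree_gt1 k H y : H \subset G -> generated k H ->
  y *m avg H != y -> (1 < k)%N.
Proof.
move=> HG gen; apply: contra_neqT; rewrite -leqNgt => k1.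
have Hle f : inv_alg k H f -> f y = f (y *m avg H).
  elim=> [//|e f' /andP[e0 ek] He fH|f1 f2 _ -> _ ->//|f1 f2 _ -> _ ->//].
  have e1 : e = 1%N by apply/eqP; rewrite eqn_leq e0 (leq_trans ek).
  rewrite e1 in He; have add := hompol_low_degree He.
  have f0 : f' 0 = 0 by apply: (addrI (f' 0)); rewrite -add !addr0.
  rewrite /avg -scalemxAr (hompol_scale _ _ He) expr1 mulmx_sumr.
  rewrite (big_morph f' add f0) (eq_bigr (fun=> f' y)).
    rewrite sumr_const -[f' y *+ _]mulr_natl mulrA mulVf ?mul1r //.
    exact: card_group_neq0.
  by move=> h hH; exact: fH.
have := Hle _ (gen _ (polfun_compl H polfun_sq) (invfun_compl HG _)).
rewrite -[_ *m avg H *m _]mulmxA avg_idem // subrr dot0l => E.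
apply/esym/eqP; rewrite -subr_eq0; apply/eqP/dot_eq0/E => h hH z.
by rewrite dot_act // (fintype.subsetP HG).
Qed.

Lemma generated_degree_gt0 k H (j : 'I_m) : H \subset G -> generated k H ->
  (0 < k)%N.
Proof.
move=> HG gen; rewrite lt0n; apply/eqP => k0.
have Hc f : inv_alg k H f -> forall y, f y = f 0.
  elim=> [//|e f' /andP[e0 ek]|f1 f2 _ H1 _ H2 y|f1 f2 _ H1 _ H2 y].
  - by rewrite k0 leqn0 in ek; rewrite (eqP ek) in e0.
  - by rewrite H1 H2.
  - by rewrite H1 H2.
have := Hc _ (gen _ polfun_sq _) (\row_i 1).
rewrite dot0l => /(_ (fun h hH y => dot_act y y (fintype.subsetP HG h hH))).
by move=> /dot_eq0 /rowP /(_ j); rewrite !mxE => /eqP; rewrite oner_eq0.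
Qed.

(** Expanding at [v] does not raise degrees, and an element fixing [v] and [f]
   fixes the homogeneous parts of the expansion. *)
Lemma inv_alg_taylor k H v f : H \subset G -> inv_alg k H f ->
  exists F : V -> {poly R}, (forall y s, f (v + s *: y) = (F y).[s]) /\
    forall j, inv_alg k (stab H v) (fun y => (F y)`_j).
Proof.
move=> HG; elim=> [c|e f' /andP[e0 ek] He fH|f1 f2 _ [F [H1 H2]] _ [F' [H1' H2']]
  |f1 f2 _ [F [H1 H2]] _ [F' [H1' H2']]].
- exists (fun=> c%:P); split=> [y s|j]; first by rewrite hornerC.
  exact: inv_alg_const.
- have [F [H1 H2 H3]] := hompol_taylor v He; exists F; split=> // j.
  have [->|j0] := posnP j.
    apply: inv_alg_ext (inv_alg_const k _ (F 0)`_0) => y.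
    exact/esym/(hompol_low_degree (H2 0%N)).
  case: (leqP j e) => je; last first.
    apply: inv_alg_ext (inv_alg_const k _ 0) => y.
    by rewrite nth_default // (leq_trans (H3 y)).
  apply: inv_alg_gen (H2 j) _; first by rewrite j0 (leq_trans je).
  move=> h /(stabP v h HG)[hH vh] y; congr (nth 0 (polyseq _) j).
  apply: poly_eq_of_horner => s; rewrite -!H1 -[RHS](fH h hH).
  by rewrite mulmxDl vh scalemxAl.
- exists (fun y => F y + F' y); split=> [y s|j]; first by rewrite hornerD H1 H1'.
  by apply: inv_alg_ext (inv_algD (H2 j) (H2' j)) => y; rewrite coefD.
- exists (fun y => F y * F' y); split=> [y s|j]; first by rewrite hornerM H1 H1'.
  apply: (@inv_alg_ext _ _ (fun y => \sum_(i < j.+1) (F y)`_i * (F' y)`_(j - i))).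
    by move=> y; rewrite coefM.
  by apply: inv_alg_sum => i _; exact: inv_algM.
Qed.

Lemma poly_divX (p : {poly R}) : p.[0] = 0 ->
  exists q : {poly R}, forall s, p.[s] = s * q.[s].
Proof.
move=> /rootP/factor_theorem[q ->]; exists q => s.
by rewrite hornerM hornerXsubC subr0 mulrC.
Qed.

(** Nonzero at [v], zero at the other points of its orbit. *)
Definition separator H v (x : V) : R :=
  \prod_(g in H :\: stab H v) (dot x v - dot (v *m rG g) v).

(** The polynomial [1 - (1 - u ^+ n) ^+ n] agrees with [1] to order [n] at
   [u = 1] and with [0] to order [n] at [u = 0], so this one does so at [v] and
   at the other points of its orbit. *)
Definition bump H v n (x : V) : R :=
  1 - (1 - (separator H v x / separator H v v) ^+ n) ^+ n.

Lemma polfun_separator H v : polfun (separator H v).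
Proof.
by apply: polfun_prod => g _; apply: polfunB; [exact: polfun_dot | exact: polfun_const].
Qed.

Lemma separator_neq0 H v : H \subset G -> separator H v v != 0.
Proof.
move=> HG; apply/prodf_neq0 => g; rewrite finset.in_setD => /andP[gS gH].
rewrite subr_eq0 gt_eqF // dotC dot_lt //.
  by rewrite dot_act // (fintype.subsetP HG).
by apply: contraNneq gS => /esym vg; apply/stabP.
Qed.

Lemma separator_orbit H v h : h \in H -> h \notin stab H v ->
  separator H v (v *m rG h) = 0.
Proof.
by move=> hH hS; rewrite /separator (bigD1 h) ?finset.in_setD ?hS //= subrr mul0r.
Qed.

Lemma invfun_dot_stab H v : H \subset G -> invfun (stab H v) (dot^~ v).
Proof.
move=> HG h hS y; rewrite dot_actl; last first.
  exact: (fintype.subsetP (fintype.subset_trans (stab_sub H v) HG)).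
by move: hS; rewrite -groupV => /(stabP v _ HG)[_ ->].
Qed.

Lemma invfun_separator H v : H \subset G -> invfun (stab H v) (separator H v).
Proof.
move=> HG h hS y; apply: eq_bigr => g _.
by rewrite (invfun_dot_stab HG hS).
Qed.

Lemma bump_base H v n y : H \subset G -> exists U : {poly R}, forall s,
  bump H v n (v + s *: y) = 1 + s ^+ n * U.[s].
Proof.
move=> HG; pose f x := 1 - (separator H v x / separator H v v) ^+ n.
have pf : polfun f.
  apply: polfunB; first exact: polfun_const.
  apply: polfun_exp; apply: polfunM; last exact: polfun_const.
  exact: polfun_separator.
have [N [F [HF _ _]]] := polfun_taylor v pf.
have [|q Hq] := @poly_divX (F y).
  rewrite -HF scale0r addr0 /f divff ?separator_neq0 //.
  by rewrite expr1n subrr.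
exists (- q ^+ n) => s; rewrite /bump -/(f _) HF Hq exprMn.
by rewrite hornerN horner_exp mulrN.
Qed.

Lemma bump_orbit H v n h y : H \subset G -> h \in H -> h \notin stab H v ->
  exists U : {poly R}, forall s,
    bump H v n ((v + s *: y) *m rG h) = s ^+ n * U.[s].
Proof.
move=> HG hH hS; pose f x := separator H v (x *m rG h) / separator H v v.
have pf : polfun f.
  apply: polfunM; last exact: polfun_const.
  exact: polfun_mul (polfun_separator H v).
have [N [F [HF _ _]]] := polfun_taylor v pf.
have [|q Hq] := @poly_divX (F y).
  by rewrite -HF scale0r addr0 /f separator_orbit // mul0r.
exists (q ^+ n * \sum_(i < n) (1 - (F y) ^+ n) ^+ i) => s.
rewrite /bump -[separator _ _ (_ *m _) / _]/(f _) HF.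
rewrite -[X in X - _](expr1n _ n) subrXX opprB addrCA subrr addr0 {1}Hq.
rewrite exprMn hornerM horner_exp mulrA; congr (_ * _).
rewrite horner_sum; apply: eq_bigr => i _.
by rewrite expr1n mul1r horner_exp hornerD hornerC hornerN horner_exp.
Qed.

(** The degree bound for generators passes to the isotropy groups: near [v] an
   invariant of the isotropy group agrees to any order with an invariant of the
   whole group, whose Taylor coefficients at [v] lie in the algebra generated by
   those of the generators. *)
Lemma generated_stab k H v : H \subset G -> generated k H ->
  generated k (stab H v).
Proof.
move=> HG gen q pq qS; set S := stab H v.
have SG : S \subset G := fintype.subset_trans (stab_sub H v) HG.
have [N0 [Fq [HFq _ sFq]]] := polfun_taylor 0 pq; pose N := N0.+1.
(* An [H]-invariant that equals [q (x - v)], up to the factor [#|S|], to order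
   [N] at [v]. *)
pose Q x := \sum_(h in H) (bump H v N (x *m rG h) * q (x *m rG h - v)).
have pbump : polfun (bump H v N).
  apply: polfunB; first exact: polfun_const.
  apply: polfun_exp; apply: polfunB; first exact: polfun_const.
  apply: polfun_exp; apply: polfunM; last exact: polfun_const.
  exact: polfun_separator.
have pQ : polfun Q.
  apply: polfun_sum => h _; apply: polfunM; first exact: polfun_mul.
  exact: polfun_affine.
have QH : invfun H Q.
  exact: (@invfun_average H (fun x => bump H v N x * q (x - v)) HG).
have [F [HF FA]] := inv_alg_taylor v HG (gen Q pQ QH).
have FE y : exists W : {poly R}, F y = #|S|%:R *: Fq y + 'X^N * W.
  have /choice[W HW] h : exists W : {poly R}, forall s, h \in H ->
      bump H v N ((v + s *: y) *m rG h) * q ((v + s *: y) *m rG h - v) =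
      (if h \in S then (Fq y).[s] else 0) + s ^+ N * W.[s].
    have [hH|] := boolP (h \in H); last by exists 0.
    have [hS|hS] := boolP (h \in S).
      have [U HU] := bump_base v N y HG; exists (U * Fq y) => s _.
      have [_ vh] := stabP v h HG hS.
      have -> : bump H v N ((v + s *: y) *m rG h) = bump H v N (v + s *: y).
        by rewrite /bump (invfun_separator HG hS).
      have -> : (v + s *: y) *m rG h - v = (s *: y) *m rG h.
        by rewrite mulmxDl vh addrC addKr.
      by rewrite HU qS // -[_ *: _]add0r HFq hornerM; ring.
    have [U HU] := bump_orbit N y HG hH hS.
    have pqh : polfun (fun x => q (x *m rG h - v)) by exact: polfun_affine.
    have [n1 [T [HT _ _]]] := polfun_taylor v pqh.
    by exists (U * T y) => s _; rewrite HU HT hornerM add0r mulrA.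
  exists (\sum_(h in H) W h); apply: poly_eq_of_horner => s.
  rewrite -HF /Q (eq_bigr (fun h => (if h \in S then (Fq y).[s] else 0) +
    s ^+ N * (W h).[s])); last by move=> h hH; exact: HW.
  rewrite big_split /= -big_mkcondr /= -mulr_sumr.
  rewrite hornerD hornerZ hornerM hornerXn horner_sum; congr (_ + _).
  rewrite (eq_bigl (mem S)); last first.
    move=> h; apply: andb_idl; exact: (fintype.subsetP (stab_sub H v)).
  by rewrite sumr_const mulr_natl.
apply: (@inv_alg_ext _ _ (fun y => \sum_(j < N) (#|S|%:R)^-1 * (F y)`_j)).
  move=> y; have [W ->] := FE y.
  rewrite -[y in RHS]scale1r -[_ *: _ in RHS]add0r HFq.
  rewrite (horner_coef_wide _ (sFq y)); apply: eq_bigr => j _.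
  rewrite coefD coefZ coefXnM ltn_ord addr0 expr1n mulr1 mulrA.
  by rewrite mulVf ?mul1r // card_group_neq0.
apply: inv_alg_sum => j _; apply: inv_algM; first exact: inv_alg_const.
exact: FA.
Qed.

(** A vector fixed by the whole group is its own average. *)
Lemma card_stab_lt H v : H \subset G -> v *m avg H = 0 -> v != 0 ->
  (#|stab H v| < #|H|)%N.
Proof.
move=> HG v0; apply: contra_neqT; rewrite -leqNgt => leHS.
have SE : (stab H v : {set gT}) = H.
  by apply/eqP; rewrite finset.eqEcard stab_sub.
rewrite -v0 avg_fixed // => h; rewrite -SE => /(stabP v h HG)[_ vh].
exact: vh.
Qed.

End Invariants.

(** * Reduction to an isotropy group *)

Section PolynomialValued.
Context {R : realType} {m : nat}.
Notation V := 'rV[R]_m.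
Implicit Types (P Q : V -> {poly R}).

(** The elements of the ring R[V][X]. *)
Definition ppol P := (forall j, polfun (fun y => (P y)`_j)) /\
  exists n, forall y, (size (P y) <= n)%N.

Lemma ppol_ext P Q : P =1 Q -> ppol P -> ppol Q.
Proof. by move=> /funext ->. Qed.

Lemma ppol_const (f : V -> R) : polfun f -> ppol (fun y => (f y)%:P).
Proof.
move=> pf; split; last by exists 1%N => y; exact: size_polyC_leq1.
by case=> [|j];
  [apply: polfun_ext pf | apply: polfun_ext (polfun_const 0)] => y; rewrite coefC.
Qed.

Lemma ppolX : ppol (fun=> 'X).
Proof.
by split=> [j|]; [exact: polfun_const | exists 2%N => y; rewrite size_polyX].
Qed.

Lemma ppolD P Q : ppol P -> ppol Q -> ppol (fun y => P y + Q y).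
Proof.
move=> [H1 [n H2]] [H1' [n' H2']]; split=> [j|].
  by apply: polfun_ext (polfunD (H1 j) (H1' j)) => y; rewrite coefD.
exists (maxn n n') => y; rewrite (leq_trans (size_polyD _ _)) // geq_max.
by rewrite (leq_trans (H2 y)) ?leq_maxl // (leq_trans (H2' y)) ?leq_maxr.
Qed.

Lemma ppolM P Q : ppol P -> ppol Q -> ppol (fun y => P y * Q y).
Proof.
move=> [H1 [n H2]] [H1' [n' H2']]; split=> [j|].
  apply: (@polfun_ext _ _ (fun y => \sum_(i < j.+1) (P y)`_i * (Q y)`_(j - i))).
    by move=> y; rewrite coefM.
  by apply: polfun_sum => i _; exact: polfunM.
exists (n + n')%N => y; rewrite (leq_trans (size_polyMleq _ _)) //.
by rewrite (leq_trans (leq_pred _)) // leq_add.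
Qed.

Lemma ppol_sum (T : Type) (r : seq T) (A : pred T) (P : T -> V -> {poly R}) :
  (forall x, A x -> ppol (P x)) -> ppol (fun y => \sum_(x <- r | A x) P x y).
Proof.
move=> HP; elim: r => [|x r IH].
  by apply: ppol_ext (ppol_const (polfun_const 0)) => y; rewrite big_nil.
case: (boolP (A x)) => Ax.
  by apply: ppol_ext (ppolD (HP x Ax) IH) => y; rewrite big_cons Ax.
by apply: ppol_ext IH => y; rewrite big_cons (negPf Ax).
Qed.

Lemma ppol_prod (T : Type) (r : seq T) (A : pred T) (P : T -> V -> {poly R}) :
  (forall x, A x -> ppol (P x)) -> ppol (fun y => \prod_(x <- r | A x) P x y).
Proof.
move=> HP; elim: r => [|x r IH].
  by apply: ppol_ext (ppol_const (polfun_const 1)) => y; rewrite big_nil.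
case: (boolP (A x)) => Ax.
  by apply: ppol_ext (ppolM (HP x Ax) IH) => y; rewrite big_cons Ax.
by apply: ppol_ext IH => y; rewrite big_cons (negPf Ax).
Qed.

Lemma ppol_mul P (A : 'M[R]_m) : ppol P -> ppol (fun y => P (y *m A)).
Proof.
move=> [H1 [n H2]]; split; last by exists n.
by move=> j; exact: (polfun_mul A (H1 j)).
Qed.

End PolynomialValued.

Section Slice.
Context {R : realType} {gT : finGroupType} {G : {group gT}} {m : nat}.
Variable rG : mx_representation R G m.
Hypothesis rG_orth : orthogonal_repr rG.
Notation V := 'rV[R]_m.
Implicit Types (H : {group gT}) (f : V -> R) (v w y : V) (s t a b : R).
Local Notation stab := (stab rG).

(** Families of curves in the orbit space of [H]. The curves [x i] in the
   representation space only name them: regularity is that of the invariants. *)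
Definition orbit_UC (I : Type) k H a b (x : I -> R -> V) :=
  forall f, polfun f -> invfun rG H f -> UC k a b (fun i t => f (x i t)).

Lemma orbit_UC_generators I k H a b (x : I -> R -> V) :
  generated rG k H ->
  (forall e f, (0 < e <= k)%N -> hompol e f -> invfun rG H f ->
     UC k a b (fun i t => f (x i t))) ->
  orbit_UC k H a b x.
Proof.
move=> gen Hx f pf fH; elim: (gen f pf fH) => [c|e f' ek He fH'|f1 f2 _ H1 _ H2|
    f1 f2 _ H1 _ H2].
- exact: UC_cst.
- exact: Hx ek He fH'.
- exact: UC_add.
- exact: UC_mul.
Qed.

Lemma sum_orbit (T : nmodType) (F : V -> T) H g y : H \subset G -> g \in H ->
  \sum_(h in H) F (y *m rG g *m rG h) = \sum_(h in H) F (y *m rG h).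
Proof.
move=> HG gH; rewrite [RHS](reindex_inj (mulgI g)) /=.
apply: eq_big => [h|h hH]; first by rewrite groupMl.
by rewrite actM // (fintype.subsetP HG).
Qed.

Section OneVector.
Variables (H : {group gT}) (w : V).
Hypothesis HG : H \subset G.
Let S := stab H w.

Let SH h : h \in S -> h \in H.
Proof. exact: (fintype.subsetP (stab_sub rG H w)). Qed.

Let inG h : h \in H -> h \in G.
Proof. exact: (fintype.subsetP HG). Qed.

(** A cut-off: at [dot y w] the polynomial of [y h] vanishes for every [h]
   outside the isotropy group of [w], and that of [y] does not as long as
   [dot y w] differs from the other values of [dot ^~ w] on the orbit. *)
Definition other_roots y : {poly R} :=
  \prod_(g in H :\: S) ('X - (dot (y *m rG g) w)%:P).

Lemma ppol_other_roots : ppol other_roots.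
Proof.
apply: ppol_prod => g _; apply: ppol_ext (ppolD ppolX (ppol_const _)).
  by move=> y; rewrite -polyCN.
apply: (@polfun_ext _ _ (fun y => 0 - dot (y *m rG g) w)).
  by move=> y; rewrite sub0r.
apply: polfunB; first exact: polfun_const.
exact: polfun_mul (polfun_dot w).
Qed.

Lemma other_rootsE y s :
  (other_roots y).[s] = \prod_(g in H :\: S) (s - dot (y *m rG g) w).
Proof. by rewrite horner_prod; apply: eq_bigr => g _; rewrite hornerXsubC. Qed.

Lemma other_roots_stab y h s : h \in S ->
  (other_roots (y *m rG h)).[s] = (other_roots y).[s].
Proof.
move=> hS; rewrite !other_rootsE [RHS](reindex_inj (mulgI h)) /=.
apply: eq_big => [g|g].
  by rewrite !finset.in_setD !(groupMl _ hS) (groupMl _ (SH hS)).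
by rewrite finset.in_setD => /andP[_ gH]; rewrite actM ?inG // SH.
Qed.

Lemma other_roots_vanish y h : h \in H -> h \notin S ->
  (other_roots (y *m rG h)).[dot y w] = 0.
Proof.
move=> hH hS; rewrite other_rootsE (bigD1 h^-1%g) /=; last first.
  by rewrite finset.in_setD !groupV hS.
by rewrite (actK _ _ (inG hH)) subrr mul0r.
Qed.

(** Lagrange interpolation at the values of [dot ^~ w] on the orbit: averaging
   makes the coefficients invariant under [H], and at [dot y w] the cut-off
   leaves only the terms with [h] in the isotropy group. *)
Definition lagrange (q : V -> {poly R}) y : {poly R} :=
  \sum_(h in H) q (y *m rG h) * other_roots (y *m rG h) ^+ 2.

Lemma ppol_lagrange q : ppol q -> ppol (lagrange q).
Proof.
move=> pq; apply: ppol_sum => h _.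
apply: (@ppol_mul _ _ (fun y => q y * other_roots y ^+ 2) (rG h)).
by apply: ppolM => //; apply: ppolM; exact: ppol_other_roots.
Qed.

Lemma invfun_lagrange q j : invfun rG H (fun y => (lagrange q y)`_j).
Proof.
move=> g gH y; rewrite /lagrange.
by rewrite (sum_orbit (fun y => q y * other_roots y ^+ 2)).
Qed.

Lemma lagrange_horner q y : (forall h, h \in S -> q (y *m rG h) = q y) ->
  (lagrange q y).[dot y w] =
  #|S|%:R * (q y).[dot y w] * (other_roots y).[dot y w] ^+ 2.
Proof.
move=> qS; rewrite horner_sum (bigID (mem S)) /= addrC big1 ?add0r; last first.
  move=> h /andP[hH hS]; rewrite hornerM horner_exp other_roots_vanish //.
  by rewrite expr0n mulr0.
rewrite (eq_bigl (mem S)); last by move=> h; apply: andb_idl; exact: SH.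
rewrite (eq_bigr (fun=> (q y).[dot y w] * (other_roots y).[dot y w] ^+ 2)).
  by rewrite sumr_const -mulrA mulr_natl.
by move=> h hS; rewrite hornerM horner_exp other_roots_stab // qS.
Qed.

Let shift y : {poly R} := 'X - (dot y w)%:P.

Let ppol_shift : ppol shift.
Proof.
apply: ppol_ext (ppolD ppolX (ppol_const (_ : polfun (fun y => 0 - dot y w)))).
  by move=> y; rewrite sub0r polyCN.
by apply: polfunB; [exact: polfun_const | exact: polfun_dot].
Qed.

Let shift_stab y h : h \in S -> shift (y *m rG h) = shift y.
Proof. by move=> hS; rewrite /shift (invfun_dot_stab rG_orth HG hS). Qed.

Lemma lagrange_root y : root (lagrange shift y) (dot y w).
Proof.
apply/rootP; rewrite lagrange_horner; last exact: shift_stab.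
by rewrite hornerXsubC subrr mulr0 mul0r.
Qed.

(** The squares make the terms outside the isotropy group vanish to second
   order. *)
Lemma lagrange_deriv y : (lagrange shift y)^`().[dot y w] =
  #|S|%:R * (other_roots y).[dot y w] ^+ 2.
Proof.
rewrite raddf_sum horner_sum (bigID (mem S)) /= addrC big1 ?add0r; last first.
  move=> h /andP[hH hS].
  rewrite expr2 !derivM !(hornerD, hornerM) other_roots_vanish //.
  by rewrite !(mulr0, mul0r, addr0).
rewrite (eq_bigl (mem S)); last by move=> h; apply: andb_idl; exact: SH.
rewrite (eq_bigr (fun=> (other_roots y).[dot y w] ^+ 2)).
  by rewrite sumr_const mulr_natl.
move=> h hS; rewrite shift_stab // derivM derivXsubC mul1r hornerD.
rewrite [X in _ + X]hornerM.
by rewrite hornerXsubC subrr mul0r addr0 horner_exp other_roots_stab.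
Qed.

(** As long as [dot y w] stays away from the other values of [dot ^~ w] on the
   orbit of [y], it is a simple root of a polynomial with invariant
   coefficients, and every invariant of the isotropy group of [w] is a rational
   function of it and of invariants of [H]. *)
Lemma orbit_UC_stab I k a b (x : I -> R -> V) (gamma : R) :
  0 < gamma ->
  orbit_UC k H a b x ->
  (forall i t, a < t < b -> {for t, continuous (fun s => dot (x i s) w)}) ->
  (forall i t, a < t < b -> forall g, g \in H -> g \notin S ->
     gamma <= dot (x i t) w - dot (x i t *m rG g) w) ->
  orbit_UC k S a b x.
Proof.
move=> g0 Hx wc gap.
pose l i t := dot (x i t) w.
pose e : R := gamma ^+ #|H :\: S| ^+ 2.
have e0 : 0 < e by rewrite !exprn_gt0.
have rootsE i t : a < t < b -> e <= (other_roots (x i t)).[l i t] ^+ 2.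
  move=> tab; rewrite /e lerXn2r ?nnegrE ?exprn_ge0 ?(ltW g0) //.
    rewrite other_rootsE prodr_ge0 // => g.
    rewrite finset.in_setD => /andP[gS gH].
    exact: le_trans (ltW g0) (gap i t tab g gH gS).
  rewrite other_rootsE -prodr_const; apply: ler_prod => g.
  rewrite finset.in_setD => /andP[gS gH].
  by rewrite (ltW g0) gap.
have S1 : 1 <= (#|S|%:R : R) by rewrite ler1n cardG_gt0.
have coefs q : ppol q -> forall j, UC k a b (fun i t => (lagrange q (x i t))`_j).
  move=> pq j; apply: (Hx (fun y => (lagrange q y)`_j)).
    by have [] := ppol_lagrange pq.
  exact: invfun_lagrange.
have lb : UC 0 a b l.
  have [M M0 HM] := UC_bounded (Hx _ polfun_sq
    (fun h hH y => dot_act rG_orth y y (inG hH))).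
  split=> //; exists (1 + M * dot w w) => i t tab.
  have H1 : `|l i t| ^+ 2 <= M * dot w w.
    rewrite real_normK ?num_real //; apply: le_trans (cauchy_schwarz _ _) _.
    by rewrite ler_wpM2r ?dot_ge0 // (le_trans (ler_norm _)) // HM.
  have := sqr_ge0 (`|l i t| - 1); have := normr_ge0 (l i t); nra.
have [n Hn] := (ppol_lagrange ppol_shift).2.
have lk : UC k a b l.
  apply: (UC_simple_root (p := fun i t => lagrange shift (x i t)) e0 _ _ wc lb).
  - by move=> i t; exact: Hn.
  - exact: coefs.
  - by move=> i t _; exact: lagrange_root.
  - move=> i t tab; rewrite lagrange_deriv ger0_norm; last first.
      by rewrite mulr_ge0 ?sqr_ge0 // (le_trans ler01).
    apply: le_trans (rootsE i t tab) _.
    by rewrite ler_peMl // sqr_ge0.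
have horn q : ppol q -> UC k a b (fun i t => (lagrange q (x i t)).[l i t]).
  move=> pq; have [n' Hn'] := (ppol_lagrange pq).2.
  apply: (@UC_ext _ _ _ _ _
    (fun i t => \sum_(j < n') (lagrange q (x i t))`_j * l i t ^+ j)).
    by move=> i t _; rewrite (horner_coef_wide _ (Hn' _)).
  by apply: UC_sum => j _; apply: UC_mul; [exact: coefs | exact: UC_exp].
move=> q pq qS.
have E i t : (lagrange (fun=> 1) (x i t)).[l i t] =
    #|S|%:R * (other_roots (x i t)).[l i t] ^+ 2.
  by rewrite lagrange_horner // hornerC mulr1.
have lb1 i t : a < t < b -> e <= `|(lagrange (fun=> 1) (x i t)).[l i t]|.
  move=> tab; rewrite E ger0_norm; last first.
    by rewrite mulr_ge0 ?sqr_ge0 // (le_trans ler01).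
  by apply: le_trans (rootsE i t tab) _; rewrite ler_peMl // sqr_ge0.
have U1 := UC_inv e0 lb1 (horn _ (ppol_const (polfun_const 1))).
apply: UC_ext (UC_mul (horn _ (ppol_const pq)) U1) => i t tab.
have n0 : (lagrange (fun=> 1) (x i t)).[l i t] != 0.
  by rewrite -normr_gt0 (lt_le_trans e0) // lb1.
apply: (mulIf n0); rewrite divfK // E lagrange_horner; last first.
  by move=> h hS; rewrite qS.
by rewrite hornerC; ring.
Qed.

End OneVector.

End Slice.

(** * Uniform bounds for the derivatives of lifts *)

Section VectorDerivative.
Context {R : realType} {m : nat}.
Notation V := 'rV[R]_m.
Implicit Types (u : R -> V) (d v w : V) (s t c a b : R).

Definition vder u t d := forall j, is_derive t 1 (fun s => u s 0 j) (d 0 j).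

Lemma vder_mulmx u t d (A : 'M[R]_m) : vder u t d ->
  vder (fun s => u s *m A) t (d *m A).
Proof.
move=> H j; rewrite mxE.
have -> : (fun s => (u s *m A) 0 j) = fun s => \sum_i u s 0 i * A i j.
  by apply/funext => s; rewrite mxE.
apply: is_derive_sum_seq => i.
have := is_derive_mul (H i) (is_derive_cst (A i j) t 1).
by rewrite mulr0 add0r mulrC.
Qed.

Lemma vderD u u' t d d' : vder u t d -> vder u' t d' ->
  vder (fun s => u s + u' s) t (d + d').
Proof.
move=> H H' j; rewrite mxE.
have -> : (fun s => (u s + u' s) 0 j) = fun s => u s 0 j + u' s 0 j.
  by apply/funext => s; rewrite mxE.
exact: is_derive_add.
Qed.

Lemma vderB u u' t d d' : vder u t d -> vder u' t d' ->
  vder (fun s => u s - u' s) t (d - d').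
Proof.
move=> H H' j; rewrite !mxE.
have -> : (fun s => (u s - u' s) 0 j) = fun s => u s 0 j - u' s 0 j.
  by apply/funext => s; rewrite !mxE.
exact: is_deriveB.
Qed.

Lemma vderZ_aff u e c t d : vder u (c * t) d ->
  vder (fun s => e *: u (c * s)) t ((e * c) *: d).
Proof.
move=> H j; rewrite mxE.
have -> : (fun s => (e *: u (c * s)) 0 j) = fun s => e * u (0 + c * s) 0 j.
  by apply/funext => s; rewrite mxE add0r.
have := H j; rewrite -{1}[c * t]add0r => /is_derive_aff.
move/(is_derive_mul (is_derive_cst (e : R) t 1)).
by rewrite mulr0 addr0 mulrA.
Qed.

Lemma vder_dot u t d w : vder u t d ->
  is_derive t 1 (fun s => dot (u s) w) (dot d w).
Proof.
move=> H; rewrite dotE.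
have -> : (fun s => dot (u s) w) = fun s => \sum_j u s 0 j * w 0 j.
  by apply/funext => s; rewrite dotE.
apply: is_derive_sum_seq => j.
have := is_derive_mul (H j) (is_derive_cst (w 0 j) t 1).
by rewrite mulr0 add0r mulrC.
Qed.

End VectorDerivative.

Section RealFacts.
Context {R : realType}.
Implicit Types (f : R -> R) (a b c s t l B : R).

Lemma UC_deriv_bounded (I : Type) k a b (f : I -> R -> R) : (0 < k)%N ->
  UC k a b f -> exists C : R, forall i t l, a < t < b ->
    is_derive t 1 (f i) l -> `|l| <= C.
Proof.
case: k => // k _ [_ [df Hd /UC_bounded[C _ HC]]]; exists C => i t l tab [_ <-].
by have [_ ->] := Hd i t tab; exact: HC.
Qed.

Lemma deriv_le f l B (d : R) : 0 < d -> is_derive (0 : R) 1 f l -> f 0 = 0 ->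
  (forall t, `|t| < d -> `|f t| <= B * `|t|) -> `|l| <= B.
Proof.
move=> d0 /dlinP H f0 HB; rewrite leNgt; apply/negP => Bl.
have [|d' d'0 Hd'] := H ((`|l| - B) / 2); first by rewrite divr_gt0 // subr_gt0.
pose t := Num.min d d' / 2.
have m0 : 0 < Num.min d d' by rewrite lt_min d0.
have t0 : 0 < t by rewrite divr_gt0.
have td : t < Num.min d d' by rewrite /t; lra.
move: td; rewrite lt_min => /andP[td td'].
have := HB t; rewrite (gtr0_norm t0) => /(_ td) H1.
have := Hd' t; rewrite subr0 (gtr0_norm t0) f0 subr0 => /(_ td') H2.
have : `|l| * t <= `|f t| + `|f t - l * t|.
  rewrite -{1}(gtr0_norm t0) -normrM -{1}(subrK (f t) (l * t)) addrC.
  by apply: le_trans (ler_normD _ _) _; rewrite lerD // distrC.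
nra.
Qed.

Lemma same_side f a b c s t : (forall x, a < x < b -> {for x, continuous f}) ->
  (forall x, a < x < b -> f x != c) -> a < s < b -> a < t < b ->
  f s < c -> f t < c.
Proof.
move=> fc fn sab tab fs; rewrite ltNge; apply/negP => ft.
have {}ft : c < f t by rewrite lt_def ft andbT fn.
have inab x y z : a < x < b -> a < y < b -> x <= z <= y -> a < z < b.
  by move=> /andP[x1 _] /andP[_ y2] /andP[z1 z2];
     rewrite (lt_le_trans x1) // (le_lt_trans z2).
have cont x y : a < x < b -> a < y < b -> {within `[x, y], continuous f}.
  move=> xab yab; apply/continuous_in_subspaceT => z /[1!inE] /=.
  by rewrite in_itv /= => zxy; apply: fc; exact: inab zxy.
case: (leP s t) => st.
  have [|z] := @IVT _ f s t c st (cont _ _ sab tab).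
    by rewrite min_l ?max_r ?(ltW fs) ?(ltW ft) // (le_trans (ltW fs) (ltW ft)).
  rewrite in_itv /= => zst fz.
  by have := fn z (inab _ _ _ sab tab zst); rewrite fz eqxx.
have [|z] := @IVT _ f t s c (ltW st) (cont _ _ tab sab).
  by rewrite min_r ?max_l ?(ltW fs) ?(ltW ft) // (le_trans (ltW fs) (ltW ft)).
rewrite in_itv /= => zst fz.
by have := fn z (inab _ _ _ tab sab zst); rewrite fz eqxx.
Qed.

Lemma uniform_fin (T : finType) (I : Type) (F : I -> T -> R) :
  (forall j, exists C : R, forall i, F i j <= C) ->
  exists C : R, forall i j, F i j <= C.
Proof.
move=> /choice[C HC]; exists (\sum_j `|C j|) => i j.
apply: le_trans (HC j i) _; apply: le_trans (ler_norm _) _.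
by rewrite (bigD1 j) //= lerDl sumr_ge0.
Qed.

End RealFacts.

Section DerivativeBound.
Context {R : realType} {gT : finGroupType} {G : {group gT}} {m : nat}.
Variable rG : mx_representation R G m.
Hypothesis rG_orth : orthogonal_repr rG.
Notation V := 'rV[R]_m.
Implicit Types (H : {group gT}) (f : V -> R) (v w y : V) (s t a b r : R).
Local Notation stab := (stab rG).
Local Notation orbit_UC := (orbit_UC rG).
Local Notation invfun := (invfun rG).
Local Notation avg := (avg rG).

Lemma orbit_UC_sub I k H a b a' b' (x : I -> R -> V) : a <= a' -> b' <= b ->
  orbit_UC k H a b x -> orbit_UC k H a' b' x.
Proof. by move=> aa bb Hx f pf fH; apply: UC_sub aa bb (Hx f pf fH). Qed.

Lemma orbit_UC_reindex I J k H a b (x : I -> R -> V) (h : J -> I) :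
  orbit_UC k H a b x -> orbit_UC k H a b (fun j => x (h j)).
Proof. by move=> Hx f pf fH; exact: UC_reindex (Hx f pf fH). Qed.

Lemma orbit_UC_compl I k H a b (x : I -> R -> V) : H \subset G ->
  orbit_UC k H a b x -> orbit_UC k H a b (fun i t => x i t - x i t *m avg H).
Proof.
move=> HG Hx f pf fH.
exact: (Hx (fun y => f (y - y *m avg H)) (polfun_compl rG H pf)
           (invfun_compl HG fH)).
Qed.

Lemma orbit_UC_avg_coord I k H a b (x : I -> R -> V) j : H \subset G ->
  orbit_UC k H a b x -> UC k a b (fun i t => (x i t *m avg H) 0 j).
Proof.
move=> HG Hx; apply: (Hx (fun y => (y *m avg H) 0 j)).
  exact: polfun_mul (polfun_coord j).
by move=> h hH y; rewrite -mulmxA avg_actl.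
Qed.

(** To be proved by induction on the group. The time [0] suffices because the
   family may contain translates of its members, and families rather than single
   curves are needed because rescaling replaces one curve by infinitely many. *)
Definition deriv_bounded k H := forall (I : Type) (x dx : I -> R -> V) r,
  0 < r -> orbit_UC k H (- r) r x ->
  (forall i t, - r < t < r -> vder (x i) t (dx i t)) ->
  exists C : R, forall i j, `|dx i 0 0 j| <= C.

(** An invariant of [y] that vanishes when [dot ^~ v] takes the value [z] on the
   orbit of [y]. *)
Definition levels z H v y : R := \prod_(h in H) (z - dot (y *m rG h) v).

Lemma polfun_levels z H v : polfun (levels z H v).
Proof.
apply: polfun_prod => h _; apply: polfunB; first exact: polfun_const.
exact: polfun_mul (polfun_dot v).
Qed.

Lemma invfun_levels z H v : H \subset G -> invfun H (levels z H v).
Proof.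
move=> HG g gH y; rewrite /levels [RHS](reindex_inj (mulgI g)) /=.
apply: eq_big => [h|h hH]; first by rewrite groupMl.
by rewrite actM // (fintype.subsetP HG).
Qed.

Lemma polfun_near_gt f v c : polfun f -> c < f v -> \forall y \near v, c < f y.
Proof.
move=> /polfun_continuous /(_ v) fc cv.
exact: (@cvgr_gt _ _ _ _ f (f v) fc).
Qed.

Lemma gap_levels H v : H \subset G -> exists z0 z1 : R,
  [/\ z0 < z1, z1 < dot v v &
      forall g, g \in H :\: stab H v -> dot (v *m rG g) v < z0].
Proof.
move=> HG; pose D := dot v v.
pose M : R := \big[Order.max/D - 1]_(g in H :\: stab H v) dot (v *m rG g) v.
have MD : M < D.
  apply/bigmax_ltP; split=> [|g]; first by lra.
  rewrite finset.in_setD => /andP[gS gH]; rewrite dotC dot_lt //.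
    by rewrite dot_act // (fintype.subsetP HG).
  by apply: contraNneq gS => /esym vg; apply/stabP.
exists (M + (D - M) / 3), (M + (D - M) * 2 / 3); split=> [||g gS];
  [lra | rewrite -/D; lra |].
have : dot (v *m rG g) v <= M.
  exact: (le_bigmax_cond _ (fun g => dot (v *m rG g) v)).
by lra.
Qed.

Definition gap z0 z1 H v y := z1 < dot y v /\
  forall g, g \in H :\: stab H v -> dot (y *m rG g) v < z0.

Lemma gap_near z0 z1 H v y : gap z0 z1 H v y -> \forall y' \near y, gap z0 z1 H v y'.
Proof.
move=> [y1 y0]; have n3 := polfun_near_gt (polfun_dot v) y1.
have n4g g : \forall y' \near y,
    g \in H :\: stab H v -> dot (y' *m rG g) v < z0.
  have [gS|gS] := boolP (g \in H :\: stab H v); last by near=> y'.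
  have pg : polfun (fun y => 0 - dot (y *m rG g) v).
    apply: polfunB; first exact: polfun_const.
    exact: polfun_mul (polfun_dot v).
  have := @polfun_near_gt _ y (- z0) pg.
  rewrite sub0r ltrN2 => /(_ (y0 g gS)).
  by apply: filterS => y'; rewrite sub0r ltrN2.
have n4 := filter_forall (nbhs_filter y) n4g.
by near=> y'; split; near: y'.
Unshelve. all: by end_near. Qed.

(** At time [0] two levels separate the value of [dot ^~ v] from its other values
   on the orbit. The invariants [levels] being uniformly Lipschitz, no value
   crosses either level during a time interval of uniform length, so the
   reduction to the isotropy group of [v] applies there. *)
Lemma deriv_bounded_near k H v (I : Type) (x dx : I -> R -> V) r :
  H \subset G -> (0 < k)%N -> deriv_bounded k (stab H v) -> 0 < r ->
  orbit_UC k H (- r) r x ->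
  (forall i t, - r < t < r -> vder (x i) t (dx i t)) ->
  exists C : R, \forall y \near v, forall i, x i 0 = y ->
    forall j, `|dx i 0 0 j| <= C.
Proof.
move=> HG k0 IH r0 Hx Hdx; pose S := stab H v.
have SH h : h \in S -> h \in H := fintype.subsetP (stab_sub rG H v) h.
have [z0 [z1 [z01 z1D Hz0]]] := gap_levels v HG.
have lev0 z : z0 <= z <= z1 -> 0 < levels z H v v ^+ 2.
  move=> /andP[z0z zz1]; rewrite lt_def sqr_ge0 sqrf_eq0 andbT.
  apply/prodf_neq0 => h hH; rewrite subr_eq0.
  have [/(stabP rG v h HG)[_ ->]|hS] := boolP (h \in S).
    by rewrite lt_eqF // (le_lt_trans zz1).
  by rewrite gt_eqF // (lt_le_trans _ z0z) // Hz0 // finset.in_setD hS.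
have plev z : polfun (fun y => levels z H v y ^+ 2).
  exact: polfun_exp (polfun_levels z H v).
have levinv z : invfun H (fun y => levels z H v y ^+ 2).
  by move=> h hH y; rewrite invfun_levels.
pose eta z := levels z H v v ^+ 2 / 2.
have etalt z : z0 <= z <= z1 -> eta z < levels z H v v ^+ 2.
  by move=> /lev0; rewrite /eta => ?; lra.
have z0I : z0 <= z0 <= z1 by rewrite lexx ltW.
have z1I : z0 <= z1 <= z1 by rewrite lexx ltW.
pose U y := [/\ eta z0 < levels z0 H v y ^+ 2, eta z1 < levels z1 H v y ^+ 2 &
  gap z0 z1 H v y].
have nU : \forall y \near v, U y.
  have n1 := polfun_near_gt (plev z0) (etalt _ z0I).
  have n2 := polfun_near_gt (plev z1) (etalt _ z1I).
  have n3 := gap_near (conj z1D Hz0).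
  by near=> y; split; near: y.
pose J := {i : I | U (x i 0)}; pose xJ (j : J) := x (sval j).
have lipz z : z0 <= z <= z1 -> exists2 d : R, 0 < d &
    forall i t, - r < t < r -> `|t| < d -> U (x i 0) ->
    eta z < levels z H v (x i 0) ^+ 2 -> levels z H v (x i t) != 0.
  move=> zI; have e0 : 0 < eta z by rewrite divr_gt0 // lev0.
  have [L L0 HL] := UC_lipschitz k0 (Hx _ (plev z) (levinv z)).
  exists (eta z / L); first by rewrite divr_gt0.
  move=> i t tr td _ H0; rewrite -sqrf_eq0.
  have r00 : - r < 0 < r by rewrite r0 oppr_lt0 r0.
  have := HL i 0 t r00 tr; rewrite subr0.
  have : L * `|t| < eta z by rewrite mulrC -ltr_pdivlMr.
  move=> H1 H2; apply: contraTneq (le_lt_trans H2 H1) => ->.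
  rewrite sub0r normrN -leNgt ger0_norm ?sqr_ge0 //; exact: ltW.
have [d0 d00 Hd0] := lipz _ z0I; have [d1 d10 Hd1] := lipz _ z1I.
pose d := Num.min r (Num.min d0 d1).
have dpos : 0 < d by rewrite !lt_min r0 d00.
have dr : d <= r by rewrite ge_min lexx.
have inr t : - d < t < d -> [/\ - r < t < r, `|t| < d0 & `|t| < d1].
  rewrite -ltr_norml => td; split; first by rewrite -ltr_norml (lt_le_trans td).
    by rewrite (lt_le_trans td) // !ge_min lexx orbT.
  by rewrite (lt_le_trans td) // !ge_min lexx !orbT.
have dd0 : - d < 0 < d by rewrite dpos oppr_lt0 dpos.
have side (j : J) t : - d < t < d -> z1 < dot (xJ j t) v /\
    forall g, g \in H :\: S -> dot (xJ j t *m rG g) v < z0.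
  move=> td; case: j => i Ui; rewrite /xJ /=; have [U1 U2 [U3 U4]] := Ui.
  have cont g s : - d < s < d -> {for s, continuous (fun s => dot (x i s *m rG g) v)}.
    move=> /inr[sr _ _]; apply: is_derive_continuous.
    exact: vder_dot (vder_mulmx _ (Hdx i s sr)).
  have avoid g z s : g \in H -> levels z H v (x i s) != 0 ->
      dot (x i s *m rG g) v != z.
    move=> gH /prodf_neq0 /(_ g gH); apply: contra_neq => ->.
    by rewrite subrr.
  split.
    rewrite -ltrN2.
    apply: (@same_side _ (fun s => - dot (x i s) v) (- d) d (- z1) 0 t _ _ dd0 td).
    - move=> s sd; apply: cvgN; have [sr _ _] := inr s sd.
      exact: is_derive_continuous (vder_dot v (Hdx i s sr)).
    - move=> s sd; have [sr _ s1] := inr s sd; rewrite eqr_opp -(act1 rG (x i s)).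
      by apply: avoid; [exact: group1 | exact: Hd1].
    - by rewrite ltrN2.
  move=> g gS; have gH : g \in H by move: gS; rewrite finset.in_setD => /andP[].
  apply: (@same_side _ (fun s => dot (x i s *m rG g) v) (- d) d z0 0 t _ _ dd0 td).
  - by move=> s; exact: cont.
  - move=> s sd; have [sr s0 _] := inr s sd.
    by apply: avoid; [exact: gH | exact: Hd0].
  - exact: U4.
have xJS : orbit_UC k S (- d) d xJ.
  apply: (@orbit_UC_stab _ _ _ _ rG rG_orth H v HG J k (- d) d xJ (z1 - z0)).
  - by rewrite subr_gt0.
  - apply: orbit_UC_reindex; apply: orbit_UC_sub Hx; last exact: dr.
    by rewrite lerN2.
  - move=> j t /inr[tr _ _]; apply: is_derive_continuous.
    exact: vder_dot (Hdx _ t tr).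
  - move=> j t td g gH gS; have [h1 h2] := side j t td.
    have := h2 g; rewrite finset.in_setD gS gH => /(_ isT) h3.
    by rewrite lerB // ltW.
have [|C HC] := IH J xJ (fun j => dx (sval j)) d dpos xJS.
  by move=> j t /inr[tr _ _]; exact: Hdx.
exists C; apply: filterS nU => y Uy i xy j.
by rewrite -xy in Uy; exact: (HC (exist _ i Uy) j).
Unshelve. all: by end_near. Qed.

(** The unit sphere of the orthogonal complement of the fixed vectors is compact,
   and finitely many of the bounds near a given vector suffice. *)
Lemma deriv_bounded_sphere k H (I : Type) (x dx : I -> R -> V) r :
  H \subset G -> (0 < k)%N ->
  (forall v, v *m avg H = 0 -> dot v v = 1 -> deriv_bounded k (stab H v)) ->
  0 < r -> orbit_UC k H (- r) r x ->
  (forall i t, - r < t < r -> vder (x i) t (dx i t)) ->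
  (forall i, x i 0 *m avg H = 0) -> (forall i, dot (x i 0) (x i 0) = 1) ->
  exists C : R, forall i j, `|dx i 0 0 j| <= C.
Proof.
move=> HG k0 IH r0 Hx Hdx x0 x1.
pose K : set V := [set v | v *m avg H = 0 /\ dot v v = 1].
have cK : compact K.
  apply: bounded_closed_compact.
    exists 1; split; first exact: num_real.
    move=> M M1 v [_ v1]; rewrite /= /Num.Def.normr /= mx_normrE.
    apply: bigmax_le => [|[i j] _ /=]; first by rewrite (le_trans ler01) // ltW.
    rewrite ord1 coord_le ?v1 //; first by rewrite (le_trans ler01) // ltW.
    by rewrite expr_ge1 // ltW // (lt_trans ltr01).
  have -> : K = [set v | dot (v *m avg H) (v *m avg H) = 0] `&`
                [set v | dot v v = 1].
    apply/seteqP; split=> v [h1 h2]; split=> //=; first by rewrite h1 dot0l.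
    exact: dot_eq0 h1.
  have cl f c : polfun f -> closed [set v | f v = c].
    move=> pf; have -> : [set v | f v = c] = f @^-1` [set c] by [].
    apply: closed_comp; last exact: closed_eq.
    by move=> v _; exact: polfun_continuous pf v.
  apply: closedI; last exact: cl polfun_sq.
  exact: cl (polfun_mul (avg H) polfun_sq).
have /compact_near_coveringP Kc := cK.
have := Kc R (pinfty_nbhs R) (fun C v => forall i, x i 0 = v ->
  forall j, `|dx i 0 0 j| <= C) _.
case=> [v [v0 v1]|M [_ HM]].
  have [C nC] := deriv_bounded_near HG k0 (IH v v0 v1) r0 Hx Hdx.
  near=> v' C'; have Hv' : forall i, x i 0 = v' ->
    forall j, `|dx i 0 0 j| <= C by near: v'.
  have CC' : C <= C' by near: C'; exact: nbhs_pinfty_ge (num_real C).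
  by move=> i xv j; apply: le_trans CC'; exact: Hv'.
exists (M + 1) => i j.
apply: (HM (M + 1) _ (x i 0)) => //; first by rewrite ltrDl.
Unshelve. all: by end_near. Qed.

End DerivativeBound.

Section RescaledBound.
Context {R : realType} {gT : finGroupType} {G : {group gT}} {m : nat}.
Variable rG : mx_representation R G m.
Hypothesis rG_orth : orthogonal_repr rG.
Notation V := 'rV[R]_m.
Implicit Types (H : {group gT}) (f : V -> R) (v w y : V) (s t a b r : R).
Local Notation stab := (stab rG).
Local Notation orbit_UC := (orbit_UC rG).
Local Notation avg := (avg rG).
Local Notation generated := (generated rG).
Local Notation deriv_bounded := (deriv_bounded rG).

(** Zooming in on the origin, with the same factor in time and space. For a
   homogeneous invariant of degree [e] the derivatives of order at least [e] do
   not grow, and those of lower order are controlled by interpolation. *)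
Lemma orbit_UC_zoom k H (I : Type) (z : I -> R -> V) (eps : I -> R)
    (c r B E : R) :
  generated k H -> (forall i, 0 < eps i <= E) -> 0 < c ->
  (forall i, c * eps i <= r) -> orbit_UC k H (- r) r z -> 0 <= B ->
  (forall i t, -1 < t < 1 ->
     dot (z i ((c * eps i) * t)) (z i ((c * eps i) * t)) <= (B * eps i) ^+ 2) ->
  orbit_UC k H (-1) 1 (fun i t => (eps i)^-1 *: z i ((c * eps i) * t)).
Proof.
move=> gen e0 c0 cr Hz B0 HB.
have eps0 i : 0 < eps i by have /andP[] := e0 i.
have inr i t : -1 < t < 1 -> - r < 0 + (c * eps i) * t < r.
  rewrite add0r -!ltr_norml normrM gtr0_norm ?mulr_gt0 // => t1.
  by rewrite (lt_le_trans _ (cr i)) // -[X in _ < X]mulr1 ltr_pM2l // mulr_gt0.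
apply: orbit_UC_generators => // e f /andP[e_gt0 ek] He fH.
have := Hz f (hompol_polfun He) fH; rewrite -(subnKC ek) => /UC_nth_deriv[g Hg gk].
have Hn := nth_deriv_affine (fun i => (eps i) ^- e) inr Hg.
apply: (@UC_ext _ _ _ _ _
    (fun i t => (eps i) ^- e * f (z i (0 + (c * eps i) * t)))).
  by move=> i t _; rewrite (hompol_scale _ _ He) add0r exprVn.
have [C C0 HC] := hompol_bound He.
apply: (@UC_interpolation _ _ _ _ _ _ _ _ (C * B ^+ e) _ Hn).
- by lra.
- move=> i t t1; rewrite add0r normrM normfV normrX (gtr0_norm (eps0 i)).
  rewrite ler_pdivrMl ?exprn_gt0 // [leRHS]mulrC -[leRHS]mulrA -exprMn; apply: HC.
    by rewrite mulr_ge0 ?(ltW (eps0 i)).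
  by move=> j; apply: coord_le; [rewrite mulr_ge0 ?(ltW (eps0 i)) | exact: HB].
apply: (@UC_ext _ _ _ _ _ (fun i t => c ^+ e * g i (0 + (c * eps i) * t))).
  move=> i t _; rewrite exprMn [_ * (c ^+ e * _)]mulrCA mulVf ?mulr1 //.
  by rewrite expf_neq0 // gt_eqF.
apply: UC_mul; first exact: UC_cst.
apply: (@UC_affine _ I I _ _ _ _ _ g id _ _ (c * E) _ inr gk) => i.
have /andP[h1 h2] := e0 i.
by rewrite gtr0_norm ?mulr_gt0 // ler_pM2l.
Qed.

(** The zoom factor is the initial distance [eps i] to the origin, so that the
   zoomed curve starts on the unit sphere. On the time interval used it stays
   bounded: the slope of the squared length at [0] is controlled by its value,
   since that function is nonnegative. Zooming preserves velocities up to the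
   constant [c]. *)
Lemma deriv_bounded_nonzero k H (I : Type) (z dz : I -> R -> V) r :
  H \subset G -> generated k H -> (1 < k)%N ->
  (forall v, v *m avg H = 0 -> dot v v = 1 -> deriv_bounded k (stab H v)) ->
  0 < r -> orbit_UC k H (- r) r z ->
  (forall i t, - r < t < r -> vder (z i) t (dz i t)) ->
  (forall i, z i 0 *m avg H = 0) -> (forall i, z i 0 != 0) ->
  exists C : R, forall i j, `|dz i 0 0 j| <= C.
Proof.
move=> HG gen k1 IH r0 Hz Hdz z0 zn.
have r00 : - r < 0 < r by rewrite r0 oppr_lt0 r0.
pose N i t := dot (z i t) (z i t).
have NU : UC k (- r) r N.
  apply: (Hz _ polfun_sq) => h hH y.
  exact: (dot_act rG_orth _ _ (fintype.subsetP HG h hH)).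
have [M M0 [dN HdN HM]] := UC_taylor2 k1 NU.
have [E E0 HE] := UC_bounded NU.
pose eps i : R := Num.sqrt (N i 0).
have N0 i : 0 < N i 0 by exact: dot_gt0.
have eps0 i : 0 < eps i by rewrite sqrtr_gt0.
have epsE i : eps i ^+ 2 = N i 0 by rewrite sqr_sqrtr // ltW.
have epsle i : eps i <= 1 + E.
  have := HE i 0 r00; rewrite (gtr0_norm (N0 i)) -epsE => H1.
  by have := sqr_ge0 (eps i - 1); have := eps0 i; nra.
have E1 : 0 < 1 + E by rewrite ltr_pwDl // ltW.
(* [c * eps i] is smaller than [r], as required for [slope_bound]. *)
pose c : R := r / (2 * (1 + E)).
have c0 : 0 < c by rewrite divr_gt0 // mulr_gt0.
have cr i : c * eps i < r.
  apply: (@le_lt_trans _ _ (c * (1 + E))); first by rewrite ler_pM2l.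
  rewrite (_ : c * (1 + E) = r / 2); first by lra.
  by rewrite /c; field; rewrite gt_eqF.
pose B : R := 2 + 2 * (M * c ^+ 2).
have Mc0 : 0 <= M * c ^+ 2 by rewrite mulr_ge0 ?sqr_ge0 // ltW.
have B0 : 0 <= B by rewrite /B; lra.
have HB i t : -1 < t < 1 -> N i ((c * eps i) * t) <= (B * eps i) ^+ 2.
  rewrite -ltr_norml => t1; set s := c * eps i * t.
  have h0 : 0 < c * eps i by rewrite mulr_gt0.
  have sh : `|s| <= c * eps i.
    by rewrite normrM (gtr0_norm h0) ler_piMr ?ltW.
  have sr : - r < s < r by rewrite -ltr_norml (le_lt_trans sh).
  have sl : `|dN i 0| * (c * eps i) <= N i 0 + M * (c * eps i) ^+ 2.
    apply: slope_bound h0 (cr i) _ => u; rewrite ltr_norml => ur.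
    have := HM i 0 u r00 ur; rewrite subr0 => /(le_trans (ler_norm _)) Hu.
    by have := dot_ge0 (z i u); rewrite -/(N i u); lra.
  have := HM i 0 s r00 sr; rewrite subr0 => /(le_trans (ler_norm _)) Hs.
  have d1 : dN i 0 * s <= N i 0 + M * (c * eps i) ^+ 2.
    apply: le_trans (ler_norm _) _; rewrite normrM; apply: le_trans sl.
    by rewrite ler_wpM2l.
  have d2 : M * s ^+ 2 <= M * (c * eps i) ^+ 2.
    rewrite ler_pM2l // -real_normK ?num_real // lerXn2r ?nnegrE //.
    exact: ltW.
  have d3 : M * (c * eps i) ^+ 2 = (M * c ^+ 2) * N i 0.
    by rewrite exprMn epsE mulrA.
  have d4 : N i s <= B * N i 0 by rewrite /B; lra.
  apply: le_trans d4 _; rewrite exprMn epsE ler_pM2r //.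
  by rewrite expr2 ler_peMl // /B; lra.
have epsI i : 0 < eps i <= 1 + E by rewrite eps0 epsle.
have Hzoom := orbit_UC_zoom gen epsI c0 (fun i => ltW (cr i)) Hz B0 HB.
have [i t t1|i|i|C HC] := @deriv_bounded_sphere _ _ _ _ rG rG_orth k H I
  (fun i t => (eps i)^-1 *: z i ((c * eps i) * t))
  (fun i t => ((eps i)^-1 * (c * eps i)) *: dz i ((c * eps i) * t)) 1 HG (ltnW k1) IH
  ltr01 Hzoom.
- apply: vderZ_aff; apply: Hdz; rewrite -ltr_norml.
  have h0 : 0 < c * eps i by rewrite mulr_gt0.
  rewrite normrM (gtr0_norm h0); apply: le_lt_trans (cr i).
  by rewrite ler_piMr ?(ltW h0) // ltW // ltr_norml.
- by rewrite mulr0 -scalemxAl z0 scaler0.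
- rewrite mulr0 dotZl dotZr -/(N i 0) -epsE expr2 mulKf ?gt_eqF //.
  by rewrite mulVf // gt_eqF.
exists (C / c) => i j; rewrite ler_pdivlMr //; apply: le_trans (HC i j).
rewrite mulr0 mxE (_ : _ * (c * _) = c); first by rewrite normrM gtr0_norm // mulrC.
by rewrite mulrCA mulVf ?mulr1 // gt_eqF.
Qed.

(** Bronshtein's theorem for orbit spaces. The average of the curve has invariant
   components and is subtracted. For the rest, a curve starting at the origin is
   of length [O(t)], and the others are zoomed in to the unit sphere, where the
   isotropy groups are proper subgroups. *)
Lemma deriv_boundedP k H : H \subset G -> generated k H -> deriv_bounded k H.
Proof.
have [n] := ubnP #|H|; elim: n H => // n IH H; rewrite ltnS => Hn HG gen.
move=> I x dx r r0 Hx Hdx.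
have r00 : - r < 0 < r by rewrite r0 oppr_lt0 r0.
have avgb : exists C : R, forall i j, `|(dx i 0 *m avg H) 0 j| <= C.
  apply: uniform_fin => j.
  have k0 := generated_degree_gt0 rG_orth j HG gen.
  have [C HC] := UC_deriv_bounded k0 (orbit_UC_avg_coord j HG Hx).
  exists C => i; apply: (HC i 0 _ r00); exact: (vder_mulmx _ (Hdx i 0 r00) j).
have split_dx C1 C2 : (forall i j, `|(dx i 0 *m avg H) 0 j| <= C1) ->
    (forall i j, `|(dx i 0 - dx i 0 *m avg H) 0 j| <= C2) ->
    exists C : R, forall i j, `|dx i 0 0 j| <= C.
  move=> H1 H2; exists (C1 + C2) => i j.
  rewrite -(subrK (dx i 0 *m avg H) (dx i 0)) mxE addrC.
  by apply: le_trans (ler_normD _ _) _; rewrite lerD.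
have [C1 HC1] := avgb.
suff [C2 HC2] : exists C : R, forall i j, `|(dx i 0 - dx i 0 *m avg H) 0 j| <= C.
  exact: split_dx HC1 HC2.
have [triv|/existsNP[y /eqP yn]] := pselect (forall y : V, y *m avg H = y).
  by exists 0 => i j; rewrite triv subrr mxE normr0.
have k1 := generated_degree_gt1 rG_orth HG gen yn.
pose z i t := x i t - x i t *m avg H.
pose dz i t := dx i t - dx i t *m avg H.
have Hz : orbit_UC k H (- r) r z by exact: orbit_UC_compl.
have Hdz i t : - r < t < r -> vder (z i) t (dz i t).
  by move=> tr; apply: vderB; [exact: Hdx | exact: vder_mulmx (Hdx i t tr)].
have zavg i : z i 0 *m avg H = 0 by exact: avg_compl.
have [C HC] : exists C : R, forall i, z i 0 = 0 -> forall j, `|dz i 0 0 j| <= C.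
  have NU : UC k (- r) r (fun i t => dot (z i t) (z i t)).
    apply: (Hz _ polfun_sq) => h hH v.
    exact: (dot_act rG_orth _ _ (fintype.subsetP HG h hH)).
  have [M M0 HM] := UC_zero_quadratic k1 NU (fun i t _ => dot_ge0 _) r00.
  exists (1 + M) => i zi0 j; apply: (deriv_le r0 (Hdz i 0 r00 j)).
    by rewrite zi0 mxE.
  move=> t tr; apply: coord_le.
    by rewrite mulr_ge0 // addr_ge0 // ltW.
  apply: le_trans (HM i t _ _) _; first by rewrite zi0 dot0l.
    by rewrite -ltr_norml.
  rewrite subr0 exprMn real_normK ?num_real // ler_wpM2r ?sqr_ge0 //.
  by nra.
have [C' HC'] : exists C : R, forall (i : {i | z i 0 != 0}) j,
    `|dz (sval i) 0 0 j| <= C.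
  apply: (@deriv_bounded_nonzero k H {i | z i 0 != 0}
    (fun i => z (sval i)) (fun i => dz (sval i)) r) => //.
  - move=> v v0 v1; apply: IH; last exact: generated_stab.
      rewrite (leq_trans _ Hn) // card_stab_lt //.
      by apply: contra_eq_neq v1 => ->; rewrite dot0l eq_sym oner_eq0.
    exact: fintype.subset_trans (stab_sub rG H v) HG.
  - exact: orbit_UC_reindex.
  - by move=> i t tr; exact: Hdz.
  - by move=> i; exact: (svalP i).
exists (Num.max C C') => i j; rewrite le_max.
have [zi0|zin] := eqVneq (z i 0) 0; first by rewrite HC.
by rewrite (HC' (exist _ i zin) j) orbT.
Qed.

End RescaledBound.

(** * Gluing differentiable lifts *)

Section LocalDerivative.
Context {R : realType} {m : nat}.
Notation V := 'rV[R]_m.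
Implicit Types (u w : R -> V) (d v : V) (s t a b : R).

Lemma vder_ext u w t d : (\forall s \near t, u s = w s) ->
  vder u t d -> vder w t d.
Proof.
move=> uw Hu j; apply: near_eq_is_derive (Hu j).
by apply: filterS uw => s ->.
Qed.

Lemma vder_ext_oo u w a b t d : a < t < b ->
  (forall s, a < s < b -> u s = w s) -> vder u t d -> vder w t d.
Proof. by move=> tab uw; apply: vder_ext; apply: filterS uw (near_oo tab). Qed.

Lemma vder_glue u w t d : u t = w t -> vder u t d -> vder w t d ->
  vder (fun s => if s <= t then u s else w s) t d.
Proof.
move=> uwt Hu Hw j; apply/dlinP => e e0.
have /dlinP /(_ e e0)[d1 d10 H1] := Hu j.
have /dlinP /(_ e e0)[d2 d20 H2] := Hw j.
exists (Num.min d1 d2); first by rewrite lt_min d10.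
move=> s; rewrite lt_min => /andP[s1 s2]; rewrite lexx.
by case: ifP => _; [exact: H1 | rewrite uwt; exact: H2].
Qed.

Lemma vder_near_nonzero u t d : vder u t d -> (u t != 0) || (d != 0) ->
  \forall s \near t^', u s != 0.
Proof.
move=> Hu H.
have [j Hj] : exists j, (u t 0 j != 0) || (d 0 j != 0).
  case/orP: H => /rV0Pn[j Hj]; exists j; apply/orP; [left|right]; exact: Hj.
suff : \forall s \near t^', u s 0 j != 0.
  by apply: filterS => s; apply: contra_neq => ->; rewrite mxE.
have [ut0|utn] := eqVneq (u t 0 j) 0; last first.
  apply: nbhs_dnbhs; have uc := is_derive_continuous (Hu j).
  have /cvgrPdist_lt /(_ `|u t 0 j|) := uc.
  rewrite normr_gt0 => /(_ utn); apply: filterS => s.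
  by apply: contraTneq => ->; rewrite subr0 ltxx.
rewrite ut0 eqxx /= in Hj.
have /dlinP /(_ (`|d 0 j| / 2))[|r r0 Hr] := Hu j.
  by rewrite divr_gt0 ?normr_gt0.
near=> s; have st : s != t by near: s; exact: nbhs_dnbhs_neq.
have sr : `|s - t| < r.
  near: s; apply: nbhs_dnbhs; apply/nbhs_ballP; exists r => //= s.
  by rewrite /ball /= distrC.
apply: contraTneq isT => us0; have := Hr s sr.
rewrite us0 ut0 subrr sub0r normrN normrM.
rewrite ler_pM2r ?normr_gt0 ?subr_eq0 // => dd.
by have : 0 < `|d 0 j|; [rewrite normr_gt0 | move=> d0; exfalso; lra].
Unshelve. all: by end_near. Qed.

End LocalDerivative.

Section Lifts.
Context {R : realType} {gT : finGroupType} {G : {group gT}} {m : nat}.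
Variable rG : mx_representation R G m.
Notation V := 'rV[R]_m.
Implicit Types (H : {group gT}) (u w x : R -> V) (d v y z : V) (s t a b p q : R).

Definition same_orbit H v y := exists2 h, h \in H & y = v *m rG h.

(** The arbitrary curve [x] only names the curve of orbits to be lifted. *)
Definition diff_lift H x a b u := forall t, a < t < b ->
  same_orbit H (x t) (u t) /\ exists d, vder u t d.

Section OneGroup.
Variable H : {group gT}.
Hypothesis HG : H \subset G.
Let inG h : h \in H -> h \in G.
Proof. exact: (fintype.subsetP HG). Qed.

Lemma same_orbit_refl v : same_orbit H v v.
Proof. by exists 1%g; rewrite ?group1 // act1. Qed.

Lemma same_orbit_sym v y : same_orbit H v y -> same_orbit H y v.
Proof.
by move=> [h hH ->]; exists h^-1%g; rewrite ?groupV // actK // inG.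
Qed.

Lemma same_orbit_trans v y z :
  same_orbit H v y -> same_orbit H y z -> same_orbit H v z.
Proof.
by move=> [h hH ->] [g gH ->]; exists (h * g)%g; rewrite ?groupM // actM // inG.
Qed.

Lemma diff_lift_sub x a b a' b' u : a <= a' -> b' <= b ->
  diff_lift H x a b u -> diff_lift H x a' b' u.
Proof.
move=> aa bb Hu t /andP[t1 t2]; apply: Hu.
by rewrite (le_lt_trans aa) // (lt_le_trans t2).
Qed.

Lemma diff_lift_act x a b u h : h \in H -> diff_lift H x a b u ->
  diff_lift H x a b (fun t => u t *m rG h).
Proof.
move=> hH Hu t /Hu[ut [d Hd]]; split; last first.
  by exists (d *m rG h); exact: vder_mulmx.
by apply: same_orbit_trans ut _; exists h.
Qed.

Lemma diff_lift_ext x a b u w : (forall t, a < t < b -> u t = w t) ->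
  diff_lift H x a b u -> diff_lift H x a b w.
Proof.
move=> uw Hu t tab; have [ut [d Hd]] := Hu t tab; split; first by rewrite -uw.
by exists d; apply: vder_ext_oo tab uw Hd.
Qed.

(** By finiteness, one group element carries one lift to the other along a
   sequence of times tending to [t], hence to first order at [t]. *)
Lemma lifts_match u w t d d' : vder u t d -> vder w t d' ->
  (\forall s \near t^', same_orbit H (u s) (w s)) ->
  exists2 h, h \in H & w t = u t *m rG h /\ d' = d *m rG h.
Proof.
move=> Hu Hw Huw; apply: contrapT => Hn.
have Hh h : \forall s \near t^', h \in H -> w s - u s *m rG h != 0.
  have [hH|hH] := boolP (h \in H); last by near=> s.
  have Hv := vderB Hw (vder_mulmx (rG h) Hu).
  have [|//] := boolP ((w t - u t *m rG h != 0) || (d' - d *m rG h != 0)).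
    by move=> /(vder_near_nonzero Hv); apply: filterS.
  rewrite negb_or !negbK !subr_eq0 => /andP[/eqP h1 /eqP h2].
  by exfalso; apply: Hn; exists h.
have Hall := filter_forall (dnbhs_filter t) Hh.
have : \forall s \near t^', False.
  apply: filterS2 Huw Hall => s [h hH ->] /(_ h hH).
  by rewrite subrr eqxx.
by move=> /filter_ex[].
Unshelve. all: by end_near. Qed.

Lemma diff_lift_match x a b a' b' u w t : diff_lift H x a b u ->
  diff_lift H x a' b' w -> a < t < b -> a' < t < b' ->
  exists2 h, h \in H & exists d, [/\ w t *m rG h = u t, vder u t d &
    vder (fun s => w s *m rG h) t d].
Proof.
move=> Hu Hw tab tab'.
have [_ [d Hd]] := Hu t tab; have [_ [d' Hd']] := Hw t tab'.
have [|h hH [uw dd]] := lifts_match Hd' Hd.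
  apply: nbhs_dnbhs; apply: filterS2 (near_oo tab) (near_oo tab') => s sab sab'.
  have [us _] := Hu s sab; have [ws _] := Hw s sab'.
  exact: same_orbit_trans (same_orbit_sym ws) us.
exists h => //; exists d; split=> //.
by rewrite dd; exact: vder_mulmx.
Qed.

Lemma diff_lift_glue_right x a b a' b' u w t : diff_lift H x a b u ->
  diff_lift H x a' b' w -> a < t < b -> a' < t < b' ->
  exists2 u', diff_lift H x a b' u' & forall s, s <= t -> u' s = u s.
Proof.
move=> Hu Hw tab tab'.
have [h hH [d [uw Hd Hd']]] := diff_lift_match Hu Hw tab tab'.
exists (fun s => if s <= t then u s else w s *m rG h) => [s|s ->] //.
move=> /andP[as_ sb]; case: (ltgtP s t) => st.
- have sab : a < s < b.
    by rewrite as_ (lt_trans st) //; case/andP: tab.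
  have [us [e He]] := Hu s sab; split=> //; exists e.
  apply: vder_ext He; near=> r; rewrite ifT // ltW //.
  by near: r; exact: lt_nbhsl.
- have sab : a' < s < b'.
    by rewrite sb (lt_trans _ st) //; case/andP: tab'.
  have [us [e He]] := diff_lift_act hH Hw sab; split=> //; exists e.
  apply: vder_ext He; near=> r; rewrite ifF //; apply/negbTE; rewrite -ltNge.
  by near: r; exact: lt_nbhsr.
- rewrite st; have [ut _] := Hu t tab; split=> //; exists d.
  exact: vder_glue.
Unshelve. all: by end_near. Qed.

Lemma diff_lift_glue_left x a b a' b' u w t : diff_lift H x a b u ->
  diff_lift H x a' b' w -> a < t < b -> a' < t < b' ->
  exists2 u', diff_lift H x a' b u' & forall s, t <= s -> u' s = u s.
Proof.
move=> Hu Hw tab tab'.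
have [h hH [d [uw Hd Hd']]] := diff_lift_match Hu Hw tab tab'.
exists (fun s => if s <= t then w s *m rG h else u s) => [s|s ts]; last first.
  case: ifP => // st; have -> : s = t by apply/eqP; rewrite eq_le st.
  exact: uw.
move=> /andP[as_ sb]; case: (ltgtP s t) => st.
- have sab : a' < s < b'.
    by rewrite as_ (lt_trans st) //; case/andP: tab'.
  have [us [e He]] := diff_lift_act hH Hw sab; split=> //; exists e.
  apply: vder_ext He; near=> r; rewrite ifT // ltW //.
  by near: r; exact: lt_nbhsl.
- have sab : a < s < b.
    by rewrite sb (lt_trans _ st) //; case/andP: tab.
  have [us [e He]] := Hu s sab; split=> //; exists e.
  apply: vder_ext He; near=> r; rewrite ifF //; apply/negbTE; rewrite -ltNge.
  by near: r; exact: lt_nbhsr.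
- rewrite st uw; have [ut _] := Hu t tab; split=> //; exists d.
  exact: vder_glue.
Unshelve. all: by end_near. Qed.

Definition local_lift x t := exists2 e : R, 0 < e &
  exists u, diff_lift H x (t - e) (t + e) u.

(** The supremum of the end points that can be reached from [p] can be passed by
   gluing on a local lift there. *)
Lemma local_lifts_compact x a b p q : (forall t, a < t < b -> local_lift x t) ->
  a < p -> p < q -> q < b -> exists u, diff_lift H x p q u.
Proof.
move=> loc ap pq qb; apply: contrapT => Hn.
pose E := [set r | p < r <= q /\ exists u, diff_lift H x p r u].
have E0 : E !=set0.
  have [|e e0 [u Hu]] := loc p; first by rewrite ap (lt_trans pq).
  exists (Num.min q (p + e)); split.
    by rewrite lt_min pq ltrDl e0 ge_min lexx.
  exists u; apply: diff_lift_sub Hu; first by rewrite gerBl ltW.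
  by rewrite ge_min lexx orbT.
have Eub : has_ubound E by exists q => r [/andP[]].
have Es : has_sup E by split.
pose s := sup E.
have sq : s <= q by apply: ge_sup => // r [/andP[]].
have Ele r : E r -> r <= s by move=> Er; exact: ub_le_sup.
have ps : p < s.
  by have [r Er] := E0; have [/andP[pr _] _] := Er; rewrite (lt_le_trans pr) // Ele.
have [|e e0 [w Hw]] := loc s; first by rewrite (lt_trans ap) // (le_lt_trans sq).
have [r [/andP[pr rq] [u Hu]] sr] := sup_adherent e0 Es.
have rs : r <= s by apply: Ele; split; [rewrite pr | exists u].
pose t := (Num.max p (s - e) + r) / 2.
have mr : Num.max p (s - e) < r by rewrite gt_max pr.
have tr : t < r by rewrite /t; lra.
have : Num.max p (s - e) < t by rewrite /t; lra.
rewrite gt_max => /andP[pt set_].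
have [||u' Hu' _] := diff_lift_glue_right Hu Hw (t := t).
- by rewrite pt.
- by rewrite set_ (lt_trans tr) // (le_lt_trans rs) // ltrDl.
case: (leP q (s + e)) => qse.
  by apply: Hn; exists u'; exact: diff_lift_sub Hu'.
have : s + e <= s.
  apply: Ele; split; last by exists u'.
  by rewrite (lt_trans ps) ?ltrDl // ltW.
by rewrite gerDl leNgt e0.
Qed.

(** Lifts over the members of an exhaustion need not be restrictions of one
   another: each is modified outside a slightly smaller interval before it is
   continued, so that the lifts stabilise. *)
Lemma lifts_exhaust x (p q : nat -> R) : (forall n, p n.+1 < p n) ->
  (forall n, q n < q n.+1) -> p 0%N < q 0%N ->
  (forall n, exists u, diff_lift H x (p n) (q n) u) ->
  exists u, forall n, diff_lift H x (p n) (q n) u.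
Proof.
move=> pS qS pq0 /choice[w Hw].
have ple n n' : (n <= n')%N -> p n' <= p n.
  move=> /subnK <-; elim: (n' - n)%N => [//|l IH].
  by rewrite addSn (le_trans (ltW (pS _))).
have qle n n' : (n <= n')%N -> q n <= q n'.
  move=> /subnK <-; elim: (n' - n)%N => [//|l IH].
  by rewrite addSn (le_trans _ (ltW (qS _))).
have step (nu : nat * (R -> V)) : exists u', diff_lift H x (p nu.1.+1)
    (q nu.1.+1) nu.2 -> diff_lift H x (p nu.1.+2) (q nu.1.+2) u' /\
    forall s, p nu.1 < s < q nu.1 -> u' s = nu.2 s.
  case: nu => n u /=; have [Hu|] := pselect (diff_lift H x (p n.+1) (q n.+1) u);
    last by exists u.
  have h1 := pS n; have h2 := pS n.+1; have h3 := qS n; have h4 := qS n.+1.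
  have h5 := ple 0%N n (leq0n n); have h6 := qle 0%N n (leq0n n).
  have [||u1 Hu1 E1] := diff_lift_glue_right Hu (Hw n.+2) (t := q n);
    [by apply/andP; split; lra | by apply/andP; split; lra |].
  have [||u2 Hu2 E2] := diff_lift_glue_left Hu1 (Hw n.+2) (t := p n);
    [by apply/andP; split; lra | by apply/andP; split; lra |].
  exists u2 => _; split=> // s /andP[s1 s2].
  by rewrite E2 ?E1 // ltW.
have [next Hnext] := choice step.
pose U := fix U n := if n is n'.+1 then next (n', U n') else w 1%N.
have HU n : diff_lift H x (p n.+1) (q n.+1) (U n).
  by elim: n => [|n IH]; [exact: Hw | have [] := Hnext (n, U n) IH].
have US n s : p n < s < q n -> U n.+1 s = U n s.
  by move=> sn; have [_ Hn] := Hnext (n, U n) (HU n); exact: Hn.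
have Ule n n' s : (n <= n')%N -> p n < s < q n -> U n' s = U n s.
  move=> /subnK <- sn; elim: (n' - n)%N => [//|l IH]; rewrite addSn US //.
  have := ple n (l + n)%N (leq_addl _ _); have := qle n (l + n)%N (leq_addl _ _).
  by case/andP: sn => s1 s2 le1 le2; apply/andP; split; lra.
have /choice[N HN] : forall s, exists n0,
    forall n, p n < s < q n -> p n0 < s < q n0.
  move=> s; have [[n Hn]|Hn] := pselect (exists n, p n < s < q n).
    by exists n.
  by exists 0%N => n sn; case: Hn; exists n.
exists (fun s => U (N s) s) => n t tn.
have near_eq s : p n < s < q n -> U n s = U (N s) s.
  move=> sn.
  rewrite -(Ule _ (maxn n (N s)) s (leq_maxl _ _) sn).
  by rewrite (Ule _ _ s (leq_maxr n _) (HN s n sn)).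
apply: (diff_lift_ext near_eq _ tn); apply: diff_lift_sub (HU n); exact: ltW.
Qed.

Lemma local_lifts_open x a b : a < b -> (forall t, a < t < b -> local_lift x t) ->
  exists u, diff_lift H x a b u.
Proof.
move=> ab loc; have ba0 : 0 < b - a by rewrite subr_gt0.
pose e n : R := (b - a) / n.+3%:R.
have e0 n : 0 < e n by rewrite divr_gt0.
have eS n : e n.+1 < e n.
  by rewrite ltr_pM2l // ltf_pV2 ?posrE ?ltr0n // ltr_nat.
have e3 n : e n <= (b - a) / 3.
  by rewrite ler_pM2l // lef_pV2 ?posrE ?ltr0n // ler_nat.
have [||||u Hu] := @lifts_exhaust x (fun n => a + e n) (fun n => b - e n).
- by move=> n; rewrite ltrD2l.
- by move=> n; rewrite ltrD2l ltrN2.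
- by have := e3 0%N; lra.
- move=> n; apply: (local_lifts_compact loc).
  + by rewrite ltrDl.
  + by have := e3 n; lra.
  + by rewrite gtrBl.
exists u => t /andP[at_ tb]; pose d := Num.min (t - a) (b - t).
have d0 : 0 < d by rewrite lt_min !subr_gt0 at_.
have := archi_boundP (ltW (divr_gt0 ba0 d0)); set n := Num.bound _ => nb.
have : e n < d.
  rewrite ltr_pdivrMr // mulrC -ltr_pdivrMr //; apply: lt_trans nb _.
  by rewrite ltr_nat -addn3 -[X in (X < _)%N]addn0 ltn_add2l.
rewrite lt_min => /andP[h1 h2]; apply: (Hu n).
by apply/andP; split; lra.
Qed.

Lemma local_lifts_global x : (forall t, local_lift x t) ->
  exists u, forall a b, diff_lift H x a b u.
Proof.
move=> loc; have [||||u Hu] := @lifts_exhaust x (fun n => - n.+1%:R)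
  (fun n => n.+1%:R).
- by move=> n; rewrite ltrN2 ltr_nat.
- by move=> n; rewrite ltr_nat.
- by rewrite (lt_trans (y := 0)) ?oppr_lt0 ?ltr0n.
- move=> n; apply: (@local_lifts_open x _ _ _ (fun t _ => loc t)).
  by rewrite (lt_trans (y := 0)) ?oppr_lt0 ?ltr0n.
exists u => a b t _; apply: (Hu (Num.bound `|t|)).
rewrite -ltr_norml; apply: lt_trans (archi_boundP (normr_ge0 t)) _.
by rewrite ltr_nat.
Qed.

(** On an arbitrary bounded open set, the lifts are chosen on each component
   separately; a component is identified by its end points. *)
Lemma local_lifts_open_set x a b (O : set R) : (forall t, O t -> a < t < b) ->
  open O -> (forall t, O t -> local_lift x t) ->
  exists u, forall t, O t -> same_orbit H (x t) (u t) /\ exists d, vder u t d.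
Proof.
move=> Oab oO loc.
pose comp t := [set s | forall r, Num.min t s <= r <= Num.max t s -> O r].
have compC t s : comp t s -> comp s t.
  by move=> H1 r; rewrite minC maxC; exact: H1.
have compT t s r : comp t s -> comp s r -> comp t r.
  move=> H1 H2 q /andP[q1 q2].
  have [qs|sq] := leP q s.
    have [tq|qt] := leP t q.
      by apply: H1; rewrite ge_min tq le_max qs orbT.
    apply: H2; move: q1; rewrite ge_min leNgt qt /= => rq.
    by rewrite ge_min rq orbT le_max qs.
  have [qt|tq] := leP q t.
    by apply: H1; rewrite ge_min (ltW sq) orbT le_max qt.
  apply: H2; move: q2; rewrite le_max leNgt tq /= => qr.
  by rewrite ge_min (ltW sq) le_max qr orbT.
have comp_eq t s : comp t s -> comp s = comp t.
  move=> H1; apply/seteqP; split=> r; first exact: compT.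
  exact/compT/compC.
have comp_refl t : O t -> comp t t.
  move=> Ot r; rewrite minxx maxxx => /andP[h1 h2].
  by have -> : r = t by apply/eqP; rewrite eq_le h1 h2.
have compO t s : comp t s -> O s.
  by move=> /(_ s); rewrite ge_min le_max lexx !orbT; apply.
pose lo t := inf (comp t); pose hi t := sup (comp t).
have bnd t : has_ubound (comp t) /\ has_lbound (comp t).
  by split; [exists b | exists a] => s /compO /Oab /andP[h1 h2]; exact: ltW.
have lohi t s : O t -> lo t < s < hi t -> comp t s.
  move=> Ot /andP[ls sh]; have ct := comp_refl t Ot; have [ub lb] := bnd t.
  have ne : comp t !=set0 by exists t.
  have [s1 c1 s1s] := inf_lt ne ls.
  have [s2 c2 ss2] := sup_gt ne sh.
  have c12 := compT _ _ _ (compC _ _ c1) c2.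
  apply: compT c1 _ => r /andP[r1 r2]; apply: c12.
  move: r1 r2; rewrite (min_l (ltW s1s)) (max_r (ltW s1s)) => r1 r2.
  have s12 := ltW (lt_trans s1s ss2).
  by rewrite (min_l s12) (max_r s12) r1 (le_trans r2) // ltW.
have inlohi t : O t -> lo t < t < hi t.
  move=> Ot; have [ub lb] := bnd t.
  have /nbhs_ballP[e /= e0 He] := open_nbhs_nbhs (conj oO Ot).
  have ce s : `|s - t| < e -> comp t s.
    move=> se r /andP[r1 r2]; apply: He; rewrite /ball /= distrC.
    apply: le_lt_trans se; move: r1 r2; case: (leP t s) => ts r1 r2.
      by rewrite !ger0_norm ?subr_ge0 // lerB.
    by rewrite !ler0_norm ?subr_le0 // ?(ltW ts) // lerN2 lerB.
  have e2 : 0 < e / 2 by rewrite divr_gt0.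
  apply/andP; split.
    apply: (@le_lt_trans _ _ (t - e / 2)); last by rewrite gtrBl.
    apply: ge_inf => //; apply: ce.
    by rewrite addrC addKr normrN gtr0_norm //; lra.
  apply: (@lt_le_trans _ _ (t + e / 2)); first by rewrite ltrDl.
  apply: ub_le_sup => //; apply: ce.
  by rewrite addrC addKr gtr0_norm //; lra.
have /choice[L HL] : forall pq : R * R, exists u,
    (exists u', diff_lift H x pq.1 pq.2 u') -> diff_lift H x pq.1 pq.2 u.
  move=> pq; have [[u Hu]|Hn] := pselect (exists u', diff_lift H x pq.1 pq.2 u').
    by exists u.
  by exists x => /Hn.
have HLt t : O t -> diff_lift H x (lo t) (hi t) (L (lo t, hi t)).
  move=> Ot; apply: (HL (lo t, hi t)); apply: local_lifts_open => /=.
    by have /andP[] := inlohi t Ot; exact: lt_trans.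
  by move=> s /(lohi t s Ot) /compO; exact: loc.
exists (fun t => L (lo t, hi t) t) => t Ot.
apply: (diff_lift_ext _ (HLt t Ot) (inlohi t Ot)) => s /(lohi t s Ot) cts.
by rewrite /lo /hi (comp_eq t s cts).
Qed.

End OneGroup.
End Lifts.

(** * Existence of differentiable lifts *)

Section OrbitDistance.
Context {R : realType} {gT : finGroupType} {G : {group gT}} {m : nat}.
Variable rG : mx_representation R G m.
Hypothesis rG_orth : orthogonal_repr rG.
Notation V := 'rV[R]_m.
Implicit Types (H : {group gT}) (f : V -> R) (v w y : V) (s t a b r e : R).
Local Notation stab := (stab rG).
Local Notation orbit_UC := (orbit_UC rG).
Local Notation invfun := (invfun rG).
Local Notation generated := (generated rG).
Local Notation gap := (gap rG).
Local Notation same_orbit := (same_orbit rG).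

Definition dist2 v y : R := dot (v - y) (v - y).

Lemma dist2C v y : dist2 v y = dist2 y v.
Proof.
by rewrite /dist2 -opprB -scaleN1r dotZl dotZr mulN1r mulN1r opprK.
Qed.

Lemma dist2_triangle v y w : dist2 v w <= 2 * dist2 v y + 2 * dist2 y w.
Proof.
have := dot_ge0 ((v - y) - (y - w)); rewrite /dist2.
have -> : v - w = (v - y) + (y - w) by rewrite addrA subrK.
move: (v - y) (y - w) => p q.
rewrite !(dotBl, dotBr, dotDl, dotDr) (dotC q p); lra.
Qed.

Lemma dist2_act v y h : h \in G -> dist2 (v *m rG h) (y *m rG h) = dist2 v y.
Proof. by move=> hG; rewrite /dist2 -mulmxBl dot_act. Qed.

Lemma near_dist2 v (P : V -> Prop) : (\forall y \near v, P y) ->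
  exists2 e : R, 0 < e & forall y, dist2 y v < e -> P y.
Proof.
move=> /nbhs_ballP[r /= r0 Hr]; exists ((r / 2) ^+ 2).
  by rewrite exprn_gt0 // divr_gt0.
move=> y yv; apply: Hr; split=> // i j; rewrite ord1 /ball /= distrC.
have := @coord_le _ _ (y - v) j (r / 2); rewrite !mxE => H.
by apply: le_lt_trans (H _ (ltW yv)) _; lra.
Qed.

Lemma polfun_near f v e : polfun f -> 0 < e -> \forall y \near v, `|f v - f y| < e.
Proof.
move=> /polfun_continuous /(_ v) fc e0.
by move/cvgrPdist_lt : fc => /(_ e e0).
Qed.

(** Replaces the distance to the orbit of [v], which is not polynomial. *)
Definition orbit_dist H v y : R := \prod_(h in H) dist2 (y *m rG h) v.

Lemma polfun_orbit_dist H v : polfun (orbit_dist H v).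
Proof.
by apply: polfun_prod => h _; exact: (polfun_affine (rG h) (- v) polfun_sq).
Qed.

Lemma invfun_orbit_dist H v : H \subset G -> invfun H (orbit_dist H v).
Proof.
move=> HG g gH y; rewrite /orbit_dist [RHS](reindex_inj (mulgI g)) /=.
apply: eq_big => [h|h hH]; first by rewrite groupMl.
by rewrite actM // (fintype.subsetP HG).
Qed.

Lemma orbit_dist0 H v : orbit_dist H v v = 0.
Proof.
by rewrite /orbit_dist (bigD1 1%g) //= act1 /dist2 subrr dot0l mul0r.
Qed.

Lemma orbit_dist_lt H v y e : 0 < e -> orbit_dist H v y < e ^+ #|H| ->
  exists2 h, h \in H & dist2 (y *m rG h) v < e.
Proof.
move=> e0 He; apply: contrapT => Hn; move: He; rewrite ltNge => /negP; apply.
rewrite -prodr_const; apply: ler_prod => h hH; rewrite (ltW e0) leNgt /=.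
by apply/negP => he; apply: Hn; exists h.
Qed.

Lemma orbit_UC_same_orbit k H a b (x x' : R -> V) :
  (forall t, a < t < b -> same_orbit H (x t) (x' t)) ->
  orbit_UC k H a b (fun _ : unit => x) -> orbit_UC k H a b (fun _ : unit => x').
Proof.
move=> xx' Hx f pf fH; apply: UC_ext (Hx f pf fH) => _ t /xx'[h hH ->].
by rewrite fH.
Qed.

(** The invariant [orbit_dist] is continuous along the curve and vanishes at
   [t0]. *)
Lemma orbit_close k H a b (x : R -> V) t0 e : H \subset G -> (0 < k)%N ->
  orbit_UC k H a b (fun _ : unit => x) -> a < t0 < b -> 0 < e ->
  \forall t \near t0, exists2 h, h \in H & dist2 (x t *m rG h) (x t0) < e.
Proof.
move=> HG k0 Hx tab e0.
have HU := Hx _ (polfun_orbit_dist H (x t0)) (invfun_orbit_dist (x t0) HG).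
have := UC_continuous (i := tt) k0 HU tab.
move=> /cvgrPdist_lt /(_ (e ^+ #|H|)); rewrite exprn_gt0 // => /(_ isT).
apply: filterS => t; rewrite orbit_dist0 sub0r normrN => H1.
by apply: orbit_dist_lt => //; apply: le_lt_trans H1; exact: ler_norm.
Qed.

(** Choosing near [t0] the representatives of the orbits that are close to
   [v = x t0] keeps the value of [dot ^~ v] above its other values on the orbit,
   so the reduction to the isotropy group of [v] applies. *)
Lemma local_slice k H a b (x : R -> V) t0 : H \subset G -> (0 < k)%N ->
  orbit_UC k H a b (fun _ : unit => x) -> a < t0 < b ->
  exists2 d : R, 0 < d & exists x', (forall t, same_orbit H (x t) (x' t)) /\
    orbit_UC k (stab H (x t0)) (t0 - d) (t0 + d) (fun _ : unit => x').
Proof.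
move=> HG k0 Hx tab; pose v := x t0; pose S := stab H v.
have [z0 [z1 [z01 z1D Hz0]]] := gap_levels rG_orth v HG.
have [e e0 He] := near_dist2 (gap_near (conj z1D Hz0)).
have /nbhs_ballP[d1 /= d10 Hd1] := orbit_close HG k0 Hx tab e0.
have /andP[at0 t0b] := tab.
pose d := Num.min d1 (Num.min (t0 - a) (b - t0)).
have d0 : 0 < d by rewrite !lt_min d10 !subr_gt0 at0.
have dd1 : d <= d1 by rewrite ge_min lexx.
have da : d <= t0 - a by rewrite !ge_min lexx !orbT.
have db : d <= b - t0 by rewrite !ge_min lexx !orbT.
have Hd t : t0 - d < t < t0 + d ->
    exists2 h, h \in H & dist2 (x t *m rG h) (x t0) < e.
  rewrite -ltr_distl => td; apply: Hd1; rewrite /ball /= distrC.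
  exact: lt_le_trans td dd1.
have /choice[x' Hx'] t : exists y, same_orbit H (x t) y /\
    (t0 - d < t < t0 + d -> gap z0 z1 H v y).
  have [td|] := boolP (t0 - d < t < t0 + d); last first.
    by move=> _; exists (x t); split=> //; exact: same_orbit_refl.
  have [h hH hd] := Hd t td.
  by exists (x t *m rG h); split=> [|_]; [exists h | exact: He].
exists d => //; exists x'; split=> [t|]; first by have [] := Hx' t.
have Hx'H : orbit_UC k H (t0 - d) (t0 + d) (fun _ : unit => x').
  apply: (orbit_UC_same_orbit (x := x)).
    by move=> t _; have [] := Hx' t.
  by apply: orbit_UC_sub Hx; lra.
have z10 : 0 < z1 - z0 by rewrite subr_gt0.
apply: (orbit_UC_stab rG_orth HG z10 Hx'H).
- move=> _ s sd; apply/cvgrPdist_lt => e' e'0.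
  have [_ /(_ sd) gs] := Hx' s.
  have ns : \forall y \near x' s, gap z0 z1 H v y /\
      `|dot (x' s) v - dot y v| < e'.
    apply: filterI; first exact: gap_near.
    exact: (polfun_near (x' s) (polfun_dot v) e'0).
  have [e1 e10 He1] := near_dist2 ns.
  apply: filterS2 (orbit_close HG k0 Hx'H sd e10) (near_oo sd).
  move=> t [h hH /He1[[gh1 gh2] he]] td; have [_ /(_ td)[g1 g2]] := Hx' t.
  have [hS|hS] := boolP (h \in S).
    by rewrite -(invfun_dot_stab rG_orth HG hS (x' t)).
  have := g2 h; rewrite finset.in_setD hS hH => /(_ isT) H1.
  by have := lt_trans gh1 H1; rewrite ltNge (ltW z01).
- move=> _ t td g gH gS; have [_ /(_ td)[g1 g2]] := Hx' t.
  have := g2 g; rewrite finset.in_setD gS gH => /(_ isT) H1.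
  by rewrite lerB // ltW.
Qed.

(** Every homogeneous invariant has a leading term at [t0], so all invariants
   converge along the rescaled curve; that curve is bounded, and the orbit of any
   cluster point is then its limit. *)
Lemma blowup_converges k H a b (y : R -> V) t0 : H \subset G ->
  generated k H -> (1 < k)%N -> orbit_UC k H a b (fun _ : unit => y) ->
  a < t0 < b -> y t0 = 0 ->
  exists v, forall e, 0 < e -> \forall t \near t0^',
    exists2 h, h \in H & dist2 (((t - t0)^-1 *: y t) *m rG h) v < e.
Proof.
move=> HG gen k1 Hy tab y0; pose z t := (t - t0)^-1 *: y t.
have NU : UC k a b (fun (_ : unit) t => dot (y t) (y t)).
  apply: (Hy _ polfun_sq) => h hH v.
  exact: (dot_act rG_orth _ _ (fintype.subsetP HG h hH)).
have [M M0 HM] := UC_zero_quadratic k1 NU (fun i t _ => dot_ge0 _) tab.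
have yle t j : a < t < b -> `|y t 0 j| <= (1 + M) * `|t - t0|.
  move=> tab'; apply: coord_le; first by rewrite mulr_ge0 // addr_ge0 // ltW.
  apply: le_trans (HM tt t _ tab') _; first by rewrite y0 dot0l.
  by rewrite exprMn real_normK ?num_real // ler_wpM2r ?sqr_ge0 //; nra.
have M1 : 0 <= 1 + M by rewrite addr_ge0 // ltW.
have neq : \forall t \near t0^', t != t0 by exact: nbhs_dnbhs_neq.
have lim f : inv_alg rG k H f -> exists c : R, f (z t) @[t --> t0^'] --> c.
  elim=> [c|e f' /andP[e0 ek] He fH|f1 f2 _ [c1 H1] _ [c2 H2]|
    f1 f2 _ [c1 H1] _ [c2 H2]].
  - by exists c; exact: cvg_cst.
  - have [C C0 HC] := hompol_bound He.
    have [r /= r0 Hr] := (nbhs_ballP _ _).1 (near_oo tab).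
    have fle s : `|s - t0| < r -> `|f' (y s)| <= C * (1 + M) ^+ e * `|s - t0| ^+ e.
      move=> sr; rewrite -mulrA -exprMn; apply: HC => [|j].
        by rewrite mulr_ge0.
      by apply: yle; apply: Hr; rewrite /ball /= distrC.
    have Hf := UC_le ek (Hy f' (hompol_polfun He) fH).
    have [c Hc] := UC_leading_term (i := tt) tab e0 Hf r0 fle.
    exists c; apply/cvgrPdist_le => e' e'0; have [d d0 Hd] := Hc e' e'0.
    have nd : \forall t \near t0^', `|t - t0| < d.
      apply: nbhs_dnbhs; apply/nbhs_ballP; exists d => //= t.
      by rewrite /ball /= distrC.
    apply: filterS2 neq nd => t tn /Hd.
    have tt0 : 0 < `|t - t0| by rewrite normr_gt0 subr_eq0.
    rewrite -ler_pdivrMr ?exprn_gt0 // -normrX -normf_div mulrBl.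
    have -> : f' (z t) = f' (y t) / (t - t0) ^+ e.
      by rewrite (hompol_scale _ _ He) exprVn mulrC.
    by rewrite mulfK ?expf_neq0 ?subr_eq0 // distrC.
  - by exists (c1 + c2); exact: cvgD.
  - by exists (c1 * c2); exact: cvgM.
have [v cv] : exists v, cluster (z t @[t --> t0^']) v.
  pose K : set V := [set v | forall j, v ord0 j \in `[- (1 + M), 1 + M]%R].
  have cK : compact K.
    apply: (@rV_compact _ _ (fun=> `[- (1 + M), 1 + M]%classic)) => _.
    exact: segment_compact.
  have [|v [_ Hv]] := cK (z t @[t --> t0^']) _; last by exists v.
    apply: filterS2 neq (nbhs_dnbhs (near_oo tab)) => t tn tab'.
    move=> j; rewrite in_itv /= -ler_norml mxE normrM normfV.
    rewrite ler_pdivrMl ?normr_gt0 ?subr_eq0 // mulrC.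
    exact: yle.
exists v => e e0.
have pd := polfun_orbit_dist H v; have id := invfun_orbit_dist v HG.
have [c Hc] := lim _ (gen _ pd id).
have c0 : c = 0.
  apply: contrapT => /eqP cn; have c2 : 0 < `|c| / 2 by rewrite divr_gt0 ?normr_gt0.
  have A : \forall t \near t0^', `|c - orbit_dist H v (z t)| < `|c| / 2.
    by move/cvgrPdist_lt : Hc => /(_ _ c2).
  have B : \forall y \near v, `|0 - orbit_dist H v y| < `|c| / 2.
    by have := polfun_near v pd c2; rewrite orbit_dist0.
  have [y' [Ay By]] := cv [set y | `|c - orbit_dist H v y| < `|c| / 2] _ A B.
  have : `|c| <= `|c - orbit_dist H v y'| + `|0 - orbit_dist H v y'|.
    by rewrite sub0r normrN -{1}(subrK (orbit_dist H v y') c) ler_normD.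
  by move: Ay By => /= Ay By; lra.
rewrite c0 in Hc; move/cvgrPdist_lt : Hc => /(_ (e ^+ #|H|)).
rewrite exprn_gt0 // => /(_ isT); apply: filterS => t.
rewrite sub0r normrN => H1; apply: orbit_dist_lt => //.
by apply: le_lt_trans H1; exact: ler_norm.
Qed.

(** Within this distance of the orbit of [v], a continuous curve cannot change the
   point of the orbit that it is close to. *)
Definition branch_radius H v e0 :=
  forall p q (z : R -> V), p < q ->
    (forall t y, p < t < q -> {for t, continuous (fun s => dist2 (z s) y)}) ->
    (forall t, p < t < q -> exists2 h, h \in H & dist2 (z t) (v *m rG h) < e0) ->
    exists2 h, h \in H & forall t e, p < t < q -> e <= e0 ->
      (exists2 h', h' \in H & dist2 (z t) (v *m rG h') < e) ->
      dist2 (z t) (v *m rG h) < e.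

Lemma orbit_branch H v : H \subset G ->
  exists2 e0 : R, 0 < e0 & branch_radius H v e0.
Proof.
move=> HG; have inG := fintype.subsetP HG.
pose D : R := \big[Order.min/1]_(h in H | v *m rG h != v) dist2 (v *m rG h) v.
have D0 : 0 < D.
  apply/bigmin_gtP; split=> // h /andP[hH hv].
  by rewrite dot_gt0 // subr_eq0.
have sep h h' : h \in H -> h' \in H -> v *m rG h != v *m rG h' ->
    D <= dist2 (v *m rG h) (v *m rG h').
  move=> hH h'H hh'.
  rewrite -(dist2_act _ _ (groupVr (inG _ h'H))) actK ?inG // -actM ?groupV ?inG //.
  have hP : (h * h'^-1 \in H)%g && (v *m rG (h * h'^-1)%g != v).
    rewrite groupM ?groupV //=; apply: contra hh' => /eqP E.
    by rewrite -{2}E actM ?groupV ?inG // actKV ?inG.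
  exact: (@bigmin_le_cond _ _ _ _ (h * h'^-1)%g (fun h => (h \in H) && (v *m rG h != v))
    (fun h => dist2 (v *m rG h) v) hP).
(* The squared distance to the orbit stays below [D / 8], so that to a given
   point of the orbit never equals [D / 4]: by [dist2_triangle] another point
   would then be closer than [D]. *)
exists (D / 8); first by rewrite divr_gt0.
move=> p q z pq zc Hz; pose t1 := (p + q) / 2.
have t1pq : p < t1 < q by rewrite /t1; apply/andP; split; lra.
have [h hH hz] := Hz t1 t1pq; exists h => // t e tpq eD [h' h'H h'z].
have side : dist2 (z t) (v *m rG h) < D / 4.
  apply: (@same_side _ (fun s => dist2 (z s) (v *m rG h)) p q (D / 4) t1 t _ _ t1pq tpq).
  - by move=> s spq; exact: zc.
  - move=> s spq; have [g gH gz] := Hz s spq.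
    have [E|hg] := eqVneq (v *m rG h) (v *m rG g).
      by rewrite E; apply/eqP => E'; rewrite E' in gz; lra.
    have := sep _ _ hH gH hg; have := dist2_triangle (v *m rG h) (z s) (v *m rG g).
    rewrite (dist2C (v *m rG h) (z s)) => H1 H2.
    by apply/eqP => E'; rewrite E' in H1; lra.
  - by lra.
have [->//|hh'] := eqVneq (v *m rG h) (v *m rG h').
have := sep _ _ hH h'H hh'; have := dist2_triangle (v *m rG h) (z t) (v *m rG h').
by rewrite (dist2C (v *m rG h) (z t)) => H1 H2; exfalso; lra.
Qed.

End OrbitDistance.

Section Existence.
Context {R : realType} {gT : finGroupType} {G : {group gT}} {m : nat}.
Variable rG : mx_representation R G m.
Hypothesis rG_orth : orthogonal_repr rG.
Notation V := 'rV[R]_m.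
Implicit Types (H : {group gT}) (f : V -> R) (v w : V) (s t a b r e : R).
Local Notation orbit_UC := (orbit_UC rG).
Local Notation avg := (avg rG).
Local Notation generated := (generated rG).
Local Notation same_orbit := (same_orbit rG).
Local Notation diff_lift := (diff_lift rG).
Local Notation local_lift := (local_lift rG).
Local Notation branch_radius := (branch_radius rG).

Lemma continuous_dist2_quotient (u : R -> V) d t t0 v : t != t0 -> vder u t d ->
  {for t, continuous (fun s => dist2 ((s - t0)^-1 *: u s) v)}.
Proof.
move=> tt0 Hu.
have -> : (fun s => dist2 ((s - t0)^-1 *: u s) v) =
    fun s => \sum_j ((s - t0)^-1 * u s 0 j - v 0 j) *
                    ((s - t0)^-1 * u s 0 j - v 0 j).
  by apply/funext => s; rewrite /dist2 dotE; apply: eq_bigr => j _; rewrite !mxE.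
apply: continuous_sum_at => j.
have H : {for t, continuous (fun s => (s - t0)^-1 * u s 0 j - v 0 j)}.
  apply: cvgB; last exact: cvg_cst.
  apply: cvgM; last exact: is_derive_continuous (Hu j).
  apply: cvgV; first by rewrite subr_eq0.
  by apply: cvgB; [exact: cvg_id | exact: cvg_cst].
by apply: cvgM; exact: H.
Qed.

(** The difference quotient of the lift is continuous away from [t0] and its
   orbits converge to that of [v], so it converges to one point of that orbit. *)
Lemma one_sided_slope H (y u : R -> V) v t0 p q : H \subset G -> p < q ->
  (forall t, p < t < q -> t != t0) -> diff_lift H y p q u ->
  (forall e, 0 < e -> \forall t \near t0^',
     exists2 h, h \in H & dist2 (((t - t0)^-1 *: y t) *m rG h) v < e) ->
  forall e0, 0 < e0 -> branch_radius H v e0 ->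
  (forall t, p < t < q ->
     exists2 h, h \in H & dist2 (((t - t0)^-1 *: y t) *m rG h) v < e0) ->
  exists2 h, h \in H & forall e, 0 < e -> \forall t \near t0, p < t < q ->
    dist2 ((t - t0)^-1 *: (u t *m rG h)) v < e.
Proof.
move=> HG pq tn Hu Hv e0 e00 branch He0; have inG := fintype.subsetP HG.
have tr t e : p < t < q ->
    (exists2 h, h \in H & dist2 (((t - t0)^-1 *: y t) *m rG h) v < e) ->
    exists2 h, h \in H & dist2 ((t - t0)^-1 *: u t) (v *m rG h) < e.
  move=> tpq [h hH hd]; have [[g gH ug] _] := Hu t tpq.
  exists (h^-1 * g)%g; first by rewrite groupM ?groupV.
  rewrite ug scalemxAl actM ?inG ?groupV // dist2_act ?inG //.
  by rewrite -(dist2_act rG_orth _ _ (inG h hH)) actKV ?inG.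
have [||h hH Hh] := branch p q (fun t => (t - t0)^-1 *: u t) pq.
- move=> t w tpq; have [_ [d Hd]] := Hu t tpq.
  exact: continuous_dist2_quotient (tn t tpq) Hd.
- by move=> t tpq; apply: tr => //; exact: He0.
exists h^-1%g; first by rewrite groupV.
move=> e e_gt0; have : 0 < Num.min e e0 by rewrite lt_min e_gt0.
move=> /Hv; rewrite near_withinE; apply: filterS => t Ht tpq.
have := Hh t (Num.min e e0) tpq; rewrite ge_min lexx orbT => /(_ isT).
have := tr t (Num.min e e0) tpq (Ht (tn t tpq)) => H1 /(_ H1).
rewrite lt_min => /andP[H2 _].
rewrite scalemxAl -(actK rG v (inG h hH)) dist2_act //.
by rewrite groupV inG.
Qed.

(** Let [v] be the limit of the rescaled curve. If it is zero, the curve of orbits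
   is stationary at [t0]; otherwise the zero is isolated, and group elements
   applied to the lifts on both sides make [v] the derivative from either side. *)
Lemma local_lift_at_zero k H a b (y : R -> V) t0 : H \subset G ->
  generated k H -> (1 < k)%N -> orbit_UC k H a b (fun _ : unit => y) ->
  (forall t, a < t < b -> y t != 0 -> local_lift H y t) ->
  a < t0 < b -> y t0 = 0 ->
  local_lift H y t0 \/ forall e, 0 < e ->
    \forall t \near t0, dot (y t) (y t) <= e * (t - t0) ^+ 2.
Proof.
move=> HG gen k1 Hy loc tab y0; have inG := fintype.subsetP HG.
have [v Hv] := blowup_converges rG_orth HG gen k1 Hy tab y0.
have [v0|vn] := eqVneq v 0; [right | left].
  move=> e e0; have := Hv e e0; rewrite near_withinE; apply: filterS => t.
  have [->|tt0] := eqVneq t t0.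
    by rewrite y0 dot0l subrr expr0n mulr0.
  move=> /(_ isT)[h hH]; rewrite v0 /dist2 subr0 dot_act ?inG //.
  have t2 : 0 < (t - t0) ^+ 2 by rewrite exprn_even_gt0 //= subr_eq0.
  rewrite dotZl dotZr mulrA -expr2 exprVn ltr_pdivrMl // mulrC.
  exact: ltW.
have [e0 e00 branch] := orbit_branch rG_orth v HG.
have near1 : \forall t \near t0^', (exists2 h, h \in H &
    dist2 (((t - t0)^-1 *: y t) *m rG h) v < Num.min e0 (dot v v)).
  by apply: Hv; rewrite lt_min e00 dot_gt0.
have /nbhs_ballP[d /= d0 Hd] : \forall t \near t0, (t != t0 ->
    exists2 h, h \in H & dist2 (((t - t0)^-1 *: y t) *m rG h) v <
      Num.min e0 (dot v v)) /\ a < t < b.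
  by apply: filterI; [move: near1; rewrite near_withinE | exact: near_oo tab].
have {}Hd t : t0 - d < t < t0 + d -> t != t0 -> [/\ a < t < b, y t != 0 &
    exists2 h, h \in H & dist2 (((t - t0)^-1 *: y t) *m rG h) v < e0].
  rewrite -ltr_distl => td tt0.
  have [|/(_ tt0)[h hH] hd tab'] := Hd t; first by rewrite /ball /= distrC.
  move: hd; rewrite lt_min => /andP[h1 h2]; split=> //; last by exists h.
  apply: contraTneq h2 => ->.
  rewrite scaler0 mul0mx /dist2 sub0r -scaleN1r dotZl dotZr.
  by rewrite mulN1r mulN1r opprK ltxx.
have sideL t : t0 - d < t < t0 -> t0 - d < t < t0 + d /\ t != t0.
  by move=> /andP[h1 h2]; rewrite h1 (lt_trans h2) ?ltrDl // lt_eqF.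
have sideR t : t0 < t < t0 + d -> t0 - d < t < t0 + d /\ t != t0.
  by move=> /andP[h1 h2]; rewrite h2 (lt_trans _ h1) ?gtrBl // gt_eqF.
have ltL : t0 - d < t0 by rewrite gtrBl.
have ltR : t0 < t0 + d by rewrite ltrDl.
have [uL HuL] : exists u, diff_lift H y (t0 - d) t0 u.
  apply: local_lifts_open => // t /sideL[td tn].
  by have [tab' yn _] := Hd t td tn; exact: loc.
have [uR HuR] : exists u, diff_lift H y t0 (t0 + d) u.
  apply: local_lifts_open => // t /sideR[td tn].
  by have [tab' yn _] := Hd t td tn; exact: loc.
have [hL hLH HL] : exists2 h, h \in H & forall e, 0 < e -> \forall t \near t0,
    t0 - d < t < t0 -> dist2 ((t - t0)^-1 *: (uL t *m rG h)) v < e.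
  apply: (one_sided_slope HG ltL _ HuL Hv e00 branch).
    by move=> t /sideL[].
  by move=> t /sideL[td tn]; have [] := Hd t td tn.
have [hR hRH HR] : exists2 h, h \in H & forall e, 0 < e -> \forall t \near t0,
    t0 < t < t0 + d -> dist2 ((t - t0)^-1 *: (uR t *m rG h)) v < e.
  apply: (one_sided_slope HG ltR _ HuR Hv e00 branch).
    by move=> t /sideR[].
  by move=> t /sideR[td tn]; have [] := Hd t td tn.
pose u t := if t < t0 then uL t *m rG hL else if t0 < t then uR t *m rG hR else 0.
have u0 : u t0 = 0 by rewrite /u ltxx.
exists d => //; exists u => t /andP[t1 t2]; case: (ltgtP t t0) => tt0.
- have tL : t0 - d < t < t0 by rewrite t1.
  apply: (diff_lift_ext _ (diff_lift_act HG hLH HuL) tL) => s /andP[_ s2].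
  by rewrite /u s2.
- have tR : t0 < t < t0 + d by rewrite tt0.
  apply: (diff_lift_ext _ (diff_lift_act HG hRH HuR) tR) => s /andP[s1 _].
  by rewrite /u s1 ltNge (ltW s1).
rewrite tt0; split; first by rewrite u0 y0; exact: same_orbit_refl.
exists v => j; apply/dlinP => e e_gt0.
have e2 : 0 < e ^+ 2 by rewrite exprn_gt0.
have /nbhs_ballP[d1 /= d10 Hd1] : \forall t \near t0,
    (t0 - d < t < t0 -> dist2 ((t - t0)^-1 *: (uL t *m rG hL)) v < e ^+ 2) /\
    (t0 < t < t0 + d -> dist2 ((t - t0)^-1 *: (uR t *m rG hR)) v < e ^+ 2).
  by apply: filterI; [exact: HL | exact: HR].
exists (Num.min d d1); first by rewrite lt_min d0.
move=> s; rewrite lt_min => /andP[sd sd1]; rewrite u0 mxE subr0.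
have [->|sn] := eqVneq s t0; first by rewrite u0 mxE !subrr mulr0 subr0 normr0 mulr0.
have [|HLs HRs] := Hd1 s; first by rewrite /ball /= distrC.
have sdd : t0 - d < s < t0 + d by rewrite -ltr_distl.
have {HLs HRs}us : dist2 ((s - t0)^-1 *: u s) v <= e ^+ 2.
  apply: ltW; rewrite /u; case: (ltgtP s t0) sn => // st _.
    by apply: HLs; rewrite st andbT; case/andP: sdd.
  by apply: HRs; rewrite st /=; case/andP: sdd.
have := coord_le j (ltW e_gt0) us; rewrite !mxE => H1.
have s0 : s - t0 != 0 by rewrite subr_eq0.
have -> : u s 0 j - v 0 j * (s - t0) = ((s - t0)^-1 * u s 0 j - v 0 j) * (s - t0).
  by rewrite mulrBl mulrAC mulVf // mul1r.
by rewrite normrM ler_wpM2r.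
Qed.

(** Assembling the lifts on the open set of times with a local lift; at the
   remaining times the curve of orbits is stationary. *)
Lemma lift_of_dichotomy H a b (y : R -> V) : H \subset G ->
  (forall t, a < t < b -> local_lift H y t \/ (y t = 0 /\ forall e, 0 < e ->
    \forall s \near t, dot (y s) (y s) <= e * (s - t) ^+ 2)) ->
  exists u, diff_lift H y a b u.
Proof.
move=> HG dich; have inG := fintype.subsetP HG.
pose O := [set t | a < t < b /\ local_lift H y t].
have oO : open O.
  rewrite openE => t [tab [e e0 [u Hu]]].
  have te : t - e < t < t + e by rewrite gtrBl ltrDl e0.
  apply: filterS2 (near_oo tab) (near_oo te) => s sab se; split=> //.
  pose d := Num.min (s - (t - e)) (t + e - s).
  exists d; first by rewrite lt_min !subr_gt0 andbC andbC.
  exists u; apply: diff_lift_sub Hu.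
    have : d <= s - (t - e) by rewrite ge_min lexx.
    by lra.
  have : d <= t + e - s by rewrite ge_min lexx orbT.
  by lra.
have [u Hu] : exists u, forall t, O t ->
    same_orbit H (y t) (u t) /\ exists d, vder u t d.
  by apply: (@local_lifts_open_set _ _ _ _ _ _ HG y a b) oO _ => t [].
pose u' t := if `[< O t >] then u t else 0.
have u'O t : O t -> u' t = u t by move=> /asboolP Ot; rewrite /u' Ot.
exists u' => t tab; have [Ot|nOt] := pselect (O t).
  have [ut [d Hd]] := Hu t Ot; rewrite u'O //; split=> //; exists d.
  apply: vder_ext Hd; apply: filterS (open_nbhs_nbhs (conj oO Ot)) => s Os.
  by rewrite u'O.
have u't : u' t = 0 by rewrite /u'; case: asboolP.
have [lt|[yt0 small]] := dich t tab; first by case: nOt.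
rewrite u't yt0; split; first exact: same_orbit_refl.
exists 0 => j; apply/dlinP => e e0; have e2 : 0 < e ^+ 2 by rewrite exprn_gt0.
have /nbhs_ballP[d /= d0 Hd] := small _ e2.
exists d => // s sd; rewrite u't !mxE subr0 mul0r subr0 /u'.
case: asboolP => Os; last by rewrite mxE normr0 mulr_ge0 // ltW.
apply: coord_le; first by rewrite mulr_ge0 // ltW.
have [[h hH ->] _] := Hu s Os.
rewrite dot_act ?inG // exprMn real_normK ?num_real //.
by apply: Hd; rewrite /ball /= distrC.
Qed.

(** Induction on the group. The average of the curve has invariant components and
   is subtracted; where the rest does not vanish, a slice reduces to a proper
   subgroup. *)
Lemma lift_exists k H a b (x : R -> V) : H \subset G -> generated k H ->
  orbit_UC k H a b (fun _ : unit => x) -> exists u, diff_lift H x a b u.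
Proof.
have [n] := ubnP #|H|; elim: n H a b x => // n IH H a b x; rewrite ltnS => Hn.
move=> HG gen Hx.
have avgd t : a < t < b -> exists d, vder (fun s => x s *m avg H) t d.
  move=> tab; have /choice[d Hd] j : exists dj : R,
      is_derive t 1 (fun s => (x s *m avg H) 0 j) dj.
    have k0 := generated_degree_gt0 rG_orth j HG gen.
    have := orbit_UC_avg_coord j HG Hx; case: (k) k0 => // k' _ [_ [df Hdf _]].
    by exists (df tt t); exact: (Hdf tt t tab).
  by exists (\row_j d j) => j; rewrite mxE.
have [triv|/existsNP[y0 /eqP yn]] := pselect (forall y : V, y *m avg H = y).
  exists x => t tab; split; first exact: same_orbit_refl.
  have [d Hd] := avgd t tab; exists d.
  by apply: vder_ext_oo tab _ Hd => s _; rewrite triv.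
have k1 := generated_degree_gt1 rG_orth HG gen yn.
pose y t := x t - x t *m avg H.
have Hy : orbit_UC k H a b (fun _ : unit => y) by exact: orbit_UC_compl.
have loc t : a < t < b -> y t != 0 -> local_lift H y t.
  move=> tab yt; have [d d0 [x' [Hx' HS]]] := local_slice rG_orth HG (ltnW k1) Hy tab.
  have [|||u Hu] := IH _ _ _ _ _ _ _ HS.
  - by rewrite (leq_trans _ Hn) // card_stab_lt // avg_compl.
  - exact: fintype.subset_trans (stab_sub rG H (y t)) HG.
  - exact: generated_stab.
  exists d => //; exists u => s sd; have [[h hS us] Hd] := Hu s sd; split=> //.
  apply: same_orbit_trans (Hx' s) _ => //.
  by exists h => //; exact: (fintype.subsetP (stab_sub rG H (y t))).
have [|u Hu] := @lift_of_dichotomy H a b y HG.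
  move=> t tab; have [yt0|yt] := eqVneq (y t) 0; last by left; exact: loc.
  have [lt|st] := local_lift_at_zero HG gen k1 Hy loc tab yt0; first by left.
  by right.
exists (fun t => u t + x t *m avg H) => t tab.
have [[h hH ut] [d Hd]] := Hu t tab; have [d' Hd'] := avgd t tab; split.
  exists h => //; rewrite ut mulmxBl -(mulmxA (x t)) avg_actr // subrK.
  by [].
by exists (d + d'); exact: vderD.
Qed.

End Existence.

(** * Lifting curves of class C^k *)

Section Coordinates.
Context {R : realType} {n : nat}.
Implicit Types (f : R -> 'rV[R]_n) (t : R).

Lemma derivable_vder f t : derivable f t 1 -> vder f t (derive1 f t).
Proof.
move=> Hf j; rewrite derive1E derive_mx // mxE.
by apply: derivableP; exact: (derivable_mxP _ _ _).1.
Qed.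

Lemma vder_derivable f t d : vder f t d -> derivable f t 1.
Proof. by move=> Hf; apply/derivable_mxP => i j; rewrite ord1; have [] := Hf j. Qed.

Lemma class_C_UC k f i a b : class_C k f -> UC k a b (fun (_ : unit) t => f t 0 i).
Proof.
move=> [Hd Hc].
have bnd (g : R -> 'rV[R]_n) : continuous g ->
    exists M : R, forall t, a < t < b -> `|g t 0 i| <= M.
  move=> cg.
  have cgi : continuous (fun t => g t 0 i : R).
    move=> t; apply: (@continuous_comp _ _ _ g (fun w : 'rV[R]_n => w 0 i)).
      exact: cg.
    exact: coord_continuous.
  have := compact_bounded (continuous_compact (continuous_subspaceT cgi)
    (@segment_compact R a b)).
  move=> [M [_ /(_ (M + 1))]]; rewrite ltrDl ltr01 => /(_ isT) HM.
  exists (M + 1) => t /andP[t1 t2]; apply: HM.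
  by exists t => //=; rewrite in_itv /= !ltW.
have cont j : (j <= k)%N -> continuous (derive1n j f).
  rewrite leq_eqVlt => /orP[/eqP->//|jk] t.
  exact/differentiable_continuous/derivable1_diffP/Hd.
suff H l j : (j + l = k)%N -> UC l a b (fun (_ : unit) t => derive1n j f t 0 i).
  by have := H k 0%N (add0n k).
elim: l j => [|l IH] j jl.
  by split=> //; have [|M HM] := bnd _ (cont j _); [rewrite -jl leq_addr | exists M].
split.
  by have [|M HM] := bnd _ (cont j _); [rewrite -jl leq_addr | exists M].
exists (fun (_ : unit) t => derive1n j.+1 f t 0 i); last by apply: IH; rewrite addSnnS.
move=> _ t _; rewrite derive1nS; apply: derivable_vder; apply: Hd.
by rewrite -jl addnS ltnS leq_addr.
Qed.

End Coordinates.

Section Lifting.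
Context {R : realType} {gT : finGroupType} {G : {group gT}} {m : nat}.
Variable rG : mx_representation R G m.
Hypothesis rG_orth : orthogonal_repr rG.
Notation V := 'rV[R]_m.
Implicit Types (t a b : R).

(** The generators being polynomials, all invariants are as regular along a curve
   of orbits as its image under the orbit map. *)
Lemma orbit_UC_class_C n (sigma : n.-tuple (mpoly.mpoly m R)) k
    (c : R -> 'rV[R]_n) (x : R -> V) a b :
  generates_invariants rG sigma -> class_C k c ->
  (forall t, orbit_map sigma (x t) = c t) ->
  orbit_UC rG k G a b (fun _ : unit => x).
Proof.
move=> Hgen Hc Hx f pf fG; have [q Hq] := invfun_generators Hgen pf fG.
apply: (@UC_ext _ _ k a b (fun (_ : unit) t => \sum_(e <- mpoly.msupp q)
   mpoly.mcoeff e q * \prod_i poly_fun (tnth (in_tuple sigma) i) (x t) ^+ e i)).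
  by move=> _ t _; rewrite Hq.
apply: UC_sum => e _; apply: UC_mul; first exact: UC_cst.
apply: UC_prod => i _; apply: UC_exp.
have := class_C_UC (cast_ord (size_tuple sigma) i) a b Hc.
apply: UC_ext => _ t _; rewrite -Hx mxE; congr (poly_fun _ _).
by rewrite !(tnth_nth 0).
Qed.

Lemma euclidean_norm_le (v : V) (C : R) : (forall j, `|v 0 j| <= C) ->
  euclidean_norm v <= Num.sqrt (\sum_(j < m) C ^+ 2).
Proof.
move=> vC; rewrite /euclidean_norm ler_wsqrtr // mxE; apply: ler_sum => j _.
rewrite mxE -expr2 -[X in X <= _]real_normK ?num_real // ler_sqr ?nnegrE //.
exact: le_trans (vC j).
Qed.

(** The velocities at all times of a compact set are bounded simultaneously: this
   is the bound at the origin for the family of all translates. *)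
Lemma diff_lift_locally_bounded k (u : R -> V) : generated rG k G ->
  (forall a b, orbit_UC rG k G a b (fun _ : unit => u)) ->
  (forall t, derivable u t 1) -> locally_bounded (derive1 u).
Proof.
move=> gen Hu Hd K /compact_bounded [A [_ /(_ (A + 1))]].
rewrite ltrDl ltr01 => /(_ isT) HA.
pose I := {t : R | K t}.
have inA (s : I) (t : R) : -1 < t < 1 -> - (A + 2) < sval s + 1 * t < A + 2.
  case: s => s Ks /=; have : `|s| <= A + 1 := HA s Ks.
  by rewrite ler_norml => /andP[s1 s2] /andP[t1 t2]; apply/andP; split; lra.
have [||C HC] := @deriv_boundedP _ _ _ _ _ rG_orth k G (subxx _) gen I
  (fun s t => u (sval s + t)) (fun s t => derive1 u (sval s + t)) 1 ltr01.
- move=> f pf fG; have C1 (s : I) : `|1 : R| <= 1 by rewrite normr1.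
  apply: UC_ext (UC_affine (fun _ : I => tt) C1 inA (Hu _ _ f pf fG)).
  by move=> s t _; rewrite mul1r.
- move=> s t _ j; have := derivable_vder (Hd (sval s + t)) j.
  rewrite -{1}[t]mul1r => /is_derive_aff; rewrite mul1r.
  by under eq_fun do rewrite mul1r.
exists (Num.sqrt (\sum_(j < m) C ^+ 2)) => t Kt; apply: euclidean_norm_le => j.
by have := HC (exist _ t Kt) j; rewrite /= addr0.
Qed.

Lemma class_C_lift n (sigma : n.-tuple (mpoly.mpoly m R)) k (c : R -> 'rV[R]_n) :
  minimal_homog_generators rG sigma -> (max_degree sigma <= k)%N ->
  (forall t, range (orbit_map sigma) (c t)) -> class_C k c ->
  exists cbar : R -> V,
    [/\ forall t, orbit_map sigma (cbar t) = c t,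
        forall t, derivable cbar t 1 &
        locally_bounded (cbar^`())].
Proof.
move=> Hmin Hk c_im Hc; have [_ Hgen _] := Hmin; have gen := generated_top Hmin Hk.
have /choice[x Hx] : forall t, exists v, orbit_map sigma v = c t.
  by move=> t; have [v _ vt] := c_im t; exists v.
have Hxk a b : orbit_UC rG k G a b (fun _ : unit => x).
  exact: orbit_UC_class_C Hgen Hc Hx.
have [t|u Hu] := @local_lifts_global _ _ _ _ rG G (subxx _) x.
  by exists 1 => //; exact: (lift_exists rG_orth (subxx _) gen).
have {}Hu t : same_orbit rG G (x t) (u t) /\ exists d, vder u t d.
  by apply: (Hu (t - 1) (t + 1)); rewrite gtrBl ltrDl ltr01.
have Hd t : derivable u t 1 by have [_ [d /vder_derivable]] := Hu t.
exists u; split=> //.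
  move=> t; have [[g gG ->] _] := Hu t; rewrite -Hx; apply/rowP => i; rewrite !mxE.
  by have [inv _] := Hgen; apply: inv => //; exact: mem_tnth.
apply: (diff_lift_locally_bounded gen) => // a b.
by apply: orbit_UC_same_orbit (Hxk a b) => t _; have [] := Hu t.
Qed.

End Lifting.

Theorem theorem8p1 (R : realType) (gT : finGroupType) (G : {group gT})
    (m : nat) (rG : mx_representation R G m) (rG_orth : orthogonal_repr rG)
    (n : nat) (sigma : n.-tuple (mpoly.mpoly m R))
    (sigma_min : minimal_homog_generators rG sigma)
    (l : nat) (U : 'I_l -> 'M[R]_m)
    (U_dec : orthogonal_irreducible_decomposition rG U)
    (v : 'I_l -> 'rV[R]_m)
    (v_max : forall i, maximal_isotropy rG (U i) (v i))
    (k : nat)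
    (k_def : k = maxn (max_degree sigma)
                      (\max_(i < l) (#|G| %/ #|rstab rG (v i)|))%N)
    (c : R -> 'rV[R]_n)
    (c_im : forall t, range (orbit_map sigma) (c t))
    (c_Ck : class_C k c) :
  exists cbar : R -> 'rV[R]_m,
    [/\ forall t, orbit_map sigma (cbar t) = c t,
        forall t, derivable cbar t 1 &
        locally_bounded (cbar^`())].
Proof.
apply: (class_C_lift rG_orth sigma_min _ c_im c_Ck).
by rewrite k_def leq_maxl.
Qed.
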